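(* Let $n\geq 0$ be an integer and let $a_0,a_1,\dots,a_n$ be complex numbers, not all zero. Define \[ \phi_F(t)=e^{-2\pi\cosh t}\Bigg(\sum_{m=0}^{n}a_m e^{-2\pi m e^{t}}\Bigg)\Bigg(\sum_{m=0}^{n}\overline{a_m}\, e^{-2\pi m e^{-t}}\Bigg),\qquad t\in\mathbb{R}, \] the entire function $\Xi_F(s)=\int_{-\infty}^{\infty}\phi_F(t)e^{ist}\,dt$, and $C_F(s)=\Xi_F(-is)$. Let \[ \psi_F(s)=\pi^{-s}\sum_{m=0}^{n}a_m(2m+1)^{-s}, \] let $P(y)=\sum_{m=0}^{n}a_m y^m$, and let $k\geq 0$ be the integer such that $P(1)=P'(1)=\cdots=P^{(k-1)}(1)=0$ and $P^{(k)}(1)\neq 0$. Let $\Delta_*<\Delta_{**}$ be positive real numbers and suppose that $\psi_F(s-k)$ has no zeros in the strip $-\Delta_{**}<\operatorname{Re} s<\Delta_*$. Let $\delta$ satisfy $0<\delta<\Delta_*$. Then all but finitely many zeros of $C_F(s)$ lying in $|\operatorname{Re} s|\leq\delta$ are on the line $\operatorname{Re} s=0$ and are simple.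
   Context: The functions $\Xi_F$ are approximations (introduced by H. Ki) of the Ramanujan $\Xi$-function; $k$ is the order of vanishing of the polynomial $P$ at $y=1$. *)

(* Defs.v *)
From Stdlib Require Import Reals.
From Coquelicot Require Import Coquelicot.
Open Scope R_scope.

Definition Cexp (z : C) : C :=
  (exp (Re z) * cos (Im z), exp (Re z) * sin (Im z)).

Definition Cpow_neg (x : R) (s : C) : C := Cexp (Cmult (RtoC (- ln x)) s).

Definition phiF (n : nat) (a : nat -> C) (t : R) : C :=
  Cmult (RtoC (exp (- 2 * PI * cosh t)))
   (Cmult (sum_n (fun m => Cmult (a m) (RtoC (exp (- 2 * PI * INR m * exp t)))) n)
          (sum_n (fun m => Cmult (Cconj (a m)) (RtoC (exp (- 2 * PI * INR m * exp (- t))))) n)).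

Definition psiF (n : nat) (a : nat -> C) (s : C) : C :=
  Cmult (Cpow_neg PI s) (sum_n (fun m => Cmult (a m) (Cpow_neg (2 * INR m + 1) s)) n).

Fixpoint falling (m j : nat) : nat :=
  match j with O => 1%nat | S j' => (m - j') * falling m j' end%nat.

(* P^{(j)}(1) for P(y) = sum_{m<=n} a_m y^m: (d/dy)^j y^m = m^{(j)} y^{m-j} at y = 1 *)
Definition Pderiv_at1 (n : nat) (a : nat -> C) (j : nat) : C :=
  sum_n (fun m => Cmult (RtoC (INR (falling m j))) (a m)) n.

Definition simple_zero (f : C -> C) (z : C) : Prop :=
  f z = RtoC 0 /\ exists l : C, l <> RtoC 0 /\ @is_derive C_AbsRing C_NormedModule f z l.

(* Main.v *)
Require Import Defs.
From Stdlib Require Import Reals Factorial List Lra Lia ClassicalEpsilon.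
From Coquelicot Require Import Coquelicot.
Open Scope R_scope.

(* Expanding the product, C_F is a double sum of terms a_m conj(a_l) I(s) with
   I(s) = int exp(- al e^t - be e^(-t) + s t) dt, al = pi (2m+1), be = pi (2l+1).
   Both I and G_{al,be}(s) = sum_j (-be)^j / j! Gamma(s - j) al^(j - s) satisfy
   al I(s+1) = s I(s) + be I(s-1), and comparing Casoratians at s -> +oo and s -> -oo gives
   I(s) = G_{al,be}(s) + G_{be,al}(-s) for nonreal s. Hence C_F(s) = G(s) + conj G(- conj s),
   where G(s) is a nonzero multiple of Gamma(s-k) psi_F(s-k) (1 + O(1/|s|)) because the
   moments sum_l a_l (2l+1)^j vanish for j < k and not for j = k. Since psi_F(s-k) is bounded
   below on the strip and Re (Gamma'/Gamma) is large for large |Im s|, |G| increases with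
   Re s there, at a definite exponential rate. So |G(s)| <> |G(- conj s)| off the imaginary
   axis, and near it |C_F| grows at least linearly in Re s, which makes the zeros simple. *)

(** Analytic facts are drawn from recurrences, limits of sequences and Taylor expansions, without
    contour integrals or Stirling's formula. So [Gam] is Euler's limit, and |Gamma(s + h)| is
    compared with |Gamma(s)| factor by factor in finite products; [entire_at] asks for a Taylor
    expansion with geometric remainder for every radius, which yields isolated zeros and the minimum
    modulus principle. The connection formula is a uniqueness statement: a solution of the
    recurrence that is proportional both to the one minimal at +oo and to the one minimal at -oo
    vanishes, since these two are independent. Real s is excluded there because the G terms can have
    poles; the bounded part of the strip only contributes finitely many zeros anyway. The strip is
    unbounded, so the lower bound for psi_F needs a compactness found elsewhere: vertical
    translation only rotates the coefficients, and the rotations lie in a compact torus. The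
    cofactor of Gamma in G is not monotone in Re s, only Lipschitz and bounded below; it is absorbed
    because the growth rate of Gamma can be made as large as desired. *)

Implicit Types (al be : R) (s z : C) (n k : nat).

(** * Complex exponentials, finite sums and limits *)

Ltac rmin_le :=
  first [apply Rmin_l | apply Rmin_r
    | eapply Rle_trans; [apply Rmin_l|solve [rmin_le]]
    | eapply Rle_trans; [apply Rmin_r|solve [rmin_le]]].

Ltac rmax_le :=
  first [apply Rmax_l | apply Rmax_r
    | eapply Rle_trans; [|apply Rmax_l]; solve [rmax_le]
    | eapply Rle_trans; [|apply Rmax_r]; solve [rmax_le]].

Ltac cmod_ring r := match goal with |- context [Cmod ?z] => replace z with r by ring end.

Lemma C_ext (x y : C) : Re x = Re y -> Im x = Im y -> x = y.
Proof. destruct x, y; simpl; intros; subst; reflexivity. Qed.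

Lemma Im_Cplus (x y : C) : Im (x + y)%C = Im x + Im y.
Proof. reflexivity. Qed.

Lemma Re_Cplus (x y : C) : Re (x + y)%C = Re x + Re y.
Proof. reflexivity. Qed.

Lemma Cmod_sub_rev (x y : C) : Cmod x - Cmod y <= Cmod (x - y)%C.
Proof.
  assert (H := Cmod_triangle (x - y) y).
  replace (x - y + y)%C with x in H by ring. lra.
Qed.

Lemma Cmod_minus_sym (x y : C) : Cmod (x - y)%C = Cmod (y - x)%C.
Proof. rewrite <- Cmod_opp. f_equal. ring. Qed.

Lemma Cmod_dist3 (x y z : C) : Cmod (x - z)%C <= Cmod (x - y)%C + Cmod (y - z)%C.
Proof.
  replace (x - z)%C with ((x - y) + (y - z))%C by ring. apply Cmod_triangle.
Qed.

Lemma Cmod_Im z : Rabs (Im z) <= Cmod z.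
Proof.
  eapply Rle_trans; [|apply Rmax_Cmod]. apply Rmax_r.
Qed.

Lemma Cmod_le_ReIm z : Cmod z <= Rabs (Re z) + Rabs (Im z).
Proof.
  assert (H := Cmod_triangle (RtoC (Re z)) (Ci * RtoC (Im z))%C).
  rewrite Cmod_mult, !Cmod_R in H.
  replace (RtoC (Re z) + Ci * RtoC (Im z))%C with z in H.
  - replace (Cmod Ci) with 1 in H; [lra|].
    unfold Cmod, Ci; simpl. rewrite <- sqrt_1 at 1. f_equal. ring.
  - destruct z; apply C_ext; simpl; ring.
Qed.

Lemma Cmod_pos_neq z : 0 < Cmod z -> z <> 0%C.
Proof. intros H E. rewrite E, Cmod_0 in H. lra. Qed.

Lemma Im_neq0 z : Im z <> 0 -> z <> 0%C.
Proof. intros H E. apply H. rewrite E. reflexivity. Qed.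

Lemma exp_monotone (x y : R) : x <= y -> exp x <= exp y.
Proof. intros [H|H]; [left; apply exp_increasing, H|rewrite H; lra]. Qed.

Lemma Cexp_0 : Cexp 0%C = 1%C.
Proof. unfold Cexp; simpl. rewrite exp_0, cos_0, sin_0. apply C_ext; simpl; ring. Qed.

Lemma Cexp_plus (x y : C) : Cexp (x + y)%C = (Cexp x * Cexp y)%C.
Proof.
  unfold Cexp. rewrite Re_Cplus, Im_Cplus, exp_plus, cos_plus, sin_plus.
  apply C_ext; simpl; ring.
Qed.

Lemma Cmod_Cexp (x : C) : Cmod (Cexp x) = exp (Re x).
Proof.
  unfold Cmod, Cexp, fst, snd.
  assert (H := exp_pos (Re x)). assert (K := sin2_cos2 (Im x)).
  rewrite <- (sqrt_pow2 (exp (Re x))) at 3 by lra.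
  f_equal. rewrite <- (Rmult_1_r (exp (Re x) ^ 2)), <- K. unfold Rsqr. ring.
Qed.

Lemma Cexp_neq0 (x : C) : Cexp x <> 0%C.
Proof. apply Cmod_pos_neq. rewrite Cmod_Cexp. apply exp_pos. Qed.

Lemma Cexp_R (x : R) : Cexp (RtoC x) = RtoC (exp x).
Proof. unfold Cexp; simpl. rewrite cos_0, sin_0. apply C_ext; simpl; ring. Qed.

Lemma Cexp_opp (x : C) : Cexp (- x)%C = (/ Cexp x)%C.
Proof.
  assert (H := Cexp_neq0 x).
  assert (E : (Cexp x * Cexp (- x) = 1)%C).
  { rewrite <- Cexp_plus. replace (x + - x)%C with (RtoC 0) by ring. apply Cexp_0. }
  replace (Cexp (- x)) with (Cexp x * Cexp (- x) * / Cexp x)%C by (field; auto).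
  rewrite E. ring.
Qed.

Lemma Cexp_conj (x : C) : Cexp (Cconj x) = Cconj (Cexp x).
Proof.
  destruct x. unfold Cexp, Cconj; simpl. rewrite cos_neg, sin_neg. apply C_ext; simpl; ring.
Qed.

Lemma Cpow_neg_plus (x : R) (s w : C) :
  Cpow_neg x (s + w)%C = (Cpow_neg x s * Cpow_neg x w)%C.
Proof. unfold Cpow_neg. rewrite <- Cexp_plus. f_equal. ring. Qed.

Lemma Cpow_neg_neq0 (x : R) s : Cpow_neg x s <> 0%C.
Proof. apply Cexp_neq0. Qed.

Lemma Cpow_neg_opp (x : R) s : Cpow_neg x (- s)%C = (/ Cpow_neg x s)%C.
Proof. unfold Cpow_neg. rewrite <- Cexp_opp. f_equal. ring. Qed.

Lemma Cpow_neg_1 (x : R) : 0 < x -> Cpow_neg x 1%C = RtoC (/ x).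
Proof.
  intros H. unfold Cpow_neg.
  replace (RtoC (- ln x) * 1)%C with (RtoC (- ln x)) by ring.
  rewrite Cexp_R, exp_Ropp, exp_ln by lra. reflexivity.
Qed.

Lemma Cpow_neg_conj (x : R) s : Cpow_neg x (Cconj s) = Cconj (Cpow_neg x s).
Proof.
  unfold Cpow_neg. rewrite <- Cexp_conj. f_equal.
  destruct s; apply C_ext; simpl; ring.
Qed.

Lemma Cmod_Cpow_neg (x : R) s : Cmod (Cpow_neg x s) = exp (- ln x * Re s).
Proof. unfold Cpow_neg. rewrite Cmod_Cexp. f_equal. destruct s; simpl. ring. Qed.

(** * Finite sums *)

Fixpoint csum (f : nat -> C) n : C :=
  match n with O => 0%C | S p => (csum f p + f p)%C end.

Lemma sum_n_csum (f : nat -> C) n : sum_n f n = csum f (S n).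
Proof.
  induction n as [|n IH].
  - rewrite sum_O. simpl. ring.
  - rewrite sum_Sn, IH. reflexivity.
Qed.

Lemma csum_ext (f g : nat -> C) n :
  (forall i, (i < n)%nat -> f i = g i) -> csum f n = csum g n.
Proof.
  induction n as [|n IH]; intros H; simpl; [reflexivity|].
  rewrite IH, H; auto.
Qed.

Lemma csum_plus (f g : nat -> C) n :
  csum (fun i => f i + g i)%C n = (csum f n + csum g n)%C.
Proof. induction n as [|n IH]; simpl; [|rewrite IH]; ring. Qed.

Lemma csum_minus (f g : nat -> C) n :
  csum (fun i => f i - g i)%C n = (csum f n - csum g n)%C.
Proof. induction n as [|n IH]; simpl; [|rewrite IH]; ring. Qed.

Lemma csum_scal (c : C) (f : nat -> C) n :
  csum (fun i => c * f i)%C n = (c * csum f n)%C.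
Proof. induction n as [|n IH]; simpl; [|rewrite IH]; ring. Qed.

Lemma csum_scal_r (c : C) (f : nat -> C) n :
  csum (fun i => f i * c)%C n = (csum f n * c)%C.
Proof. induction n as [|n IH]; simpl; [|rewrite IH]; ring. Qed.

Lemma csum_conj (f : nat -> C) n :
  Cconj (csum f n) = csum (fun i => Cconj (f i)) n.
Proof.
  induction n as [|n IH]; simpl.
  - apply C_ext; simpl; ring.
  - rewrite <- IH. apply Cplus_conj.
Qed.

Lemma csum_zero (f : nat -> C) n :
  (forall i, (i < n)%nat -> f i = 0%C) -> csum f n = 0%C.
Proof.
  induction n as [|n IH]; intros H; simpl; [reflexivity|].
  rewrite IH, H; auto. ring.
Qed.

Lemma csum_S_l (f : nat -> C) n :
  csum f (S n) = (f O + csum (fun i => f (S i)) n)%C.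
Proof. induction n as [|n IH]; [simpl; ring|]. simpl in *. rewrite IH. ring. Qed.

Lemma csum_swap (f : nat -> nat -> C) (n m : nat) :
  csum (fun i => csum (f i) m) n = csum (fun j => csum (fun i => f i j) n) m.
Proof.
  induction n as [|n IH]; simpl.
  - symmetry. apply csum_zero. reflexivity.
  - rewrite IH, <- csum_plus. reflexivity.
Qed.

Lemma csum_mult (f g : nat -> C) (n m : nat) :
  (csum f n * csum g m)%C = csum (fun i => csum (fun j => f i * g j)%C m) n.
Proof.
  rewrite <- csum_scal_r. apply csum_ext. intros i _. rewrite csum_scal. reflexivity.
Qed.

Fixpoint rsum (f : nat -> R) n : R :=
  match n with O => 0 | S p => rsum f p + f p end.

Lemma csum_Cmod_le (f : nat -> C) (g : nat -> R) n :
  (forall i, (i < n)%nat -> Cmod (f i) <= g i) -> Cmod (csum f n) <= rsum g n.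
Proof.
  induction n as [|n IH]; intros H; simpl; [rewrite Cmod_0; lra|].
  eapply Rle_trans; [apply Cmod_triangle|].
  apply Rplus_le_compat; auto.
Qed.

Lemma rsum_le (f g : nat -> R) n :
  (forall i, (i < n)%nat -> f i <= g i) -> rsum f n <= rsum g n.
Proof.
  induction n as [|n IH]; intros H; simpl; [lra|].
  apply Rplus_le_compat; auto.
Qed.

Lemma rsum_scal (c : R) (f : nat -> R) n :
  rsum (fun i => c * f i) n = c * rsum f n.
Proof. induction n as [|n IH]; simpl; [|rewrite IH]; ring. Qed.

Lemma rsum_scal_r (c : R) (f : nat -> R) n :
  rsum (fun i => f i * c) n = rsum f n * c.
Proof. induction n as [|n IH]; simpl; [|rewrite IH]; ring. Qed.

Lemma rsum_nonneg (f : nat -> R) n : (forall i, 0 <= f i) -> 0 <= rsum f n.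
Proof. intros H. induction n; simpl; [lra|]. specialize (H n). lra. Qed.

Lemma rsum_exp_le (x : R) n :
  0 <= x -> rsum (fun i => x ^ i / INR (fact i)) n <= exp x.
Proof.
  intros H. destruct n as [|n]; [simpl; left; apply exp_pos|].
  eapply Rle_trans; [|apply (exp_ge_taylor x n H)].
  apply Req_le. induction n as [|n IH]; [simpl; ring|].
  rewrite tech5, <- IH. reflexivity.
Qed.

Lemma pow_fact_le_exp (x : R) n : 0 <= x -> x ^ n / INR (fact n) <= exp x.
Proof.
  intros H. eapply Rle_trans; [|apply (rsum_exp_le x (S n) H)].
  simpl. assert (0 <= rsum (fun i => x ^ i / INR (fact i)) n); [|lra].
  apply rsum_nonneg. intros i. apply Rle_mult_inv_pos; [apply pow_le; auto|apply INR_fact_lt_0].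
Qed.

(** * Limits of complex sequences *)

Definition Clim (u : nat -> C) (l : C) : Prop :=
  forall eps, 0 < eps -> exists N, forall n, (N <= n)%nat -> Cmod (u n - l)%C < eps.

Lemma Clim_ext_ev (u v : nat -> C) (l : C) (N : nat) :
  (forall n, (N <= n)%nat -> u n = v n) -> Clim u l -> Clim v l.
Proof.
  intros E H eps He. destruct (H eps He) as [M HM].
  exists (max N M). intros n Hn. rewrite <- E by lia. apply HM. lia.
Qed.

Lemma Clim_ext (u v : nat -> C) (l : C) :
  (forall n, u n = v n) -> Clim u l -> Clim v l.
Proof. intros E. apply (Clim_ext_ev _ _ _ 0). auto. Qed.

Lemma Clim_const (c : C) : Clim (fun _ => c) c.
Proof.
  intros eps He. exists O. intros. replace (c - c)%C with (RtoC 0) by ring.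
  rewrite Cmod_0. exact He.
Qed.

Lemma Clim_squeeze (u : nat -> C) (l : C) (v : nat -> R) :
  (exists N, forall n, (N <= n)%nat -> Cmod (u n - l)%C <= v n) ->
  is_lim_seq v 0 -> Clim u l.
Proof.
  intros [N E] H eps He.
  apply is_lim_seq_spec in H. destruct (H (mkposreal eps He)) as [M HM]. simpl in HM.
  exists (max N M). intros n Hn.
  assert (A := HM n ltac:(lia)). rewrite Rminus_0_r in A.
  apply Rabs_def2 in A. assert (B := E n ltac:(lia)). lra.
Qed.

Lemma Clim_unique (u : nat -> C) (l l' : C) : Clim u l -> Clim u l' -> l = l'.
Proof.
  intros H H'. destruct (Ceq_dec l l') as [e|ne]; [exact e|exfalso].
  assert (P : 0 < Cmod (l - l')).
  { apply Cmod_gt_0. intros E. apply ne.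
    replace l with (l - l' + l')%C by ring. rewrite E. ring. }
  destruct (H (Cmod (l - l') / 2) ltac:(lra)) as [N HN].
  destruct (H' (Cmod (l - l') / 2) ltac:(lra)) as [M HM].
  specialize (HN (max N M) ltac:(lia)). specialize (HM (max N M) ltac:(lia)).
  assert (A := Cmod_dist3 l (u (max N M)) l').
  rewrite (Cmod_minus_sym l (u _)) in A. lra.
Qed.

Lemma Clim_plus (u v : nat -> C) (a b : C) :
  Clim u a -> Clim v b -> Clim (fun n => u n + v n)%C (a + b)%C.
Proof.
  intros H K eps He.
  destruct (H (eps / 2) ltac:(lra)) as [N HN]. destruct (K (eps / 2) ltac:(lra)) as [M HM].
  exists (max N M). intros n Hn.
  cmod_ring ((u n - a) + (v n - b))%C.
  eapply Rle_lt_trans; [apply Cmod_triangle|].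
  specialize (HN n ltac:(lia)). specialize (HM n ltac:(lia)). lra.
Qed.

Lemma Clim_mult (u v : nat -> C) (a b : C) :
  Clim u a -> Clim v b -> Clim (fun n => u n * v n)%C (a * b)%C.
Proof.
  intros H K eps He.
  assert (Pa := Cmod_ge_0 a). assert (Pb := Cmod_ge_0 b).
  set (e := Rmin 1 (eps / (Cmod a + Cmod b + 2))).
  assert (P : 0 < eps / (Cmod a + Cmod b + 2)) by (apply Rdiv_lt_0_compat; lra).
  assert (e1 : e <= 1) by apply Rmin_l.
  assert (e2 : e <= eps / (Cmod a + Cmod b + 2)) by apply Rmin_r.
  assert (e0 : 0 < e) by (apply Rmin_glb_lt; lra).
  destruct (H e e0) as [N HN]. destruct (K e e0) as [M HM].
  exists (max N M). intros n Hn.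
  replace (u n * v n - a * b)%C
    with ((u n - a) * (v n - b) + (u n - a) * b + a * (v n - b))%C by ring.
  specialize (HN n ltac:(lia)). specialize (HM n ltac:(lia)).
  eapply Rle_lt_trans; [eapply Rle_trans; [apply Cmod_triangle|]; apply Rplus_le_compat_r, Cmod_triangle|].
  rewrite !Cmod_mult.
  set (x := Cmod (u n - a)) in *. set (y := Cmod (v n - b)) in *.
  assert (Px : 0 <= x) by apply Cmod_ge_0. assert (Py : 0 <= y) by apply Cmod_ge_0.
  assert (e * (Cmod a + Cmod b + 2) <= eps) by (apply Rle_div_r; lra).
  assert (x * y <= e * 1) by (apply Rmult_le_compat; lra).
  assert (x * Cmod b <= e * Cmod b) by (apply Rmult_le_compat_r; lra).
  assert (Cmod a * y <= Cmod a * e) by (apply Rmult_le_compat_l; lra).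
  lra.
Qed.

Lemma Clim_scal (c : C) (u : nat -> C) (a : C) :
  Clim u a -> Clim (fun n => c * u n)%C (c * a)%C.
Proof. intros H. apply Clim_mult; [apply Clim_const|exact H]. Qed.

Lemma Clim_minus (u v : nat -> C) (a b : C) :
  Clim u a -> Clim v b -> Clim (fun n => u n - v n)%C (a - b)%C.
Proof.
  intros H K. apply (Clim_scal (- (1))%C) in K.
  replace (a - b)%C with (a + - (1) * b)%C by ring.
  eapply Clim_ext; [|apply Clim_plus; [apply H|apply K]]. intros n. simpl. ring.
Qed.

Lemma Clim_inv (u : nat -> C) (a : C) :
  a <> 0%C -> Clim u a -> Clim (fun n => / u n)%C (/ a)%C.
Proof.
  intros Ha H eps He. assert (Pa := proj1 (Cmod_gt_0 a) Ha).
  assert (P2 : 0 < eps * (Cmod a * Cmod a / 2)).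
  { apply Rmult_lt_0_compat; [lra|]. apply Rdiv_lt_0_compat; [|lra]. apply Rmult_lt_0_compat; lra. }
  destruct (H (Cmod a / 2) ltac:(lra)) as [N HN].
  destruct (H _ P2) as [M HM].
  exists (max N M). intros n Hn.
  specialize (HN n ltac:(lia)). specialize (HM n ltac:(lia)).
  assert (Pu : Cmod a / 2 < Cmod (u n)).
  { assert (A := Cmod_sub_rev a (u n)). rewrite (Cmod_minus_sym a) in A. lra. }
  assert (Hu : u n <> 0%C) by (apply Cmod_pos_neq; lra).
  replace (/ u n - / a)%C with (- (u n - a) * / (u n * a))%C by (field; auto).
  rewrite Cmod_mult, Cmod_opp, Cmod_inv by (apply Cmult_neq_0; auto). rewrite Cmod_mult.
  apply (Rmult_lt_reg_r (Cmod (u n) * Cmod a)); [apply Rmult_lt_0_compat; lra|].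
  rewrite Rmult_assoc, Rinv_l by (apply Rgt_not_eq, Rmult_lt_0_compat; lra).
  rewrite Rmult_1_r. eapply Rlt_le_trans; [exact HM|].
  apply Rmult_le_compat_l; [lra|]. replace (Cmod a * Cmod a / 2) with (Cmod a / 2 * Cmod a) by field.
  apply Rmult_le_compat_r; lra.
Qed.

Lemma Clim_S (u : nat -> C) (a : C) : Clim u a -> Clim (fun n => u (S n)) a.
Proof.
  intros H eps He. destruct (H eps He) as [N HN]. exists N. intros. apply HN. lia.
Qed.

Lemma Clim_S_inv (u : nat -> C) (a : C) : Clim (fun n => u (S n)) a -> Clim u a.
Proof.
  intros H eps He. destruct (H eps He) as [N HN]. exists (S N). intros n Hn.
  destruct n; [lia|]. apply HN. lia.
Qed.

Lemma Clim_conj (u : nat -> C) (a : C) :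
  Clim u a -> Clim (fun n => Cconj (u n)) (Cconj a).
Proof.
  intros H eps He. destruct (H eps He) as [N HN]. exists N. intros n Hn.
  rewrite <- Cminus_conj, Cmod_conj. auto.
Qed.

Lemma Clim_Cmod_le (u : nat -> C) (a : C) (B : R) :
  (exists N, forall n, (N <= n)%nat -> Cmod (u n) <= B) -> Clim u a -> Cmod a <= B.
Proof.
  intros [N E] H. apply Rnot_lt_le. intros C0.
  destruct (H (Cmod a - B) ltac:(lra)) as [M HM].
  specialize (HM (max N M) ltac:(lia)). specialize (E (max N M) ltac:(lia)).
  assert (A := Cmod_sub_rev a (u (max N M))). rewrite (Cmod_minus_sym a) in A. lra.
Qed.

Lemma Clim_Cmod (u : nat -> C) (a : C) : Clim u a -> is_lim_seq (fun n => Cmod (u n)) (Cmod a).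
Proof.
  intros H. apply is_lim_seq_spec. intros [eps He]. destruct (H eps He) as [N HN].
  exists N. intros n Hn. simpl. specialize (HN n Hn).
  assert (A := Cmod_sub_rev a (u n)). assert (B := Cmod_sub_rev (u n) a).
  rewrite (Cmod_minus_sym a) in A. apply Rabs_def1; lra.
Qed.

Lemma Clim_R (u : nat -> R) (a : R) : is_lim_seq u a <-> Clim (fun n => RtoC (u n)) (RtoC a).
Proof.
  split; intros H.
  - apply is_lim_seq_spec in H. intros eps He. destruct (H (mkposreal eps He)) as [N HN].
    exists N. intros n Hn. rewrite <- RtoC_minus, Cmod_R. apply HN; auto.
  - apply is_lim_seq_spec. intros [eps He]. destruct (H eps He) as [N HN].
    exists N. intros n Hn. specialize (HN n Hn). rewrite <- RtoC_minus, Cmod_R in HN. exact HN.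
Qed.

Lemma Clim_Cauchy (u : nat -> C) :
  (forall eps, 0 < eps -> exists N, forall n m, (N <= n)%nat -> (n <= m)%nat ->
     Cmod (u m - u n)%C < eps) -> exists l, Clim u l.
Proof.
  intros H.
  assert (K : forall p : C -> R, (forall x y, Rabs (p x - p y) <= Cmod (x - y)%C) ->
     exists l : R, is_lim_seq (fun n => p (u n)) l).
  { intros p Hp.
    assert (K : Cauchy_crit (fun n => p (u n))).
    { intros eps He. destruct (H eps He) as [N HN]. exists N. intros n m Hn Hm.
      unfold Rdist. eapply Rle_lt_trans; [apply Hp|].
      destruct (Nat.le_ge_cases n m); [rewrite Cmod_minus_sym|]; apply HN; lia. }
    destruct (Rcomplete.R_complete _ K) as [l Hl].
    exists l. apply is_lim_seq_Reals. exact Hl. }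
  destruct (K Re) as [a Ha].
  { intros x y. apply (re_le_Cmod (x - y)). }
  destruct (K Im) as [b Hb].
  { intros x y. apply (Cmod_Im (x - y)). }
  exists (a, b).
  apply (Clim_squeeze _ _ (fun n => Rabs (Re (u n) - a) + Rabs (Im (u n) - b))).
  - exists O. intros n _. apply (Cmod_le_ReIm (u n - (a, b))%C).
  - replace (Finite 0) with (Finite (0 + 0)) by (f_equal; ring).
    apply is_lim_seq_plus'; rewrite <- Rabs_R0 at 1; apply (is_lim_seq_abs _ (Finite 0)).
    + replace (Finite 0) with (Finite (a - a)) by (f_equal; ring).
      apply is_lim_seq_minus'; [exact Ha|apply is_lim_seq_const].
    + replace (Finite 0) with (Finite (b - b)) by (f_equal; ring).
      apply is_lim_seq_minus'; [exact Hb|apply is_lim_seq_const].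
Qed.

Definition Climit (u : nat -> C) : C := epsilon (inhabits (RtoC 0)) (Clim u).

Lemma Climit_correct (u : nat -> C) (l : C) : Clim u l -> Clim u (Climit u).
Proof. intros H. apply (epsilon_spec (inhabits (RtoC 0)) (Clim u)). exists l. exact H. Qed.

Lemma Climit_eq (u : nat -> C) (l : C) : Clim u l -> Climit u = l.
Proof. intros H. eapply Clim_unique; [eapply Climit_correct|]; exact H. Qed.

(** * Derivatives along the real line and Taylor remainders of the exponential *)

Definition Cderiv (F : R -> C) (x : R) (l : C) : Prop :=
  is_derive (fun t => Re (F t)) x (Re l) /\ is_derive (fun t => Im (F t)) x (Im l).

Lemma Cderiv_ext (F G : R -> C) (x : R) (l : C) :
  (forall t, F t = G t) -> Cderiv F x l -> Cderiv G x l.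
Proof.
  intros E [H K]. split; (eapply is_derive_ext; [|eassumption]); intros t; simpl; rewrite E; reflexivity.
Qed.

Lemma Cderiv_plus (F G : R -> C) (x : R) (l m : C) :
  Cderiv F x l -> Cderiv G x m -> Cderiv (fun t => F t + G t)%C x (l + m)%C.
Proof.
  intros [H1 H2] [K1 K2]. split.
  - apply (is_derive_plus (fun t => Re (F t)) (fun t => Re (G t)) x (Re l) (Re m) H1 K1).
  - apply (is_derive_plus (fun t => Im (F t)) (fun t => Im (G t)) x (Im l) (Im m) H2 K2).
Qed.

Lemma Cderiv_minus (F G : R -> C) (x : R) (l m : C) :
  Cderiv F x l -> Cderiv G x m -> Cderiv (fun t => F t - G t)%C x (l - m)%C.
Proof.
  intros [H1 H2] [K1 K2]. split.
  - apply (is_derive_minus (fun t => Re (F t)) (fun t => Re (G t)) x (Re l) (Re m) H1 K1).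
  - apply (is_derive_minus (fun t => Im (F t)) (fun t => Im (G t)) x (Im l) (Im m) H2 K2).
Qed.

Lemma Cderiv_RtoC_mult (r : R -> R) (r' x : R) (c : C) :
  is_derive r x r' -> Cderiv (fun t => RtoC (r t) * c)%C x (r' * c)%C.
Proof.
  intros H. split.
  - apply (is_derive_ext (fun t => r t * Re c)); [intros t; simpl; unfold Re; ring|].
    replace (Re (r' * c)) with (r' * Re c) by (simpl; unfold Re; ring).
    apply (is_derive_scal_l r x r' (Re c) H).
  - apply (is_derive_ext (fun t => r t * Im c)); [intros t; simpl; unfold Im; ring|].
    replace (Im (r' * c)) with (r' * Im c) by (simpl; unfold Im; ring).
    apply (is_derive_scal_l r x r' (Im c) H).
Qed.

Lemma Cderiv_csum (F G : nat -> R -> C) (x : R) n :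
  (forall i, (i < n)%nat -> Cderiv (F i) x (G i x)) ->
  Cderiv (fun t => csum (fun i => F i t) n) x (csum (fun i => G i x) n).
Proof.
  induction n as [|n IH]; intros H; simpl.
  - split; apply (is_derive_const (V := R_NormedModule) 0 x).
  - apply Cderiv_plus; auto.
Qed.

Lemma deriv_nonneg_le (g g' : R -> R) (a b : R) : a <= b ->
  (forall x, a <= x <= b -> is_derive g x (g' x)) ->
  (forall x, a <= x <= b -> 0 <= g' x) -> g a <= g b.
Proof.
  intros Hab Hg Hpos.
  destruct (MVT_gen g a b g') as [c [Hc E]]; rewrite Rmin_left, Rmax_right in * by lra.
  - intros x Hx. apply Hg. lra.
  - intros x Hx. apply continuity_pt_filterlim, (ex_derive_continuous (V := R_NormedModule)).
    exists (g' x). apply Hg, Hx.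
  - assert (P : 0 <= g' c * (b - a)) by (apply Rmult_le_pos; [apply Hpos, Hc|lra]). lra.
Qed.

(** Projecting on the direction [D] of the total increment reduces the claim to the monotonicity of
    a real function, [m * g] minus the inner product of [D] and [F]. *)
Lemma Cderiv_mean_value (F F' : R -> C) (g g' : R -> R) (a b : R) :
  a <= b ->
  (forall x, a <= x <= b -> Cderiv F x (F' x)) ->
  (forall x, a <= x <= b -> is_derive g x (g' x)) ->
  (forall x, a <= x <= b -> Cmod (F' x) <= g' x) ->
  Cmod (F b - F a)%C <= g b - g a.
Proof.
  intros Hab HF Hg Hle.
  set (D := (F b - F a)%C). set (m := Cmod D).
  assert (Hm : 0 <= m) by apply Cmod_ge_0.
  assert (P := deriv_nonneg_le (fun x => m * g x - (Re D * Re (F x) + Im D * Im (F x)))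
    (fun x => m * g' x - (Re D * Re (F' x) + Im D * Im (F' x))) a b Hab).
  assert (Q : m * m = Re D * Re (F b) + Im D * Im (F b) - (Re D * Re (F a) + Im D * Im (F a))).
  { unfold m. replace (Cmod D * Cmod D) with (Cmod D ^ 2) by ring.
    unfold Cmod. rewrite pow2_sqrt by nra. unfold D. simpl. unfold Re, Im. ring. }
  destruct (Req_dec m 0) as [m0|m0].
  - assert (G := deriv_nonneg_le g g' a b Hab Hg). rewrite m0.
    cut (g a <= g b); [lra|]. apply G. intros x Hx.
    eapply Rle_trans; [apply Cmod_ge_0|apply Hle, Hx].
  - apply (Rmult_le_reg_l m); [lra|]. cbv beta in P. cut (0 <= m * (g b - g a) - m * m); [lra|].
    rewrite Q. cut (m * g a - (Re D * Re (F a) + Im D * Im (F a)) <= m * g b - (Re D * Re (F b) + Im D * Im (F b)));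
      [lra|]. apply P; intros x Hx.
    + destruct (HF x Hx) as [H1 H2].
      apply (is_derive_minus (V := R_NormedModule)); [|apply (is_derive_plus (V := R_NormedModule))];
        apply is_derive_scal; [apply Hg, Hx|exact H1|exact H2].
    + assert (B := re_le_Cmod (Cconj D * F' x)%C). rewrite Cmod_mult, Cmod_conj in B.
      fold m in B. apply Rabs_le_between in B.
      replace (Re (Cconj D * F' x)) with (Re D * Re (F' x) + Im D * Im (F' x)) in B
        by (simpl; unfold Re, Im; ring).
      assert (m * Cmod (F' x) <= m * g' x) by (apply Rmult_le_compat_l; auto). lra.
Qed.

Lemma Cderiv_Cexp (w : C) (x : R) :
  Cderiv (fun t => Cexp (t * w)%C) x (w * Cexp (x * w))%C.
Proof.
  destruct w as [u v]. split.
  - apply (is_derive_ext (fun t => exp (t * u) * cos (t * v))).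
    + intros t. simpl. f_equal; f_equal; ring.
    + auto_derive; [auto|]. unfold Cexp; simpl.
      replace (x * u - 0 * v) with (x * u) by ring.
      replace (x * v + 0 * u) with (x * v) by ring. ring.
  - apply (is_derive_ext (fun t => exp (t * u) * sin (t * v))).
    + intros t. simpl. f_equal; f_equal; ring.
    + auto_derive; [auto|]. unfold Cexp; simpl.
      replace (x * u - 0 * v) with (x * u) by ring.
      replace (x * v + 0 * u) with (x * v) by ring. ring.
Qed.

Definition cexp_taylor (w : C) n : C :=
  csum (fun j => w ^ j / INR (fact j))%C n.

Lemma RtoC_neq0 (x : R) : x <> 0 -> RtoC x <> RtoC 0.
Proof. intros H E. apply H. now inversion E. Qed.

Lemma fact_C_neq0 n : RtoC (INR (fact n)) <> RtoC 0.
Proof. apply RtoC_neq0, INR_fact_neq_0. Qed.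

(** Induction through the mean value inequality: along t -> t w, the derivative of the remainder of
    order n + 1 is w times the remainder of order n at t w. *)
Lemma cexp_taylor_bound n (w : C) :
  Cmod (Cexp w - cexp_taylor w n)%C <= Cmod w ^ n / INR (fact n) * exp (Cmod w).
Proof.
  revert w. induction n as [|n IH]; intros w.
  - unfold cexp_taylor. simpl. replace (Cexp w - 0)%C with (Cexp w) by ring.
    rewrite Cmod_Cexp.
    replace (1 / 1 * exp (Cmod w)) with (exp (Cmod w)) by field.
    assert (A := re_le_Cmod w). apply Rabs_le_between in A.
    apply exp_monotone. lra.
  - set (F := fun t : R => (Cexp (t * w) - cexp_taylor (t * w) (S n))%C).
    set (F' := fun t : R => (w * (Cexp (t * w) - cexp_taylor (t * w) n))%C).
    set (c := Cmod w ^ S n / INR (fact (S n)) * exp (Cmod w)).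
    assert (Pf := INR_fact_lt_0 n). assert (Pf' := INR_fact_lt_0 (S n)).
    assert (Pw := Cmod_ge_0 w).
    assert (B : Cmod (F 1 - F 0)%C <= c * 1 ^ S n - c * 0 ^ S n).
    { apply (Cderiv_mean_value F F' (fun t => c * t ^ S n) (fun t => c * (INR (S n) * t ^ n))).
      - lra.
      - intros x _. unfold F, F'.
        apply (Cderiv_ext (fun t => Cexp (t * w) -
           (csum (fun j => RtoC (t ^ S j) * (w ^ S j / INR (fact (S j))))%C n + 1))%C).
        { intros t. f_equal. f_equal. unfold cexp_taylor. rewrite csum_S_l, Cplus_comm. f_equal.
          - simpl. field.
          - apply csum_ext. intros i _. rewrite Cpow_mult_l, RtoC_pow. field. apply fact_C_neq0. }
        replace (w * (Cexp (x * w) - cexp_taylor (x * w) n))%C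
          with (w * Cexp (x * w) -
           (csum (fun j => RtoC (INR (S j) * x ^ j) * (w ^ S j / INR (fact (S j))))%C n + 0))%C.
        + apply Cderiv_minus; [apply Cderiv_Cexp|].
          apply Cderiv_plus; [|split; apply (is_derive_const (V := R_NormedModule))].
          apply (Cderiv_csum (fun j t => RtoC (t ^ S j) * (w ^ S j / INR (fact (S j))))%C
             (fun j t => RtoC (INR (S j) * t ^ j) * (w ^ S j / INR (fact (S j))))%C).
          intros i _. apply Cderiv_RtoC_mult. auto_derive; [auto|]. apply Rmult_1_l.
        + replace (csum (fun j => RtoC (INR (S j) * x ^ j) * (w ^ S j / INR (fact (S j))))%C n)
            with (w * cexp_taylor (x * w) n)%C; [ring|].
          unfold cexp_taylor. rewrite <- csum_scal. apply csum_ext. intros i _.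
          rewrite RtoC_mult, RtoC_pow, Cpow_mult_l, Cpow_S.
          rewrite fact_simpl, mult_INR, RtoC_mult. field. split; [apply fact_C_neq0|].
          apply RtoC_neq0, not_0_INR. lia.
      - intros x _. auto_derive; [auto|]. rewrite Rmult_1_l; reflexivity.
      - intros x Hx. unfold F'. rewrite Cmod_mult.
        eapply Rle_trans; [apply Rmult_le_compat_l; [apply Cmod_ge_0|apply IH]|].
        rewrite Cmod_mult, Cmod_R, Rabs_pos_eq by lra. unfold c.
        rewrite fact_simpl, mult_INR.
        replace (Cmod w ^ S n / (INR (S n) * INR (fact n)) * exp (Cmod w) * (INR (S n) * x ^ n))
          with (Cmod w * ((x * Cmod w) ^ n / INR (fact n) * exp (Cmod w))).
        + apply Rmult_le_compat_l; [lra|]. apply Rmult_le_compat_l.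
          * apply Rle_mult_inv_pos; [|lra]. apply pow_le, Rmult_le_pos; lra.
          * apply exp_monotone. nra.
        + rewrite Rpow_mult_distr. simpl pow. field. split; [lra|]. apply not_0_INR. lia. }
    rewrite pow1, pow_i in B by lia.
    replace (F 1 - F 0)%C with (Cexp w - cexp_taylor w (S n))%C in B; [lra|].
    unfold F. replace (RtoC 1 * w)%C with w by ring. replace (RtoC 0 * w)%C with (RtoC 0) by ring.
    assert (E : cexp_taylor (RtoC 0) (S n) = RtoC 1).
    { unfold cexp_taylor. rewrite csum_S_l, csum_zero.
      - simpl. field.
      - intros i _. rewrite Cpow_S. field. apply fact_C_neq0. }
    rewrite Cexp_0, E. ring.
Qed.

(** Trades the factorial for a geometric factor through (q |z|)^n / n! <= exp (q |z|). For real z =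
    t the cost exp (2 q |t|) can be integrated against the kernels below. *)
Lemma cexp_taylor_bound_q n (h z : C) (q : R) :
  0 < q -> Cmod h <= q ->
  Cmod (Cexp (h * z) - cexp_taylor (h * z) n)%C <= (Cmod h / q) ^ n * exp (2 * q * Cmod z).
Proof.
  intros Hq Hh. eapply Rle_trans; [apply cexp_taylor_bound|].
  assert (Ph := Cmod_ge_0 h). assert (Pz := Cmod_ge_0 z). rewrite Cmod_mult.
  assert (A := pow_fact_le_exp (q * Cmod z) n ltac:(nra)).
  assert (Pq : 0 <= (Cmod h / q) ^ n) by (apply pow_le, Rle_mult_inv_pos; lra).
  replace ((Cmod h * Cmod z) ^ n / INR (fact n))
    with ((Cmod h / q) ^ n * ((q * Cmod z) ^ n / INR (fact n))).
  - rewrite Rmult_assoc. apply Rmult_le_compat_l; [exact Pq|].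
    replace (2 * q * Cmod z) with (q * Cmod z + q * Cmod z) by ring. rewrite exp_plus.
    apply Rmult_le_compat; [| |exact A|].
    + apply Rle_mult_inv_pos; [apply pow_le; nra|apply INR_fact_lt_0].
    + left; apply exp_pos.
    + apply exp_monotone, Rmult_le_compat_r; lra.
  - unfold Rdiv. rewrite !Rpow_mult_distr, pow_inv. field.
    split; [apply INR_fact_neq_0|apply pow_nonzero; lra].
Qed.

(** * Integrals over the real line *)

Definition CRInt (f : R -> C) (a b : R) (l : C) : Prop :=
  is_RInt (fun t => Re (f t)) a b (Re l) /\ is_RInt (fun t => Im (f t)) a b (Im l).

Lemma CRInt_is_RInt (f : R -> C) (a b : R) (l : C) :
  CRInt f a b l <-> is_RInt (V := C_R_NormedModule) f a b l.
Proof.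
  split.
  - intros [H K]. destruct l as [x y].
    exact (is_RInt_fct_extend_pair (U := R_NormedModule) (V := R_NormedModule) f a b x y H K).
  - intros H. split.
    + exact (is_RInt_fct_extend_fst (U := R_NormedModule) (V := R_NormedModule) f a b l H).
    + exact (is_RInt_fct_extend_snd (U := R_NormedModule) (V := R_NormedModule) f a b l H).
Qed.

Lemma CRInt_unique (f : R -> C) (a b : R) (l m : C) : CRInt f a b l -> CRInt f a b m -> l = m.
Proof.
  intros [H1 H2] [K1 K2]. apply C_ext.
  - rewrite <- (is_RInt_unique _ _ _ _ H1). apply (is_RInt_unique _ _ _ _ K1).
  - rewrite <- (is_RInt_unique _ _ _ _ H2). apply (is_RInt_unique _ _ _ _ K2).
Qed.

Lemma CRInt_ext (f g : R -> C) (a b : R) (l : C) :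
  (forall t, f t = g t) -> CRInt f a b l -> CRInt g a b l.
Proof.
  intros E [H K]. split; (eapply is_RInt_ext; [|eassumption]); intros t _; simpl; rewrite E; reflexivity.
Qed.

Lemma CRInt_plus (f g : R -> C) (a b : R) (l m : C) :
  CRInt f a b l -> CRInt g a b m -> CRInt (fun t => f t + g t)%C a b (l + m)%C.
Proof.
  intros [H1 H2] [K1 K2]. split.
  - exact (is_RInt_plus _ _ _ _ _ _ H1 K1).
  - exact (is_RInt_plus _ _ _ _ _ _ H2 K2).
Qed.

Lemma CRInt_scal (c : C) (f : R -> C) (a b : R) (l : C) :
  CRInt f a b l -> CRInt (fun t => c * f t)%C a b (c * l)%C.
Proof.
  intros [H1 H2]. split.
  - apply (is_RInt_ext (fun t => minus (scal (Re c) (Re (f t))) (scal (Im c) (Im (f t))))).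
    + intros t _. reflexivity.
    + apply (is_RInt_minus (V := R_NormedModule)); apply (is_RInt_scal (V := R_NormedModule)); assumption.
  - apply (is_RInt_ext (fun t => plus (scal (Re c) (Im (f t))) (scal (Im c) (Re (f t))))).
    + intros t _. reflexivity.
    + apply (is_RInt_plus (V := R_NormedModule)); apply (is_RInt_scal (V := R_NormedModule)); assumption.
Qed.

Lemma CRInt_flip (f : R -> C) (a : R) (l : C) :
  CRInt f (- a) a l -> CRInt (fun t => f (- t)) (- a) a l.
Proof.
  intros [H K].
  assert (F : forall (g : R -> R) (x : R), is_RInt g (- a) a x -> is_RInt (fun t => g (- t)) (- a) a x).
  { intros g x Hg. apply is_RInt_swap in Hg.
    rewrite <- (Ropp_involutive a) in Hg at 1.
    apply (is_RInt_comp_opp g (- a) a) in Hg.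
    apply (is_RInt_scal _ _ _ (- 1)) in Hg.
    apply (is_RInt_ext (fun t => scal (- 1) (opp (g (- t))))).
    - intros t _. unfold scal, opp; simpl. unfold mult; simpl. ring.
    - replace x with (scal (- 1) (opp x)); [exact Hg|].
      unfold scal, opp; simpl. unfold mult; simpl. ring. }
  split; [exact (F (fun t => Re (f t)) _ H)|exact (F (fun t => Im (f t)) _ K)].
Qed.

Lemma norm_C_R z : norm (V := C_R_NormedModule) z = Cmod z.
Proof.
  destruct z as [x y]. unfold norm; simpl. unfold prod_norm, Cmod, norm; simpl. unfold abs; simpl.
  rewrite !Rmult_1_r, <- !Rabs_mult, !Rabs_pos_eq by nra. reflexivity.
Qed.

Lemma CRInt_Cmod_le (f : R -> C) (g : R -> R) (a b : R) (l : C) (m : R) :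
  a <= b -> (forall t, Cmod (f t) <= g t) ->
  CRInt f a b l -> is_RInt g a b m -> Cmod l <= m.
Proof.
  intros Hab Hle Hf Hg. apply CRInt_is_RInt in Hf. rewrite <- norm_C_R.
  apply (norm_RInt_le (V := C_R_NormedModule) f g a b l m Hab); auto.
  intros t _. rewrite norm_C_R. apply Hle.
Qed.

(** Only the symmetric integer cutoffs are used, which makes the improper integral a limit of a
    sequence; [is_int_of_gen] connects it with the two-sided improper integral. *)
Definition is_int (f : R -> C) (l : C) : Prop :=
  forall eps, 0 < eps -> exists N, forall n, (N <= n)%nat ->
    exists y, CRInt f (- INR n) (INR n) y /\ Cmod (y - l)%C < eps.

Lemma is_int_unique (f : R -> C) (l m : C) : is_int f l -> is_int f m -> l = m.
Proof.
  intros H K. destruct (Ceq_dec l m) as [e|ne]; [exact e|exfalso].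
  assert (P : 0 < Cmod (l - m)).
  { apply Cmod_gt_0. intros E. apply ne. replace l with (l - m + m)%C by ring. rewrite E. ring. }
  destruct (H (Cmod (l - m) / 2) ltac:(lra)) as [N HN].
  destruct (K (Cmod (l - m) / 2) ltac:(lra)) as [M HM].
  destruct (HN (max N M) ltac:(lia)) as [y [Y1 Y2]].
  destruct (HM (max N M) ltac:(lia)) as [z [Z1 Z2]].
  assert (y = z) by (eapply CRInt_unique; eassumption). subst z.
  assert (A := Cmod_dist3 l y m). rewrite (Cmod_minus_sym l y) in A. lra.
Qed.

Lemma is_int_ext (f g : R -> C) (l : C) : (forall t, f t = g t) -> is_int f l -> is_int g l.
Proof.
  intros E H eps He. destruct (H eps He) as [N HN]. exists N. intros n Hn.
  destruct (HN n Hn) as [y [Y1 Y2]]. exists y. split; [|exact Y2].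
  eapply CRInt_ext; eassumption.
Qed.

Lemma is_int_plus (f g : R -> C) (l m : C) :
  is_int f l -> is_int g m -> is_int (fun t => f t + g t)%C (l + m)%C.
Proof.
  intros H K eps He. destruct (H (eps / 2) ltac:(lra)) as [N HN].
  destruct (K (eps / 2) ltac:(lra)) as [M HM].
  exists (max N M). intros n Hn.
  destruct (HN n ltac:(lia)) as [y [Y1 Y2]]. destruct (HM n ltac:(lia)) as [z [Z1 Z2]].
  exists (y + z)%C. split; [apply CRInt_plus; assumption|].
  replace (y + z - (l + m))%C with ((y - l) + (z - m))%C by ring.
  eapply Rle_lt_trans; [apply Cmod_triangle|]. lra.
Qed.

Lemma is_int_scal (c : C) (f : R -> C) (l : C) :
  is_int f l -> is_int (fun t => c * f t)%C (c * l)%C.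
Proof.
  intros H eps He. assert (P := Cmod_ge_0 c).
  destruct (H (eps / (Cmod c + 1))) as [N HN]; [apply Rdiv_lt_0_compat; lra|].
  exists N. intros n Hn. destruct (HN n Hn) as [y [Y1 Y2]].
  exists (c * y)%C. split; [apply CRInt_scal; assumption|].
  replace (c * y - c * l)%C with (c * (y - l))%C by ring. rewrite Cmod_mult.
  apply Rle_lt_trans with (Cmod c * (eps / (Cmod c + 1))).
  - apply Rmult_le_compat_l; lra.
  - apply (Rmult_lt_reg_r (Cmod c + 1)); [lra|].
    replace (Cmod c * (eps / (Cmod c + 1)) * (Cmod c + 1)) with (Cmod c * eps) by (field; lra).
    nra.
Qed.

Lemma is_int_0 : is_int (fun _ => RtoC 0) (RtoC 0).
Proof.
  intros eps He. exists O. intros n _. exists (RtoC 0). split.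
  - assert (H := is_RInt_const (V := R_NormedModule) (- INR n) (INR n) 0).
    change (is_RInt (V := R_NormedModule) (fun _ => 0) (- INR n) (INR n) ((INR n - - INR n) * 0)) in H.
    rewrite Rmult_0_r in H.
    split; exact H.
  - replace (RtoC 0 - RtoC 0)%C with (RtoC 0) by ring. rewrite Cmod_0. exact He.
Qed.

Lemma is_int_minus (f g : R -> C) (l m : C) :
  is_int f l -> is_int g m -> is_int (fun t => f t - g t)%C (l - m)%C.
Proof.
  intros H K. replace (l - m)%C with (l + - (1) * m)%C by ring.
  eapply is_int_ext; [|apply is_int_plus; [apply H|apply (is_int_scal (- (1))%C _ _ K)]].
  intros t. simpl. ring.
Qed.

Lemma is_int_csum (f : nat -> R -> C) (l : nat -> C) n :
  (forall i, (i < n)%nat -> is_int (f i) (l i)) ->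
  is_int (fun t => csum (fun i => f i t) n) (csum l n).
Proof.
  induction n as [|n IH]; intros H; simpl; [apply is_int_0|].
  apply is_int_plus; auto.
Qed.

Lemma is_int_flip (f : R -> C) (l : C) : is_int f l -> is_int (fun t => f (- t)) l.
Proof.
  intros H eps He. destruct (H eps He) as [N HN]. exists N. intros n Hn.
  destruct (HN n Hn) as [y [Y1 Y2]]. exists y. split; [|exact Y2].
  apply CRInt_flip. exact Y1.
Qed.

Lemma is_int_Cmod_le (f : R -> C) (g : R -> R) (l m : C) :
  (forall t, Cmod (f t) <= g t) -> is_int f l -> is_int (fun t => RtoC (g t)) m ->
  Cmod l <= Re m.
Proof.
  intros Hle H K. apply Rnot_lt_le. intros L.
  destruct (H ((Cmod l - Re m) / 2) ltac:(lra)) as [N HN].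
  destruct (K ((Cmod l - Re m) / 2) ltac:(lra)) as [M HM].
  destruct (HN (max N M) ltac:(lia)) as [y [Y1 Y2]].
  destruct (HM (max N M) ltac:(lia)) as [z [[Z1 _] Z2]].
  assert (A : Cmod y <= Re z).
  { apply (CRInt_Cmod_le f g _ _ y (Re z)) with (3 := Y1) (4 := Z1); auto.
    assert (B := pos_INR (max N M)). lra. }
  assert (B := re_le_Cmod (z - m)%C). apply Rabs_le_between in B.
  replace (Re (z - m)) with (Re z - Re m) in B by reflexivity.
  assert (D := Cmod_sub_rev l y). rewrite (Cmod_minus_sym l) in D. lra.
Qed.

Definition Ccont (f : R -> C) : Prop :=
  forall t, continuous (fun t => Re (f t)) t /\ continuous (fun t => Im (f t)) t.

Lemma CRInt_ex (f : R -> C) (a b : R) : Ccont f -> exists y, CRInt f a b y.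
Proof.
  intros H.
  destruct (ex_RInt_continuous (V := R_CompleteNormedModule) (fun t => Re (f t)) a b) as [x Hx].
  { intros z _. apply H. }
  destruct (ex_RInt_continuous (V := R_CompleteNormedModule) (fun t => Im (f t)) a b) as [y Hy].
  { intros z _. apply H. }
  exists (x, y). split; assumption.
Qed.

Lemma CRInt_Chasles (f : R -> C) (a b c : R) (l m : C) :
  CRInt f a b l -> CRInt f b c m -> CRInt f a c (l + m)%C.
Proof.
  intros [H1 H2] [K1 K2]. split.
  - exact (is_RInt_Chasles _ _ _ _ _ _ H1 K1).
  - exact (is_RInt_Chasles _ _ _ _ _ _ H2 K2).
Qed.

Lemma is_RInt_atan (M a b : R) :
  is_RInt (fun t => M / (1 + t ^ 2)) a b (M * atan b - M * atan a).
Proof.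
  apply (is_RInt_derive (V := R_CompleteNormedModule) (fun t => M * atan t)).
  - intros x _. auto_derive; [auto|]. field. nra.
  - intros x _. apply (ex_derive_continuous (V := R_NormedModule)). auto_derive. nra.
Qed.

Lemma atan_lim : is_lim_seq (fun n => atan (INR n)) (PI / 2).
Proof.
  apply is_lim_seq_spec. intros [eps He]. simpl.
  assert (HP := PI_RGT_0).
  set (e := Rmin eps (PI / 4)).
  assert (e1 : e <= eps) by apply Rmin_l. assert (e2 : e <= PI / 4) by apply Rmin_r.
  assert (e0 : 0 < e) by (apply Rmin_glb_lt; lra).
  destruct (INR_unbounded (tan (PI / 2 - e))) as [N HN].
  exists N. intros n Hn.
  assert (A := atan_bound (INR n)).
  assert (B : PI / 2 - e < atan (INR n)).
  { rewrite <- (atan_tan (PI / 2 - e)) by lra. apply atan_increasing.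
    apply Rlt_le_trans with (INR N); [exact HN|]. apply le_INR, Hn. }
  apply Rabs_def1; lra.
Qed.

(** The tails are controlled by those of M / (1 + t^2), whose primitive M atan converges. *)
Lemma is_int_ex (f : R -> C) (M : R) :
  Ccont f -> (forall t, Cmod (f t) <= M / (1 + t ^ 2)) -> exists l, is_int f l.
Proof.
  intros Hc Hb.
  destruct (choice (fun n y => CRInt f (- INR n) (INR n) y)) as [y Hy].
  { intros n. apply CRInt_ex, Hc. }
  assert (PM : 0 <= M).
  { assert (A := Hb 0). assert (B := Cmod_ge_0 (f 0)).
    replace (M / (1 + 0 ^ 2)) with M in A by field. lra. }
  destruct (Clim_Cauchy y) as [l Hl].
  - intros eps He.
    assert (L := atan_lim). apply is_lim_seq_spec in L.
    assert (P : 0 < eps / (2 * M + 1)) by (apply Rdiv_lt_0_compat; lra).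
    destruct (L (mkposreal _ P)) as [N HN]. simpl in HN.
    exists N. intros n m Hn Hm.
    destruct (CRInt_ex f (- INR m) (- INR n) Hc) as [u Hu].
    destruct (CRInt_ex f (INR n) (INR m) Hc) as [v Hv].
    assert (E : y m = (u + y n + v)%C).
    { eapply CRInt_unique; [apply Hy|].
      eapply CRInt_Chasles; [eapply CRInt_Chasles; [exact Hu|apply Hy]|exact Hv]. }
    assert (Hnm : INR n <= INR m) by (apply le_INR, Hm).
    assert (Hmn : - INR m <= - INR n) by lra.
    assert (Bu := CRInt_Cmod_le _ _ _ _ _ _ Hmn Hb Hu (is_RInt_atan M _ _)).
    assert (Bv := CRInt_Cmod_le _ _ _ _ _ _ Hnm Hb Hv (is_RInt_atan M _ _)).
    rewrite !atan_opp in Bu.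
    rewrite E. replace (u + y n + v - y n)%C with (u + v)%C by ring.
    eapply Rle_lt_trans; [apply Cmod_triangle|].
    assert (A := HN n Hn). apply Rabs_def2 in A.
    assert (A2 := proj2 (atan_bound (INR m))).
    apply Rle_lt_trans with (2 * M * (eps / (2 * M + 1))).
    + set (e := eps / (2 * M + 1)) in *.
      assert (M * (atan (INR m) - atan (INR n)) <= M * e) by (apply Rmult_le_compat_l; lra). lra.
    + apply (Rmult_lt_reg_r (2 * M + 1)); [lra|].
      replace (2 * M * (eps / (2 * M + 1)) * (2 * M + 1)) with (2 * M * eps) by (field; lra). nra.
  - exists l. intros eps He. destruct (Hl eps He) as [N HN]. exists N. intros n Hn.
    exists (y n). split; auto.
Qed.

Lemma is_int_FTC (F F' : R -> C) (a b : C) :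
  (forall t, Cderiv F t (F' t)) -> Ccont F' ->
  Clim (fun n => F (INR n)) a -> Clim (fun n => F (- INR n)) b ->
  is_int F' (a - b)%C.
Proof.
  intros HF Hc Ha Hb eps He.
  destruct (Clim_minus _ _ _ _ Ha Hb eps He) as [N HN].
  exists N. intros n Hn. exists (F (INR n) - F (- INR n)%R)%C. split; [|apply HN, Hn].
  split.
  - apply (is_RInt_derive (V := R_CompleteNormedModule) (fun t => Re (F t)) (fun t => Re (F' t))).
    + intros x _. apply HF.
    + intros x _. apply Hc.
  - apply (is_RInt_derive (V := R_CompleteNormedModule) (fun t => Im (F t)) (fun t => Im (F' t))).
    + intros x _. apply HF.
    + intros x _. apply Hc.
Qed.

Lemma is_int_of_gen (f : R -> C) (l : C) :
  is_RInt_gen (V := C_R_CompleteNormedModule) f (Rbar_locally m_infty) (Rbar_locally p_infty) l ->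
  is_int f l.
Proof.
  intros H eps He.
  assert (P : 0 < eps / 2) by lra.
  assert (Hloc : locally (T := C_R_CompleteNormedModule) l (fun y : C => Cmod (y - l)%C < eps)).
  { exists (mkposreal (eps / 2) P). intros y [By1 By2]. simpl in *.
    unfold ball in By1, By2; simpl in By1, By2. unfold AbsRing_ball, abs, minus, plus, opp in By1, By2; simpl in By1, By2.
    eapply Rle_lt_trans; [apply Cmod_le_ReIm|].
    unfold Rminus in *. simpl. unfold Re, Im. lra. }
  specialize (H _ Hloc). destruct H as [Q S HQ HS HQS].
  destruct HQ as [q Hq]. destruct HS as [s Hs].
  destruct (INR_unbounded (Rmax (- q) s)) as [N HN].
  exists N. intros n Hn. apply le_INR in Hn.
  assert (A := Rmax_l (- q) s). assert (B := Rmax_r (- q) s).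
  destruct (HQS (- INR n) (INR n)) as [y [Y1 Y2]].
  - apply Hq. lra.
  - apply Hs. lra.
  - exists y. split; [|exact Y2]. apply CRInt_is_RInt. exact Y1.
Qed.

Definition Cint (f : R -> C) : C := epsilon (inhabits (RtoC 0)) (is_int f).

Lemma Cint_correct (f : R -> C) (l : C) : is_int f l -> is_int f (Cint f).
Proof. intros H. apply (epsilon_spec (inhabits (RtoC 0)) (is_int f)). exists l. exact H. Qed.

(** * Bessel-type integrals *)

Definition Kexp al be s (t : R) : C :=
  Cexp (RtoC (- al * exp t - be * exp (- t)) + s * t)%C.

Definition wexp (al be x t : R) : R := exp (- al * exp t - be * exp (- t) + x * t).

Lemma Cmod_Kexp al be s (t : R) : Cmod (Kexp al be s t) = wexp al be (Re s) t.
Proof.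
  unfold Kexp, wexp. rewrite Cmod_Cexp. f_equal. destruct s; simpl. ring.
Qed.

Lemma Kexp_R (al be x t : R) : Kexp al be (RtoC x) t = RtoC (wexp al be x t).
Proof.
  unfold Kexp, wexp. rewrite <- RtoC_mult, <- RtoC_plus, Cexp_R. reflexivity.
Qed.

Lemma Kexp_shift al be (s w : C) (t : R) :
  Kexp al be (s + w)%C t = (Cexp (w * t) * Kexp al be s t)%C.
Proof. unfold Kexp. rewrite <- Cexp_plus. f_equal. ring. Qed.

Lemma Kexp_flip al be s (t : R) : Kexp al be s (- t) = Kexp be al (- s)%C t.
Proof.
  unfold Kexp. rewrite Ropp_involutive, RtoC_opp. f_equal.
  replace (- al * exp (- t) - be * exp t) with (- be * exp t - al * exp (- t)) by ring. ring.
Qed.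

Lemma exp_pow (x : R) n : exp (INR n * x) = exp x ^ n.
Proof.
  induction n as [|n IH]; [simpl; rewrite Rmult_0_l; apply exp_0|].
  rewrite S_INR, Rmult_plus_distr_r, Rmult_1_l, exp_plus, IH. simpl. ring.
Qed.

(** For an integer p > x + 1, exp u >= (u / p)^p at u = al e^t leaves a factor e^(-t) to spare, and
    1 + t^2 <= 2 e^t. *)
Lemma exp_decay_half (al x : R) : 0 < al ->
  exists M, 0 <= M /\ forall t, 0 <= t -> exp (- al * exp t + x * t) <= M / (1 + t ^ 2).
Proof.
  intros Hal. destruct (INR_unbounded (Rmax 0 (x + 1))) as [m Hm].
  assert (A1 := Rmax_l 0 (x + 1)). assert (A2 := Rmax_r 0 (x + 1)).
  set (p := INR m) in *. assert (Pp : 0 < p) by lra.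
  exists (2 * (p / al) ^ m). split.
  - assert (0 < (p / al) ^ m); [|lra]. apply pow_lt, Rdiv_lt_0_compat; lra.
  - intros t Ht.
    assert (E : (al / p * exp t) ^ m <= exp (al * exp t)).
    { replace (exp (al * exp t)) with (exp (al / p * exp t) ^ m).
      - apply pow_incr. assert (Pe := exp_pos t).
        assert (0 < al / p) by (apply Rdiv_lt_0_compat; lra).
        split; [nra|]. assert (B := exp_ineq1_le (al / p * exp t)). lra.
      - rewrite <- exp_pow. f_equal. fold p. field. lra. }
    rewrite Rpow_mult_distr in E.
    assert (E2 : exp (p * t) * exp (- al * exp t) <= (p / al) ^ m).
    { replace (exp (p * t)) with (exp t ^ m) by (rewrite <- exp_pow; f_equal; fold p; ring).
      replace (- al * exp t) with (- (al * exp t)) by ring. rewrite exp_Ropp.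
      assert (Pe := exp_pos (al * exp t)).
      apply (Rmult_le_reg_r (exp (al * exp t))); [exact Pe|].
      rewrite Rmult_assoc, Rinv_l, Rmult_1_r by lra.
      assert (Pq : 0 < (p / al) ^ m) by (apply pow_lt, Rdiv_lt_0_compat; lra).
      apply Rle_trans with ((p / al) ^ m * ((al / p) ^ m * exp t ^ m)); [|apply Rmult_le_compat_l; lra].
      rewrite <- Rmult_assoc, <- Rpow_mult_distr.
      replace (p / al * (al / p)) with 1 by (field; lra). rewrite pow1. lra. }
    assert (T := exp_ge_taylor t 2 Ht). simpl in T.
    assert (T2 : 1 + t ^ 2 <= 2 * exp t) by (simpl; lra). clear T.
    assert (Pt : 0 < 1 + t ^ 2) by (simpl; nra).
    apply Rle_div_r; [exact Pt|].
    assert (L : exp (- al * exp t + x * t) <= exp (- t) * (exp (p * t) * exp (- al * exp t))).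
    { rewrite <- !exp_plus. destruct (Req_dec t 0) as [->|t0].
      - right. f_equal. ring.
      - left. apply exp_increasing. nra. }
    assert (Pm : 0 < exp (- t)) by apply exp_pos.
    apply Rle_trans with (exp (- t) * (p / al) ^ m * (2 * exp t)).
    + apply Rmult_le_compat; [left; apply exp_pos|lra| |exact T2].
      eapply Rle_trans; [exact L|]. apply Rmult_le_compat_l; lra.
    + replace (exp (- t) * (p / al) ^ m * (2 * exp t)) with (2 * (p / al) ^ m * (exp (- t) * exp t)) by ring.
      rewrite <- exp_plus. replace (- t + t) with 0 by ring. rewrite exp_0. lra.
Qed.

(** For [be = 0] only e^(x t) provides decay at -oo; x >= 1 gives the majorant e^t there. *)
Definition integrable_params (al be x : R) : Prop := 0 < al /\ 0 <= be /\ (0 < be \/ 1 <= x).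

Lemma integrable_params_pos (al be x : R) : 0 < al -> 0 < be -> integrable_params al be x.
Proof. intros Ha Hb. split; [|split]; auto with real. Qed.

Lemma wexp_bound (al be x : R) : integrable_params al be x ->
  exists M, forall t, wexp al be x t <= M / (1 + t ^ 2).
Proof.
  intros [Ha [Hb Hx]].
  destruct (exp_decay_half al x Ha) as [M1 [P1 H1]].
  assert (K : exists M2, 0 <= M2 /\ forall t, t <= 0 -> wexp al be x t <= M2 / (1 + t ^ 2)).
  { destruct Hx as [Hx|Hx].
    - destruct (exp_decay_half be (- x) Hx) as [M2 [P2 H2]]. exists M2. split; [exact P2|].
      intros t Ht. specialize (H2 (- t) ltac:(lra)).
      replace ((- t) ^ 2) with (t ^ 2) in H2 by ring.
      eapply Rle_trans; [|exact H2]. unfold wexp. apply exp_monotone.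
      assert (Pe := exp_pos t). nra.
    - exists 2. split; [lra|]. intros t Ht.
      assert (Pt : 0 < 1 + t ^ 2) by (simpl; nra).
      apply Rle_div_r; [exact Pt|].
      assert (T := exp_ge_taylor (- t) 2 ltac:(lra)). simpl in T.
      assert (T2 : 1 + t ^ 2 <= 2 * exp (- t)) by (simpl; lra). clear T.
      assert (L : wexp al be x t <= exp t).
      { unfold wexp. apply exp_monotone.
        assert (Pe := exp_pos t). assert (Pe' := exp_pos (- t)). nra. }
      apply Rle_trans with (exp t * (2 * exp (- t))).
      + apply Rmult_le_compat; [left; apply exp_pos|lra|exact L|exact T2].
      + replace (exp t * (2 * exp (- t))) with (2 * (exp t * exp (- t))) by ring.
        rewrite <- exp_plus. replace (t + - t) with 0 by ring. rewrite exp_0. lra. }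
  destruct K as [M2 [P2 H2]]. exists (M1 + M2). intros t.
  assert (Pt : 0 < / (1 + t ^ 2)) by (apply Rinv_0_lt_compat; simpl; nra).
  unfold Rdiv in *.
  destruct (Rle_dec t 0) as [L|L].
  - eapply Rle_trans; [apply H2, L|]. nra.
  - specialize (H1 t ltac:(lra)).
    apply Rle_trans with (M1 * / (1 + t ^ 2)); [|nra].
    eapply Rle_trans; [|exact H1]. unfold wexp. apply exp_monotone.
    assert (Pe := exp_pos (- t)). nra.
Qed.

Lemma Kexp_Re al be s (t : R) :
  Re (Kexp al be s t) = wexp al be (Re s) t * cos (Im s * t).
Proof.
  destruct s as [u v]. unfold Kexp, wexp, Cexp; simpl. f_equal; f_equal; ring.
Qed.

Lemma Kexp_Im al be s (t : R) :
  Im (Kexp al be s t) = wexp al be (Re s) t * sin (Im s * t).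
Proof.
  destruct s as [u v]. unfold Kexp, wexp, Cexp; simpl. f_equal; f_equal; ring.
Qed.

Lemma Ccont_Kexp al be s : Ccont (Kexp al be s).
Proof.
  intros t. split.
  - apply (continuous_ext (fun t => wexp al be (Re s) t * cos (Im s * t))).
    + intros u. symmetry. apply Kexp_Re.
    + apply (ex_derive_continuous (V := R_NormedModule)). unfold wexp. auto_derive. auto.
  - apply (continuous_ext (fun t => wexp al be (Re s) t * sin (Im s * t))).
    + intros u. symmetry. apply Kexp_Im.
    + apply (ex_derive_continuous (V := R_NormedModule)). unfold wexp. auto_derive. auto.
Qed.

Lemma Ccont_pow_mult (f : R -> C) (j : nat) : Ccont f -> Ccont (fun t => RtoC (t ^ j) * f t)%C.
Proof.
  intros H t. destruct (H t) as [H1 H2].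
  assert (P : continuous (fun t : R => t ^ j) t).
  { apply (ex_derive_continuous (V := R_NormedModule)). auto_derive. auto. }
  split.
  - apply (continuous_ext (fun t => t ^ j * Re (f t))).
    + intros u. simpl. unfold Re. ring.
    + apply (continuous_mult (K := R_AbsRing)); assumption.
  - apply (continuous_ext (fun t => t ^ j * Im (f t))).
    + intros u. simpl. unfold Im. ring.
    + apply (continuous_mult (K := R_AbsRing)); assumption.
Qed.

Lemma Ccont_plus (f g : R -> C) : Ccont f -> Ccont g -> Ccont (fun t => f t + g t)%C.
Proof.
  intros H K t. destruct (H t) as [H1 H2]. destruct (K t) as [K1 K2]. split.
  - exact (continuous_plus (V := R_NormedModule) _ _ t H1 K1).
  - exact (continuous_plus (V := R_NormedModule) _ _ t H2 K2).
Qed.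

Lemma Ccont_scal (c : C) (f : R -> C) : Ccont f -> Ccont (fun t => c * f t)%C.
Proof.
  intros H t. destruct (H t) as [H1 H2].
  assert (A1 := continuous_scal_r (V := R_NormedModule) (Re c) _ t H1).
  assert (A2 := continuous_scal_r (V := R_NormedModule) (Im c) _ t H1).
  assert (B1 := continuous_scal_r (V := R_NormedModule) (Re c) _ t H2).
  assert (B2 := continuous_scal_r (V := R_NormedModule) (Im c) _ t H2).
  split.
  - exact (continuous_minus (V := R_NormedModule) _ _ t A1 B2).
  - exact (continuous_plus (V := R_NormedModule) _ _ t B1 A2).
Qed.

(** For [be > 0] this is 2 (be / al)^(s/2) K_s(2 sqrt (al be)), with K_s the modified Bessel
    function; for [be = 0] and Re s >= 1 it is Gamma(s) / al^s. *)
Definition BI al be s : C := Cint (Kexp al be s).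

Lemma BI_correct al be s :
  integrable_params al be (Re s) -> is_int (Kexp al be s) (BI al be s).
Proof.
  intros H. destruct (wexp_bound _ _ _ H) as [M HM].
  destruct (is_int_ex (Kexp al be s) M (Ccont_Kexp al be s)) as [l Hl].
  - intros t. rewrite Cmod_Kexp. apply HM.
  - eapply Cint_correct, Hl.
Qed.

Lemma inv_sq_lim (M : R) : is_lim_seq (fun n => M / (1 + INR n ^ 2)) 0.
Proof.
  replace (Finite 0) with (Rbar_mult M 0) by (simpl; f_equal; ring).
  apply is_lim_seq_scal_l.
  apply (is_lim_seq_le_le_loc (fun _ => 0) _ (fun n => / INR n)).
  - exists 1%nat. intros n Hn. apply le_INR in Hn. simpl in Hn. split.
    + left. apply Rinv_0_lt_compat. simpl; nra.
    + apply Rinv_le_contravar; simpl; nra.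
  - apply is_lim_seq_const.
  - replace (Finite 0) with (Rbar_inv p_infty) by reflexivity.
    apply is_lim_seq_inv; [apply is_lim_seq_INR|discriminate].
Qed.

Lemma Kexp_lim0 al be s : integrable_params al be (Re s) ->
  Clim (fun n => Kexp al be s (INR n)) 0%C /\ Clim (fun n => Kexp al be s (- INR n)) 0%C.
Proof.
  intros H. destruct (wexp_bound _ _ _ H) as [M HM].
  split; apply (Clim_squeeze _ _ (fun n => M / (1 + INR n ^ 2))); try apply inv_sq_lim;
    exists O; intros n _; unfold Cminus; rewrite Copp_0, Cplus_0_r, Cmod_Kexp.
  - apply HM.
  - replace (INR n ^ 2) with ((- INR n) ^ 2) by ring. apply HM.
Qed.

Lemma Kexp_deriv al be s (t : R) :
  Cderiv (Kexp al be s) t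
    (RtoC (- al) * Kexp al be (s + 1) t + be * Kexp al be (s - 1) t + s * Kexp al be s t)%C.
Proof.
  assert (E1 : Kexp al be (s + 1)%C t = (RtoC (exp t) * Kexp al be s t)%C).
  { rewrite Kexp_shift. f_equal. rewrite <- Cexp_R. f_equal. ring. }
  assert (E2 : Kexp al be (s - 1)%C t = (RtoC (exp (- t)) * Kexp al be s t)%C).
  { unfold Cminus. rewrite Kexp_shift. f_equal. rewrite <- Cexp_R. f_equal. rewrite RtoC_opp. ring. }
  rewrite E1, E2.
  set (z := Kexp al be s t).
  assert (R1 : Re z = wexp al be (Re s) t * cos (Im s * t)) by apply Kexp_Re.
  assert (R2 : Im z = wexp al be (Re s) t * sin (Im s * t)) by apply Kexp_Im.
  split.
  - apply (is_derive_ext (fun t => wexp al be (Re s) t * cos (Im s * t))).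
    + intros u. symmetry. apply Kexp_Re.
    + replace (Re (_ + _)%C) with ((- al * exp t + be * exp (- t) + Re s) * Re z - Im s * Im z)
        by (simpl; unfold Re, Im; ring).
      rewrite R1, R2. unfold wexp. auto_derive; [auto|]. unfold Rminus. ring.
  - apply (is_derive_ext (fun t => wexp al be (Re s) t * sin (Im s * t))).
    + intros u. symmetry. apply Kexp_Im.
    + replace (Im (_ + _)%C) with ((- al * exp t + be * exp (- t) + Re s) * Im z + Im s * Re z)
        by (simpl; unfold Re, Im; ring).
      rewrite R1, R2. unfold wexp. auto_derive; [auto|]. unfold Rminus. ring.
Qed.

(** The kernel vanishes at both ends, so its derivative integrates to 0; this is the three-term
    recurrence in integrated form. *)
Lemma is_int_Kexp_deriv al be s : integrable_params al be (Re s) ->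
  is_int (fun t => RtoC (- al) * Kexp al be (s + 1) t + be * Kexp al be (s - 1) t
                   + s * Kexp al be s t)%C (RtoC 0).
Proof.
  intros H. destruct (Kexp_lim0 al be s H) as [L1 L2].
  replace (RtoC 0) with (RtoC 0 - RtoC 0)%C by ring.
  apply (is_int_FTC (Kexp al be s)); auto.
  - intros t. apply Kexp_deriv.
  - repeat apply Ccont_plus; apply Ccont_scal, Ccont_Kexp.
Qed.

Lemma BI_rec al be s : 0 < al -> 0 < be ->
  (al * BI al be (s + 1) = s * BI al be s + be * BI al be (s - 1))%C.
Proof.
  intros Ha Hb.
  assert (P : forall x, integrable_params al be x) by (intros x; apply integrable_params_pos; assumption).
  assert (I0 := is_int_Kexp_deriv al be s (P _)).
  assert (I1 := is_int_scal (RtoC (- al)) _ _ (BI_correct al be (s + 1)%C (P _))).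
  assert (I2 := is_int_scal (RtoC be) _ _ (BI_correct al be (s - 1)%C (P _))).
  assert (I3 := is_int_scal s _ _ (BI_correct al be s (P _))).
  assert (E := is_int_unique _ _ _ I0 (is_int_plus _ _ _ _ (is_int_plus _ _ _ _ I1 I2) I3)).
  rewrite RtoC_opp in E.
  replace (al * BI al be (s + 1))%C with (al * BI al be (s + 1) + RtoC 0)%C by ring.
  rewrite E. ring.
Qed.

Lemma BI_rec0 al s : 0 < al -> 1 <= Re s ->
  (al * BI al 0 (s + 1) = s * BI al 0 s)%C.
Proof.
  intros Ha Hs.
  assert (P : integrable_params al 0 (Re s)) by (split; [|split]; auto with real).
  assert (P1 : integrable_params al 0 (Re (s + 1)%C)).
  { split; [|split]; auto with real. right. rewrite Re_Cplus. simpl. lra. }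
  assert (I0 := is_int_Kexp_deriv al 0 s P).
  assert (I1 := is_int_scal (RtoC (- al)) _ _ (BI_correct al 0 (s + 1)%C P1)).
  assert (I3 := is_int_scal s _ _ (BI_correct al 0 s P)).
  assert (E2 : RtoC 0 = (RtoC (- al) * BI al 0 (s + 1) + s * BI al 0 s)%C).
  { eapply is_int_unique; [|apply (is_int_plus _ _ _ _ I1 I3)].
    eapply is_int_ext; [|exact I0]. intros t. simpl. ring. }
  rewrite RtoC_opp in E2.
  replace (al * BI al 0 (s + 1))%C with (al * BI al 0 (s + 1) + RtoC 0)%C by ring.
  rewrite E2. ring.
Qed.

Lemma BI_flip al be s : 0 < al -> 0 < be -> BI al be s = BI be al (- s)%C.
Proof.
  intros Ha Hb.
  eapply is_int_unique.
  - apply is_int_flip, BI_correct, integrable_params_pos; assumption.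
  - eapply is_int_ext; [|apply BI_correct, integrable_params_pos; assumption].
    intros t. simpl. rewrite Kexp_flip. reflexivity.
Qed.

Lemma BI_1 al : 0 < al -> BI al 0 1%C = RtoC (/ al).
Proof.
  intros Ha.
  assert (P : integrable_params al 0 (Re 1%C)) by (split; [|split]; simpl; auto with real).
  eapply is_int_unique; [apply BI_correct, P|].
  (* At s = 1 and be = 0 the integrand e^t exp (- al e^t) has this explicit primitive. *)
  set (F := fun t => RtoC (- / al * exp (- al * exp t))).
  replace (RtoC (/ al)) with (RtoC 0 - RtoC (- / al))%C by (rewrite RtoC_opp; ring).
  assert (HM : is_lim_seq (fun n => exp (INR n)) p_infty).
  { apply (is_lim_seq_le_p_loc INR).
    - exists O. intros n _. assert (A := exp_ineq1_le (INR n)). lra.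
    - apply is_lim_seq_INR. }
  apply (is_int_FTC F).
  - intros t. rewrite Kexp_R. unfold F. split.
    + simpl. unfold wexp. auto_derive; [auto|].
      replace (- al * exp t - 0 * exp (- t) + 1 * t) with (t + - al * exp t) by ring.
      rewrite exp_plus. field. lra.
    + apply (is_derive_const (V := R_NormedModule) 0 t).
  - apply Ccont_Kexp.
  - unfold F. apply (Clim_R _ 0).
    replace (Finite 0) with (Rbar_mult (- / al) 0) by (simpl; f_equal; ring).
    apply is_lim_seq_scal_l.
    apply (is_lim_seq_le_le_loc (fun _ => 0) _ (fun n => / al * / exp (INR n))).
    + exists O. intros n _. split; [left; apply exp_pos|].
      replace (- al * exp (INR n)) with (- (al * exp (INR n))) by ring.
      assert (Pe := exp_pos (INR n)).
      rewrite exp_Ropp, <- Rinv_mult. apply Rinv_le_contravar; [nra|].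
      assert (A := exp_ineq1_le (al * exp (INR n))). lra.
    + apply is_lim_seq_const.
    + replace (Finite 0) with (Rbar_mult (/ al) (Rbar_inv p_infty)) by (simpl; f_equal; ring).
      apply is_lim_seq_scal_l, is_lim_seq_inv; [exact HM|discriminate].
  - unfold F. apply (Clim_R _ (- / al)).
    replace (Finite (- / al)) with (Rbar_mult (- / al) (exp (- al * 0))).
    2:{ simpl. f_equal. rewrite Rmult_0_r, exp_0. ring. }
    apply is_lim_seq_scal_l.
    apply (is_lim_seq_continuous exp (fun n => - al * exp (- INR n)) (- al * 0)).
    + apply derivable_continuous_pt, derivable_pt_exp.
    + apply (is_lim_seq_scal_l _ (- al) 0).
      apply (is_lim_seq_ext (fun n => / exp (INR n))); [intros n; symmetry; apply exp_Ropp|].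
      replace (Finite 0) with (Rbar_inv p_infty) by reflexivity.
      apply is_lim_seq_inv; [exact HM|discriminate].
Qed.

(** * Entire functions *)

(** The sets [P e] shrink with e and are never empty; [l] is a cluster value of [c] along them. If
    each l were avoided at some scale delta(l), compactness of [-B, B] would give one scale d at
    which every value is avoided. *)
Lemma cluster_point_1d (X : Type) (P : R -> X -> Prop) (c : X -> R) (B : R) :
  (forall e e' x, e <= e' -> P e x -> P e' x) ->
  (forall e x, P e x -> - B <= c x <= B) ->
  (forall e, 0 < e -> exists x, P e x) ->
  exists l, forall e, 0 < e -> exists x, P e x /\ Rabs (c x - l) < e.
Proof.
  intros Hmono HB HP. apply NNPP. intros Hno.
  assert (K : forall l, exists e : posreal, forall x, P e x -> ~ Rabs (c x - l) < e).
  { intros l. apply NNPP. intros K. apply Hno. exists l. intros e He.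
    apply NNPP. intros K2. apply K. exists (mkposreal e He). intros x Hx Hc.
    apply K2. exists x. split; assumption. }
  destruct (choice _ K) as [delta Hd].
  destruct (compactness_value_1d (- B) B delta) as [d Hcov].
  destruct (HP d (cond_pos d)) as [x Hx].
  apply (Hcov (c x) (HB _ _ Hx)). intros [t [_ [Ht Hdt]]].
  apply (Hd t x); [|exact Ht]. eapply Hmono; eassumption.
Qed.

(** Bolzano-Weierstrass without subsequences: closeness of the last coordinate is added to [P], and
    the induction treats the remaining ones. *)
Lemma cluster_point (X : Type) (P : R -> X -> Prop) (c : nat -> X -> R) (B : R) (d : nat) :
  (forall e e' x, e <= e' -> P e x -> P e' x) ->
  (forall e x i, (i < d)%nat -> P e x -> - B <= c i x <= B) ->
  (forall e, 0 < e -> exists x, P e x) ->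
  exists l : nat -> R, forall e, 0 < e ->
    exists x, P e x /\ forall i, (i < d)%nat -> Rabs (c i x - l i) < e.
Proof.
  revert P. induction d as [|d IH]; intros P Hmono HB HP.
  - exists (fun _ => 0). intros e He. destruct (HP e He) as [x Hx].
    exists x. split; [exact Hx|]. intros i Hi. lia.
  - destruct (cluster_point_1d X P (c d) B Hmono) as [y Hy].
    + intros e x. apply HB. lia.
    + exact HP.
    + destruct (IH (fun e x => P e x /\ Rabs (c d x - y) < e)) as [l Hl].
      * intros e e' x He [H1 H2]. split; [eapply Hmono; eassumption|lra].
      * intros e x i Hi [H1 _]. apply (HB e); [lia|exact H1].
      * exact Hy.
      * exists (fun i => if Nat.eq_dec i d then y else l i). intros e He.
        destruct (Hl e He) as [x [[H1 H2] H3]]. exists x. split; [exact H1|].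
        intros i Hi. destruct (Nat.eq_dec i d) as [->|ne]; [exact H2|]. apply H3. lia.
Qed.

Lemma least_nat (P : nat -> Prop) : (exists n, P n) -> exists p, P p /\ forall j, (j < p)%nat -> ~ P j.
Proof.
  intros [n Hn]. apply NNPP. intros K.
  assert (A : forall m, ~ P m); [|apply (A n Hn)].
  intros m. induction m as [m IH] using (well_founded_induction Nat.lt_wf_0).
  intros Hm. apply K. exists m. split; assumption.
Qed.

(* [q] is arbitrary, so such a Taylor expansion converges on the whole plane. *)
Definition entire_at (f : C -> C) z0 : Prop :=
  exists c : nat -> C, forall q, 1 <= q -> exists M, 0 <= M /\ forall n h, Cmod h <= q ->
    Cmod (f (z0 + h) - csum (fun j => c j * h ^ j) n)%C <= M * (Cmod h / q) ^ n.

Lemma entire_at_ext (f g : C -> C) z0 :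
  (forall z, f z = g z) -> entire_at f z0 -> entire_at g z0.
Proof.
  intros E [c H]. exists c. intros q Hq. destruct (H q Hq) as [M [PM HM]].
  exists M. split; [exact PM|]. intros n h Hh. rewrite <- E. apply HM, Hh.
Qed.

Lemma entire_at_plus (f g : C -> C) z0 :
  entire_at f z0 -> entire_at g z0 -> entire_at (fun z => f z + g z)%C z0.
Proof.
  intros [c H] [d K]. exists (fun j => c j + d j)%C. intros q Hq.
  destruct (H q Hq) as [M [PM HM]]. destruct (K q Hq) as [N [PN HN]].
  exists (M + N). split; [lra|]. intros n h Hh.
  specialize (HM n h Hh). specialize (HN n h Hh).
  rewrite (csum_ext _ (fun j => c j * h ^ j + d j * h ^ j)%C) by (intros; ring).
  rewrite csum_plus.
  cmod_ring ((f (z0 + h) - csum (fun j => c j * h ^ j) n) + (g (z0 + h) - csum (fun j => d j * h ^ j) n))%C.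
  eapply Rle_trans; [apply Cmod_triangle|]. lra.
Qed.

Lemma entire_at_scal (a : C) (f : C -> C) z0 :
  entire_at f z0 -> entire_at (fun z => a * f z)%C z0.
Proof.
  intros [c H]. exists (fun j => a * c j)%C. intros q Hq.
  destruct (H q Hq) as [M [PM HM]].
  exists (Cmod a * M). split; [apply Rmult_le_pos; [apply Cmod_ge_0|exact PM]|]. intros n h Hh.
  specialize (HM n h Hh).
  rewrite (csum_ext _ (fun j => a * (c j * h ^ j))%C) by (intros; ring).
  rewrite csum_scal.
  cmod_ring (a * (f (z0 + h) - csum (fun j => c j * h ^ j) n))%C.
  rewrite Cmod_mult, Rmult_assoc. apply Rmult_le_compat_l; [apply Cmod_ge_0|exact HM].
Qed.

Lemma entire_at_Cexp (b z0 : C) : entire_at (fun z => Cexp (b * z)%C) z0.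
Proof.
  exists (fun j => Cexp (b * z0) * (b ^ j / INR (fact j)))%C. intros q Hq.
  exists (Cmod (Cexp (b * z0)) * exp (2 * q * Cmod b)).
  split; [apply Rmult_le_pos; [apply Cmod_ge_0|left; apply exp_pos]|]. intros n h Hh.
  rewrite (csum_ext _ (fun j => Cexp (b * z0) * ((h * b) ^ j / INR (fact j)))%C).
  2:{ intros i _. rewrite Cpow_mult_l. field. apply fact_C_neq0. }
  rewrite csum_scal. fold (cexp_taylor (h * b) n).
  replace (b * (z0 + h))%C with (b * z0 + h * b)%C by ring. rewrite Cexp_plus.
  cmod_ring (Cexp (b * z0) * (Cexp (h * b) - cexp_taylor (h * b) n))%C.
  rewrite Cmod_mult, Rmult_assoc, (Rmult_comm (exp _)).
  apply Rmult_le_compat_l; [apply Cmod_ge_0|]. apply cexp_taylor_bound_q; lra.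
Qed.

Lemma entire_at_const (a z0 : C) : entire_at (fun _ => a) z0.
Proof.
  apply (entire_at_ext (fun z => a * Cexp (0 * z))%C).
  - intros z. replace (RtoC 0 * z)%C with (RtoC 0) by ring. rewrite Cexp_0. ring.
  - apply entire_at_scal, entire_at_Cexp.
Qed.

Lemma entire_at_csum (f : nat -> C -> C) z0 n :
  (forall i, (i < n)%nat -> entire_at (f i) z0) -> entire_at (fun z => csum (fun i => f i z) n) z0.
Proof.
  induction n as [|n IH]; intros H; simpl; [apply entire_at_const|].
  apply entire_at_plus; auto.
Qed.

Lemma wexp_exp_abs (al be x q t : R) : 0 <= q ->
  exp (q * Rabs t) * wexp al be x t <= wexp al be (x + q) t + wexp al be (x - q) t.
Proof.
  intros Hq. unfold wexp. rewrite <- exp_plus.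
  assert (A := exp_pos (- al * exp t - be * exp (- t) + (x + q) * t)).
  assert (B := exp_pos (- al * exp t - be * exp (- t) + (x - q) * t)).
  destruct (Rle_dec 0 t) as [H|H].
  - rewrite Rabs_pos_eq by exact H.
    replace (q * t + (- al * exp t - be * exp (- t) + x * t))
      with (- al * exp t - be * exp (- t) + (x + q) * t) by ring. lra.
  - rewrite Rabs_left by lra.
    replace (q * - t + (- al * exp t - be * exp (- t) + x * t))
      with (- al * exp t - be * exp (- t) + (x - q) * t) by ring. lra.
Qed.

Lemma is_int_Kexp_pow al be s (j : nat) : 0 < al -> 0 < be ->
  exists l, is_int (fun t => RtoC (t ^ j) * Kexp al be s t)%C l.
Proof.
  intros Ha Hb.
  assert (P : forall x, integrable_params al be x) by (intros x; apply integrable_params_pos; assumption).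
  destruct (wexp_bound _ _ _ (P (Re s + 1))) as [M1 H1].
  destruct (wexp_bound _ _ _ (P (Re s - 1))) as [M2 H2].
  apply (is_int_ex _ (INR (fact j) * (M1 + M2))).
  - apply Ccont_pow_mult, Ccont_Kexp.
  - intros t. rewrite Cmod_mult, Cmod_R, Cmod_Kexp, <- RPow_abs.
    assert (A := pow_fact_le_exp (Rabs t) j (Rabs_pos t)).
    assert (Pf := INR_fact_lt_0 j).
    assert (W := wexp_exp_abs al be (Re s) 1 t ltac:(lra)). rewrite Rmult_1_l in W.
    specialize (H1 t). specialize (H2 t).
    assert (PK : 0 < wexp al be (Re s) t) by apply exp_pos.
    assert (A2 : Rabs t ^ j <= INR (fact j) * exp (Rabs t)).
    { apply (Rmult_le_compat_l (INR (fact j))) in A; [|lra].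
      replace (INR (fact j) * (Rabs t ^ j / INR (fact j))) with (Rabs t ^ j) in A by (field; lra).
      exact A. }
    apply Rle_trans with (INR (fact j) * (exp (Rabs t) * wexp al be (Re s) t)).
    + rewrite <- Rmult_assoc. apply Rmult_le_compat_r; lra.
    + unfold Rdiv in *. rewrite Rmult_assoc. apply Rmult_le_compat_l; lra.
Qed.

(** The exponential e^(h t) is expanded under the integral: the Taylor coefficients are the moments
    of t^j against the kernel, divided by j!. *)
Lemma entire_at_BI al be z0 : 0 < al -> 0 < be -> entire_at (BI al be) z0.
Proof.
  intros Ha Hb.
  assert (P : forall x, integrable_params al be x) by (intros x; apply integrable_params_pos; assumption).
  destruct (choice _ (fun j => is_int_Kexp_pow al be z0 j Ha Hb)) as [m Hm].
  exists (fun j => / INR (fact j) * m j)%C. intros q Hq.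
  (* The Taylor remainder costs exp (2 q |t|) <= exp (2 q t) + exp (- 2 q t), which amounts to
     shifting Re z0 by 2 q either way. *)
  set (V := (BI al be (RtoC (Re z0 + 2 * q)) + BI al be (RtoC (Re z0 - 2 * q)))%C).
  assert (HV : is_int (fun t => RtoC (wexp al be (Re z0 + 2 * q) t + wexp al be (Re z0 - 2 * q) t)) V).
  { eapply is_int_ext; [|apply is_int_plus; apply BI_correct, P].
    intros t. simpl. rewrite !Kexp_R, RtoC_plus. reflexivity. }
  exists (Re V). split.
  - eapply Rle_trans; [apply Cmod_ge_0|]. refine (is_int_Cmod_le _ _ _ _ _ HV HV).
    intros t. cbv beta. rewrite Cmod_R, Rabs_pos_eq; [lra|].
    assert (A := exp_pos). unfold wexp. apply Rplus_le_le_0_compat; left; apply exp_pos.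
  - intros n h Hh.
    assert (HI : is_int (fun t => Kexp al be (z0 + h) t -
        csum (fun j => / INR (fact j) * h ^ j * (RtoC (t ^ j) * Kexp al be z0 t)) n)%C
        (BI al be (z0 + h) - csum (fun j => / INR (fact j) * h ^ j * m j) n)%C).
    { apply is_int_minus; [apply BI_correct, P|].
      apply (is_int_csum (fun j t => / INR (fact j) * h ^ j * (RtoC (t ^ j) * Kexp al be z0 t))%C).
      intros i _. apply is_int_scal, Hm. }
    rewrite (csum_ext _ (fun j => / INR (fact j) * h ^ j * m j)%C) by (intros; ring).
    apply Rle_trans with (Re (RtoC ((Cmod h / q) ^ n) * V)%C).
    + eapply is_int_Cmod_le; [|exact HI|].
      2:{ eapply is_int_ext; [|apply (is_int_scal (RtoC ((Cmod h / q) ^ n)) _ _ HV)].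
          intros t. simpl. rewrite <- RtoC_mult. reflexivity. }
      intros t. simpl.
      rewrite (csum_ext _ (fun j => ((h * t) ^ j / INR (fact j)) * Kexp al be z0 t)%C).
      2:{ intros i _. rewrite Cpow_mult_l, RtoC_pow. field. apply fact_C_neq0. }
      rewrite csum_scal_r. fold (cexp_taylor (h * t) n). rewrite Kexp_shift.
      cmod_ring ((Cexp (h * t) - cexp_taylor (h * t) n) * Kexp al be z0 t)%C.
      rewrite Cmod_mult, Cmod_Kexp.
      assert (T := cexp_taylor_bound_q n h (RtoC t) q ltac:(lra) Hh). rewrite Cmod_R in T.
      assert (W := wexp_exp_abs al be (Re z0) (2 * q) t ltac:(lra)).
      assert (PK : 0 < wexp al be (Re z0) t) by apply exp_pos.
      assert (Pq : 0 <= (Cmod h / q) ^ n).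
      { apply pow_le, Rle_mult_inv_pos; [apply Cmod_ge_0|lra]. }
      eapply Rle_trans; [apply Rmult_le_compat_r; [lra|exact T]|].
      rewrite Rmult_assoc. apply Rmult_le_compat_l; assumption.
    + right. simpl. unfold Re. ring.
Qed.

Lemma entire_at_order2 (f : C -> C) z0 : entire_at f z0 ->
  exists l M, 0 <= M /\
    forall h, Cmod h <= 1 -> Cmod (f (z0 + h) - f z0 - l * h)%C <= M * Cmod h ^ 2.
Proof.
  intros [c H]. destruct (H 1 ltac:(lra)) as [M [PM HM]]. exists (c 1%nat), M.
  split; [exact PM|]. intros h Hh.
  (* The expansion of order 1 at h = 0 identifies c 0 with f z0. *)
  assert (A := HM 1%nat 0%C ltac:(rewrite Cmod_0; lra)). assert (B := HM 2%nat h Hh).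
  simpl in A, B. rewrite Cmod_0 in A. replace (M * (0 / 1 * 1)) with 0 in A by field.
  assert (E := Cmod_eq_0 _ (Rle_antisym _ _ A (Cmod_ge_0 _))).
  replace (z0 + RtoC 0)%C with z0 in E by ring.
  replace (f (z0 + h) - f z0 - c 1%nat * h)%C
    with (f (z0 + h) - (RtoC 0 + c 0%nat * 1 + c 1%nat * (h * 1)) - (f z0 - (RtoC 0 + c 0%nat * 1)))%C by ring.
  rewrite E. replace (M * Cmod h ^ 2) with (M * (Cmod h / 1 * (Cmod h / 1 * 1))) by field.
  unfold Cminus at 1. rewrite Copp_0, Cplus_0_r. exact B.
Qed.

Lemma entire_at_Lipschitz (f : C -> C) z0 : entire_at f z0 ->
  exists M, 0 <= M /\ forall h, Cmod h <= 1 -> Cmod (f (z0 + h) - f z0)%C <= M * Cmod h.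
Proof.
  intros H. destruct (entire_at_order2 f z0 H) as [l [M [PM HM]]].
  assert (Pl := Cmod_ge_0 l). exists (Cmod l + M). split; [lra|]. intros h Hh.
  specialize (HM h Hh). assert (Ph := Cmod_ge_0 h).
  assert (D := Cmod_sub_rev (f (z0 + h) - f z0)%C (l * h)%C). rewrite Cmod_mult in D.
  assert (M * Cmod h ^ 2 <= M * Cmod h) by (apply Rmult_le_compat_l; nra). lra.
Qed.

(** If all coefficients vanish, the radius q = 2 |h| + 1 gives |f z| <= M / 2^n for every n, so f is
    0 on the whole plane at once. Otherwise the first nonzero coefficient is the leading one. *)
Lemma entire_at_local (f : C -> C) z0 : entire_at f z0 ->
  (forall z, f z = RtoC 0) \/
  exists p c M, c <> RtoC 0 /\ 0 <= M /\ forall h, Cmod h <= 1 ->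
    Cmod (f (z0 + h) - c * h ^ p)%C <= M * Cmod h ^ (S p).
Proof.
  intros [c H]. destruct (classic (exists p, c p <> RtoC 0)) as [K|K].
  - right. destruct (least_nat _ K) as [p [Hp Hl]].
    destruct (H 1 ltac:(lra)) as [M [PM HM]]. exists p, (c p), M. split; [exact Hp|split; [exact PM|]].
    intros h Hh. specialize (HM (S p) h Hh). simpl csum in HM.
    rewrite (csum_zero _ p) in HM.
    + rewrite Cplus_0_l in HM. replace (Cmod h / 1) with (Cmod h) in HM by field. exact HM.
    + intros i Hi. assert (E : c i = RtoC 0) by (apply NNPP; auto). rewrite E. ring.
  - left. intros z. apply Cmod_eq_0, Rle_antisym; [|apply Cmod_ge_0].
    set (h := (z - z0)%C). assert (Ph := Cmod_ge_0 h).
    destruct (H (2 * Cmod h + 1) ltac:(lra)) as [M [PM HM]].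
    assert (B : forall n, Cmod (f z) <= M * (/ 2) ^ n).
    { intros n. specialize (HM n h ltac:(lra)). rewrite (csum_zero _ n) in HM.
      - replace (z0 + h)%C with z in HM by (unfold h; ring).
        replace (f z - RtoC 0)%C with (f z) in HM by ring.
        eapply Rle_trans; [exact HM|]. apply Rmult_le_compat_l; [exact PM|].
        apply pow_incr. split; [apply Rle_mult_inv_pos; lra|].
        apply Rle_div_l; lra.
      - intros i _. assert (E : c i = RtoC 0) by (apply NNPP; intros N; apply K; exists i; exact N).
        rewrite E. ring. }
    apply (is_lim_seq_le (fun _ => Cmod (f z)) (fun n => M * (/ 2) ^ n) (Cmod (f z)) 0 B).
    + apply is_lim_seq_const.
    + replace (Finite 0) with (Rbar_mult M 0) by (simpl; f_equal; ring).
      apply is_lim_seq_scal_l, is_lim_seq_geom. rewrite Rabs_pos_eq; lra.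
Qed.

(** The leading term c h^p beats the remainder M |h|^(p+1) as soon as |h| < |c| / (M + 1). *)
Lemma entire_isolated_zeros (f : C -> C) z0 :
  entire_at f z0 -> (exists z, f z <> RtoC 0) ->
  exists r, 0 < r /\ forall h, 0 < Cmod h < r -> f (z0 + h)%C <> RtoC 0.
Proof.
  intros H [z Hz]. destruct (entire_at_local f z0 H) as [K|[p [c [M [Hc [PM HM]]]]]]; [elim (Hz (K z))|].
  assert (Pc := proj1 (Cmod_gt_0 c) Hc).
  exists (Rmin 1 (Cmod c / (M + 1))). split.
  - apply Rmin_glb_lt; [lra|]. apply Rdiv_lt_0_compat; lra.
  - intros h [h0 h1] E.
    assert (A1 := Rmin_l 1 (Cmod c / (M + 1))). assert (A2 := Rmin_r 1 (Cmod c / (M + 1))).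
    specialize (HM h ltac:(lra)). rewrite E in HM.
    replace (RtoC 0 - c * h ^ p)%C with (- (c * h ^ p))%C in HM by ring.
    rewrite Cmod_opp, Cmod_mult, Cmod_pow in HM. simpl in HM.
    assert (Pp : 0 < Cmod h ^ p) by (apply pow_lt, h0).
    assert (L : Cmod h * (M + 1) < Cmod c).
    { apply (Rmult_lt_reg_r (/ (M + 1))); [apply Rinv_0_lt_compat; lra|].
      rewrite Rmult_assoc, Rinv_r by lra. unfold Rdiv in *. lra. }
    nra.
Qed.

(** From |1 + z|^2 = 1 + 2 Re z + |z|^2 <= 1 - |z| + |z|^2. *)
Lemma Cmod_one_plus_le z : Re z <= - Cmod z / 2 -> Cmod z <= / 2 ->
  Cmod (1 + z)%C <= 1 - Cmod z / 4.
Proof.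
  intros H1 H2. assert (P := Cmod_ge_0 z).
  apply Rsqr_incr_0_var; [|lra]. rewrite !Rsqr_pow2.
  assert (Q : forall w : C, Cmod w ^ 2 = Re w ^ 2 + Im w ^ 2).
  { intros w. unfold Cmod. rewrite pow2_sqrt; [reflexivity|]. simpl. nra. }
  rewrite Q. replace (Re (1 + z)%C) with (1 + Re z) by reflexivity.
  replace (Im (1 + z)%C) with (Im z) by (simpl; unfold Im; ring).
  assert (E := Q z). simpl in *. nra.
Qed.

(** Near z0, f is f z0 (1 + b h^p) up to O(|h|^(p+1)) with b = c / f z0. The direction of h is
    chosen so that b h^p points to the left, and the modulus drops by an amount of order |h|^p. *)
Lemma entire_no_local_min (f : C -> C) z0 (r : R) :
  entire_at f z0 -> f z0 <> RtoC 0 -> (exists z, f z <> f z0) -> 0 < r ->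
  exists h, Cmod h < r /\ Cmod (f (z0 + h)%C) < Cmod (f z0).
Proof.
  intros H Hz [z Hnc] Hr.
  assert (Hg : entire_at (fun z => f z + - f z0)%C z0).
  { apply entire_at_plus; [exact H|apply entire_at_const]. }
  destruct (entire_at_local _ z0 Hg) as [K|[p [c [M [Hc [PM HM]]]]]].
  { elim Hnc. replace (f z) with (f z + - f z0 + f z0)%C by ring. rewrite K. ring. }
  assert (Pc := proj1 (Cmod_gt_0 c) Hc). assert (Pz := proj1 (Cmod_gt_0 (f z0)) Hz).
  assert (Hp : p <> O).
  { intros ->. specialize (HM 0%C ltac:(rewrite Cmod_0; lra)). rewrite Cmod_0 in HM.
    replace (f (z0 + RtoC 0) + - f z0 - c * RtoC 0 ^ 0)%C with (- c)%C in HM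
      by (replace (z0 + RtoC 0)%C with z0 by ring; simpl; ring).
    rewrite Cmod_opp in HM. simpl in HM. lra. }
  set (b := (c / f z0)%C).
  assert (Hb : Cmod b = Cmod c / Cmod (f z0)) by (unfold b; rewrite Cmod_div; auto).
  assert (Pb : 0 < Cmod b) by (rewrite Hb; apply Rdiv_lt_0_compat; lra).
  (* one of the four rotations of [b] by multiples of [PI / 2] points into the left half-plane *)
  assert (Rot : exists th, Re (b * Cexp (0, th))%C <= - Cmod b / 2).
  { assert (A := Cmod_le_ReIm b).
    assert (C0 : forall th, Re (b * Cexp (0, th))%C = Re b * cos th - Im b * sin th).
    { intros th. unfold Cexp; simpl. rewrite exp_0. unfold Re, Im. ring. }
    destruct (Rle_dec (Re b) (- Cmod b / 2)) as [L1|L1].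
    { exists 0. rewrite C0, cos_0, sin_0. lra. }
    destruct (Rle_dec (- Re b) (- Cmod b / 2)) as [L2|L2].
    { exists PI. rewrite C0, cos_PI, sin_PI. lra. }
    destruct (Rle_dec (- Im b) (- Cmod b / 2)) as [L3|L3].
    { exists (PI / 2). rewrite C0, cos_PI2, sin_PI2. lra. }
    exists (- (PI / 2)). rewrite C0, cos_neg, sin_neg, cos_PI2, sin_PI2.
    assert (B1 := Rabs_def1 (Re b) (Cmod b / 2) ltac:(lra) ltac:(lra)).
    destruct (Rle_dec 0 (Im b)) as [L|L].
    - rewrite (Rabs_pos_eq (Im b)) in A by lra. lra.
    - rewrite (Rabs_left (Im b)) in A by lra. lra. }
  destruct Rot as [th Hth].
  set (w := Cexp (0, th / INR p)).
  assert (Hw : (w ^ p)%C = Cexp (0, th)).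
  { assert (G : forall m x, (Cexp (0, x) ^ m)%C = Cexp (0, INR m * x)).
    { intros m x. induction m as [|m IH].
      - simpl. replace (0, 0 * x) with (RtoC 0) by (unfold RtoC; f_equal; ring). symmetry. apply Cexp_0.
      - rewrite Cpow_S, IH, <- Cexp_plus, S_INR. f_equal. apply C_ext; simpl; ring. }
    unfold w. rewrite G. f_equal. f_equal. field. apply not_0_INR, Hp. }
  assert (Mw : Cmod w = 1) by (unfold w; rewrite Cmod_Cexp; simpl; apply exp_0).
  (* The bounds keep h inside the disc of radius r and the expansion valid, give |b h^p| <= 1/2, and
     make the error M rho^(p+1) smaller than the gain |c| rho^p / 4. *)
  set (rho := Rmin (Rmin (r / 2) 1) (Rmin (/ (2 * Cmod b)) (Cmod c / (8 * (M + 1))))).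
  assert (R1 : rho <= r / 2) by rmin_le.
  assert (R2 : rho <= 1) by rmin_le.
  assert (R3 : rho <= / (2 * Cmod b)) by rmin_le.
  assert (R4 : rho <= Cmod c / (8 * (M + 1))) by rmin_le.
  assert (R0 : 0 < rho).
  { repeat apply Rmin_glb_lt; try lra.
    - apply Rinv_0_lt_compat. lra.
    - apply Rdiv_lt_0_compat; lra. }
  set (h := (rho * w)%C).
  assert (Mh : Cmod h = rho) by (unfold h; rewrite Cmod_mult, Mw, Cmod_R, Rabs_pos_eq; lra).
  exists h. split; [rewrite Mh; lra|].
  specialize (HM h ltac:(lra)). rewrite Mh in HM.
  set (v := (b * h ^ p)%C).
  assert (Ev : v = (RtoC (rho ^ p) * (b * Cexp (0%R, th)))%C).
  { unfold v, h. rewrite Cpow_mult_l, Hw, RtoC_pow. ring. }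
  assert (Pp : 0 < rho ^ p) by (apply pow_lt, R0).
  assert (Mv : Cmod v = rho ^ p * Cmod b).
  { unfold v. rewrite Cmod_mult, Cmod_pow, Mh. ring. }
  assert (Rp : rho ^ p <= rho).
  { destruct p as [|p]; [now elim Hp|]. simpl.
    assert (rho ^ p <= 1 ^ p) by (apply pow_incr; lra). rewrite pow1 in *. nra. }
  assert (S1 : Cmod (1 + v)%C <= 1 - Cmod v / 4).
  { apply Cmod_one_plus_le.
    - rewrite Mv, Ev. replace (Re (RtoC (rho ^ p) * (b * Cexp (0%R, th)))%C)
        with (rho ^ p * Re (b * Cexp (0%R, th))%C) by (simpl; unfold Re; ring).
      nra.
    - rewrite Mv. apply Rle_trans with (/ (2 * Cmod b) * Cmod b).
      + apply Rmult_le_compat_r; lra.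
      + right. field. lra. }
  assert (E : f (z0 + h)%C = (f z0 * (1 + v) + (f (z0 + h) + - f z0 - c * h ^ p))%C).
  { unfold v, b. field. exact Hz. }
  rewrite E. eapply Rle_lt_trans; [apply Cmod_triangle|]. rewrite Cmod_mult.
  apply Rle_lt_trans with (Cmod (f z0) * (1 - Cmod v / 4) + M * rho ^ S p).
  - apply Rplus_le_compat; [|exact HM]. apply Rmult_le_compat_l; lra.
  - rewrite Mv, Hb. simpl.
    replace (Cmod (f z0) * (1 - rho ^ p * (Cmod c / Cmod (f z0)) / 4))
      with (Cmod (f z0) - rho ^ p * Cmod c / 4) by (field; lra).
    assert (rho * (8 * (M + 1)) <= Cmod c) by (apply Rle_div_r; lra).
    nra.
Qed.

(** * Lower bound for zero-free exponential sums *)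

(** [Hcl] is closedness of [S]. A cluster point of points whose values approach the infimum is a
    minimizer, by the local Lipschitz bound for f. *)
Lemma entire_attains_min (f : C -> C) (S : C -> Prop) (B : R) :
  (forall z, entire_at f z) ->
  (forall z, (forall e, 0 < e -> exists w, S w /\ Cmod (w - z)%C < e) -> S z) ->
  (forall z, S z -> Cmod z <= B) -> (exists z, S z) ->
  exists z, S z /\ forall w, S w -> Cmod (f z) <= Cmod (f w).
Proof.
  intros Hf Hcl HB [z0 Hz0].
  destruct (completeness (fun y => exists z, S z /\ y = - Cmod (f z))) as [L [L1 L2]].
  { exists 0. intros y [z [_ ->]]. assert (A := Cmod_ge_0 (f z)). lra. }
  { exists (- Cmod (f z0)), z0. auto. }
  destruct (cluster_point C (fun e z => S z /\ Cmod (f z) < - L + e)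
     (fun i z => match i with O => Re z | _ => Im z end) B 2) as [l Hl].
  - intros e e' x He [H1 H2]. split; [exact H1|lra].
  - intros e x i _ [H1 _]. specialize (HB x H1).
    assert (A1 := re_le_Cmod x). assert (A2 := Cmod_Im x).
    apply Rabs_le_between in A1, A2. destruct i; lra.
  - intros e He. apply NNPP. intros K.
    assert (L <= L - e); [|lra]. apply L2. intros y [z [Hz ->]].
    destruct (Rle_dec (- L + e) (Cmod (f z))) as [A|A]; [lra|].
    elim K. exists z. split; [exact Hz|lra].
  - set (z := (l O, l 1%nat) : C).
    assert (N : forall e, 0 < e -> exists w, (S w /\ Cmod (f w) < - L + e) /\ Cmod (w - z)%C < e).
    { intros e He. destruct (Hl (e / 2) ltac:(lra)) as [w [[W1 W2] W3]].
      exists w. split; [split; [exact W1|lra]|].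
      assert (C0 := W3 0%nat ltac:(lia)). assert (C1 := W3 1%nat ltac:(lia)). simpl in C0, C1.
      eapply Rle_lt_trans; [apply Cmod_le_ReIm|].
      replace (Re (w - z)%C) with (Re w - l O) by (simpl; unfold Re; ring).
      replace (Im (w - z)%C) with (Im w - l 1%nat) by (simpl; unfold Im; ring). lra. }
    exists z. split.
    + apply Hcl. intros e He. destruct (N e He) as [w [[W1 _] W2]]. exists w. auto.
    + intros w Hw. assert (A : - Cmod (f w) <= L) by (apply L1; exists w; auto).
      destruct (entire_at_Lipschitz f z (Hf z)) as [M [PM HM]].
      apply le_epsilon. intros e He.
      set (d := Rmin 1 (e / (M + 1))).
      assert (d1 : d <= 1) by apply Rmin_l. assert (d2 : d <= e / (M + 1)) by apply Rmin_r.
      assert (d0 : 0 < d) by (apply Rmin_glb_lt; [lra|apply Rdiv_lt_0_compat; lra]).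
      destruct (N d d0) as [v [[V1 V2] V3]].
      specialize (HM (v - z)%C ltac:(lra)). replace (z + (v - z))%C with v in HM by ring.
      assert (D := Cmod_sub_rev (f z) (f v)). rewrite (Cmod_minus_sym (f z)) in D.
      assert (M * Cmod (v - z)%C <= M * d) by (apply Rmult_le_compat_l; lra).
      assert (d * (M + 1) <= e) by (apply Rle_div_r; lra).
      lra.
Qed.

(** If |f z0| < eta, the minimizer on the closed disc cannot lie on the circle, and in the interior
    it contradicts [entire_no_local_min]. *)
Lemma entire_min_modulus (f : C -> C) z0 (r eta : R) :
  (forall z, entire_at f z) -> 0 < r ->
  (forall h, Cmod h <= r -> f (z0 + h)%C <> RtoC 0) ->
  (forall h, Cmod h = r -> eta <= Cmod (f (z0 + h)%C)) ->
  eta <= Cmod (f z0).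
Proof.
  intros Hf Hr Hnz Hb. apply Rnot_lt_le. intros K.
  destruct (entire_attains_min f (fun z => Cmod (z - z0)%C <= r) (Cmod z0 + r)) as [z [Sz Hmin]].
  - exact Hf.
  - intros z Hz. apply le_epsilon. intros e He. destruct (Hz e He) as [w [W1 W2]].
    assert (D := Cmod_dist3 z w z0). rewrite (Cmod_minus_sym z w) in D. lra.
  - intros z Hz. assert (D := Cmod_sub_rev z z0). lra.
  - exists z0. replace (z0 - z0)%C with (RtoC 0) by ring. rewrite Cmod_0. lra.
  - assert (M0 : Cmod (f z) <= Cmod (f z0)).
    { apply Hmin. replace (z0 - z0)%C with (RtoC 0) by ring. rewrite Cmod_0. lra. }
    assert (Ez : (z0 + (z - z0))%C = z) by ring.
    destruct (Req_dec (Cmod (z - z0)%C) r) as [E|E].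
    + specialize (Hb _ E). rewrite Ez in Hb. lra.
    + destruct (entire_no_local_min f z (r - Cmod (z - z0)%C) (Hf z)) as [h [H1 H2]].
      * rewrite <- Ez. apply Hnz, Sz.
      (* f is not constant: at the boundary point z0 + r its modulus is at least eta, hence larger
         than |f z|. *)
      * exists (z0 + r)%C. intros E2.
        specialize (Hb (RtoC r) ltac:(rewrite Cmod_R, Rabs_pos_eq; lra)). rewrite E2 in Hb. lra.
      * lra.
      * assert (A : Cmod (f z) <= Cmod (f (z + h)%C)); [|lra].
        apply Hmin. replace (z + h - z0)%C with ((z - z0) + h)%C by ring.
        eapply Rle_trans; [apply Cmod_triangle|lra].
Qed.

Definition expsum (x : nat -> R) (b : nat -> C) (N : nat) s : C :=
  csum (fun m => b m * Cpow_neg (x m) s)%C N.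

Lemma entire_at_expsum (x : nat -> R) (b : nat -> C) (N : nat) z0 :
  entire_at (expsum x b N) z0.
Proof.
  apply (entire_at_csum (fun m s => b m * Cpow_neg (x m) s)%C).
  intros i _. apply entire_at_scal. apply entire_at_Cexp.
Qed.

Lemma csum_single (f : nat -> C) (n m : nat) :
  (m < n)%nat -> (forall i, (i < n)%nat -> i <> m -> f i = RtoC 0) -> csum f n = f m.
Proof.
  intros Hm H. induction n as [|n IH]; [lia|]. simpl.
  destruct (Nat.eq_dec m n) as [->|ne].
  - rewrite csum_zero; [ring|]. intros i Hi. apply H; lia.
  - rewrite IH, (H n); try lia; [ring|]. intros i Hi. apply H. lia.
Qed.

Lemma Cpow_neg_pred (x : R) s : 0 < x ->
  Cpow_neg x (s - 1)%C = (x * Cpow_neg x s)%C.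
Proof.
  intros Hx. unfold Cminus. rewrite Cpow_neg_plus, Cpow_neg_opp, Cpow_neg_1 by exact Hx.
  rewrite RtoC_inv. field.
  all: try apply RtoC_neq0; lra.
Qed.

(** The operator f -> f(s - 1) - x_j f(s) multiplies the m-th coefficient by x_m - x_j. Composed
    over all j <> m0 it removes every term but the m0-th, which has no zeros, so the sum cannot
    vanish identically. *)
Lemma expsum_nonzero (x : nat -> R) (b : nat -> C) (N m0 : nat) :
  (forall i, 0 < x i) -> (forall i j, x i = x j -> i = j) ->
  (m0 < N)%nat -> b m0 <> RtoC 0 -> exists s, expsum x b N s <> RtoC 0.
Proof.
  intros Hx Hinj Hm Hb. apply NNPP. intros K.
  (* [pr j m] is the product of x m - x i over i < j with i <> m0. *)
  set (pr := fix pr (j m : nat) : C := match j with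
     | O => RtoC 1
     | S j' => if Nat.eq_dec j' m0 then pr j' m else (pr j' m * (RtoC (x m) - RtoC (x j')))%C end).
  assert (A : forall j s, expsum x (fun m => b m * pr j m)%C N s = RtoC 0).
  { induction j as [|j IH]; intros s.
    - apply NNPP. intros Hs. apply K. exists s. intros E. apply Hs. rewrite <- E.
      apply csum_ext. intros i _. simpl. ring.
    - simpl. destruct (Nat.eq_dec j m0); [apply IH|].
      replace (RtoC 0) with (RtoC 0 - RtoC (x j) * RtoC 0)%C by ring.
      rewrite <- (IH s) at 2. rewrite <- (IH (s - 1)%C). unfold expsum.
      rewrite <- csum_scal, <- csum_minus. apply csum_ext. intros i _.
      rewrite Cpow_neg_pred by apply Hx. ring. }
  assert (Z : forall j m, (m < j)%nat -> m <> m0 -> pr j m = RtoC 0).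
  { induction j as [|j IH]; intros m Hj Hne; [lia|]. simpl.
    destruct (Nat.eq_dec m j) as [->|nj].
    - destruct (Nat.eq_dec j m0); [contradiction|]. ring.
    - rewrite IH by lia. destruct (Nat.eq_dec j m0); ring. }
  assert (NZ : forall j, pr j m0 <> RtoC 0).
  { induction j as [|j IH]; simpl; [apply RtoC_neq0; lra|].
    destruct (Nat.eq_dec j m0) as [e|ne]; [exact IH|]. apply Cmult_neq_0; [exact IH|].
    rewrite <- RtoC_minus. apply RtoC_neq0. intros E. apply ne. symmetry. apply Hinj. lra. }
  specialize (A N (RtoC 0)). unfold expsum in A. rewrite (csum_single _ N m0 Hm) in A.
  - revert A. repeat apply Cmult_neq_0; auto. apply Cpow_neg_neq0.
  - intros i Hi Hne. rewrite (Z N i Hi Hne). ring.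
Qed.

(** Almost periodicity combined with a Hurwitz argument. Translating by i Im s multiplies each
    coefficient by a unimodular phase. If the values come close to 0, the phases and Re s cluster at
    some [U] and [sg]; the sum [g] with coefficients b m U m is not identically 0 but vanishes at
    [sg]. On a small circle around [sg], |g| is bounded below, hence so is a nearby translate; the
    minimum modulus principle in the zero-free strip carries the bound to the centre, where the
    translate is almost 0. *)
Lemma expsum_lower_bound (x : nat -> R) (b : nat -> C) (N m0 : nat) (A a c B : R) :
  (forall i, 0 < x i) -> (forall i j, x i = x j -> i = j) ->
  (m0 < N)%nat -> b m0 <> RtoC 0 -> A < a -> c < B ->
  (forall s, A < Re s < B -> expsum x b N s <> RtoC 0) ->
  exists eta, 0 < eta /\ forall s, a <= Re s <= c -> eta <= Cmod (expsum x b N s).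
Proof.
  intros Hx Hinj Hm Hb HA HB Hnz. apply NNPP. intros Hno.
  set (u := fun m (s : C) => Cpow_neg (x m) (0, Im s)).
  assert (Mu : forall m s, Cmod (u m s) = 1).
  { intros m s. unfold u. rewrite Cmod_Cpow_neg. simpl. rewrite Rmult_0_r. apply exp_0. }
  set (P := fun e (s : C) => a <= Re s <= c /\ Cmod (expsum x b N s) < e).
  (* The 2 N + 1 real coordinates: real parts of the phases, their imaginary parts, and Re s as
     coordinate 2 N. *)
  set (co := fun i (s : C) => if (i <? N)%nat then Re (u i s)
       else if (i <? 2 * N)%nat then Im (u (i - N)%nat s) else Re s).
  assert (PB1 := Rmax_l 1 (Rmax (Rabs a) (Rabs c))).
  assert (PB2 := Rmax_l (Rabs a) (Rabs c)). assert (PB3 := Rmax_r (Rabs a) (Rabs c)).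
  assert (PB4 := Rmax_r 1 (Rmax (Rabs a) (Rabs c))).
  set (W := Rmax 1 (Rmax (Rabs a) (Rabs c))) in *.
  destruct (cluster_point C P co W (S (2 * N))) as [l Hl].
  { intros e e' s He [H1 H2]. split; [exact H1|lra]. }
  { intros e s i _ [H1 _]. unfold co.
    assert (A1 := Rle_abs a). assert (A2 := Rle_abs c). assert (A3 := Rle_abs (- a)).
    rewrite Rabs_Ropp in A3.
    destruct (i <? N)%nat; [|destruct (i <? 2 * N)%nat].
    - assert (D := re_le_Cmod (u i s)). rewrite Mu in D. apply Rabs_le_between in D. lra.
    - assert (D := Cmod_Im (u (i - N)%nat s)). rewrite Mu in D. apply Rabs_le_between in D. lra.
    - lra. }
  { intros e He. apply NNPP. intros K. apply Hno. exists e. split; [exact He|].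
    intros s Hs. apply Rnot_lt_le. intros L. apply K. exists s. split; assumption. }
  set (U := fun m => (l m, l (N + m)%nat) : C). set (sg := l (2 * N)%nat).
  assert (Hlim : forall e, 0 < e -> exists s, P e s /\ Rabs (Re s - sg) < e /\
      forall m, (m < N)%nat -> Cmod (u m s - U m)%C < 2 * e).
  { intros e He. destruct (Hl e He) as [s [Ps Hs]]. exists s. split; [exact Ps|split].
    - specialize (Hs (2 * N)%nat ltac:(lia)). unfold co in Hs.
      rewrite (proj2 (Nat.ltb_ge (2 * N) N)), Nat.ltb_irrefl in Hs by lia. exact Hs.
    - intros m Hm'. assert (S1 := Hs m ltac:(lia)). assert (S2 := Hs (N + m)%nat ltac:(lia)).
      unfold co in S1, S2.
      rewrite (proj2 (Nat.ltb_lt m N)) in S1 by lia.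
      rewrite (proj2 (Nat.ltb_ge (N + m) N)), (proj2 (Nat.ltb_lt (N + m) (2 * N))) in S2 by lia.
      replace (N + m - N)%nat with m in S2 by lia.
      eapply Rle_lt_trans; [apply Cmod_le_ReIm|].
      replace (Re (u m s - U m)%C) with (Re (u m s) - l m) by reflexivity.
      replace (Im (u m s - U m)%C) with (Im (u m s) - l (N + m)%nat) by reflexivity. lra. }
  clearbody sg.
  assert (HU : U m0 <> RtoC 0).
  { intros E. destruct (Hlim (/ 4) ltac:(lra)) as [s [_ [_ Hs]]]. specialize (Hs m0 Hm).
    rewrite E in Hs. replace (u m0 s - RtoC 0)%C with (u m0 s) in Hs by ring. rewrite Mu in Hs. lra. }
  assert (Hsg : a <= sg <= c).
  { split; apply le_epsilon; intros e He; destruct (Hlim e He) as [s [[Hs _] [Hs2 _]]];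
      apply Rabs_def2 in Hs2; lra. }
  set (g := expsum x (fun m => b m * U m)%C N).
  destruct (expsum_nonzero x (fun m => b m * U m)%C N m0 Hx Hinj Hm (Cmult_neq_0 _ _ Hb HU)) as [w0 Hw0].
  (* Bounds the terms for |Re w - sg| <= 1, so that moving all phases by less than 2 e changes the
     sum by at most 2 e C0. *)
  set (C0 := rsum (fun m => Cmod (b m) * exp (Rabs (ln (x m)) * (Rabs sg + 1))) N).
  assert (PC0 : 0 <= C0).
  { apply rsum_nonneg. intros i. apply Rmult_le_pos; [apply Cmod_ge_0|left; apply exp_pos]. }
  assert (Happ : forall e s w, 0 < e -> (forall m, (m < N)%nat -> Cmod (u m s - U m)%C < 2 * e) ->
     Rabs (Re w - sg) <= 1 -> Cmod (expsum x b N (w + (0, Im s))%C - g w)%C <= 2 * e * C0).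
  { intros e s w He Hs Hw. unfold g, expsum. rewrite <- csum_minus.
    unfold C0. rewrite <- rsum_scal. apply csum_Cmod_le. intros i Hi.
    rewrite Cpow_neg_plus. fold (u i s).
    cmod_ring ((u i s - U i) * (b i * Cpow_neg (x i) w))%C.
    rewrite !Cmod_mult. apply Rmult_le_compat; [apply Cmod_ge_0| |left; apply Hs, Hi|].
    - apply Rmult_le_pos; apply Cmod_ge_0.
    - apply Rmult_le_compat_l; [apply Cmod_ge_0|]. rewrite Cmod_Cpow_neg.
      apply exp_monotone. eapply Rle_trans; [apply Rle_abs|].
      rewrite Rabs_mult, Rabs_Ropp. apply Rmult_le_compat_l; [apply Rabs_pos|].
      assert (T := Rabs_triang (Re w - sg) sg). replace (Re w - sg + sg) with (Re w) in T by ring. lra. }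
  assert (Gs : g (RtoC sg) = RtoC 0).
  { destruct (entire_at_Lipschitz g (RtoC sg) (entire_at_expsum _ _ _ _)) as [M [PM HM]].
    apply Cmod_eq_0, Rle_antisym; [|apply Cmod_ge_0]. apply le_epsilon. intros e He.
    set (d := Rmin 1 (e / (1 + 2 * C0 + M))).
    assert (d1 : d <= 1) by apply Rmin_l. assert (d2 : d <= e / (1 + 2 * C0 + M)) by apply Rmin_r.
    assert (d0 : 0 < d) by (apply Rmin_glb_lt; [lra|apply Rdiv_lt_0_compat; lra]).
    destruct (Hlim d d0) as [s [[_ Hs1] [Hs2 Hs3]]].
    assert (B1 := Happ d s (RtoC (Re s)) d0 Hs3 ltac:(simpl; lra)).
    replace (RtoC (Re s) + (0, Im s))%C with s in B1 by (destruct s; apply C_ext; simpl; ring).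
    assert (Mh : Cmod (RtoC (Re s - sg)) < d) by (rewrite Cmod_R; exact Hs2).
    assert (B2 := HM (RtoC (Re s - sg)) ltac:(lra)).
    replace (sg + RtoC (Re s - sg))%C with (RtoC (Re s)) in B2 by (rewrite <- RtoC_plus; f_equal; ring).
    assert (D1 := Cmod_sub_rev (g (RtoC (Re s))) (expsum x b N s)). rewrite Cmod_minus_sym in D1.
    assert (D2 := Cmod_sub_rev (g (RtoC sg)) (g (RtoC (Re s)))). rewrite Cmod_minus_sym in D2.
    assert (M * Cmod (RtoC (Re s - sg)) <= M * d) by (apply Rmult_le_compat_l; lra).
    assert (d * (1 + 2 * C0 + M) <= e) by (apply Rle_div_r; lra).
    lra. }
  destruct (entire_isolated_zeros g (RtoC sg) (entire_at_expsum _ _ _ _) (ex_intro _ w0 Hw0)) as [r [Pr Hr]].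
  (* The disc around [sg] avoids other zeros of g, stays in the range of [Happ], and lies in the
     open strip because a <= sg <= c. *)
  set (r1 := Rmin (r / 2) (Rmin 1 (Rmin ((a - A) / 2) ((B - c) / 2)))).
  assert (Q1 : r1 <= r / 2) by apply Rmin_l.
  assert (Q2 : r1 <= 1) by rmin_le.
  assert (Q3 : r1 <= (a - A) / 2) by rmin_le.
  assert (Q4 : r1 <= (B - c) / 2) by rmin_le.
  assert (Q0 : 0 < r1) by (repeat apply Rmin_glb_lt; lra).
  destruct (entire_attains_min g (fun z => Cmod (z - sg)%C = r1) (Cmod (RtoC sg) + r1)) as [z [Sz Hmin]].
  { intros z. apply entire_at_expsum. }
  { intros z Hz. apply Rle_antisym; apply le_epsilon; intros e He; destruct (Hz e He) as [w [W1 W2]].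
    - assert (D := Cmod_dist3 z w (RtoC sg)). rewrite (Cmod_minus_sym z w) in D. lra.
    - assert (D := Cmod_dist3 w z (RtoC sg)). lra. }
  { intros z Hz. assert (D := Cmod_sub_rev z (RtoC sg)). lra. }
  { exists (sg + r1)%C. replace (sg + r1 - sg)%C with (RtoC r1) by ring.
    rewrite Cmod_R, Rabs_pos_eq; lra. }
  set (eta := Cmod (g z)) in *.
  assert (Peta : 0 < eta).
  { apply Cmod_gt_0. replace z with (sg + (z - sg))%C by ring. apply Hr. lra. }
  (* Makes the approximation error at most eta / 4: the translate is at least eta / 2 on the circle,
     yet at most eta / 4 at the centre. *)
  set (e := eta / (4 * (2 * C0 + 1))).
  assert (Pe : 0 < e) by (apply Rdiv_lt_0_compat; lra).
  assert (Ee : e * (2 * C0 + 1) = eta / 4) by (unfold e; field; lra).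
  destruct (Hlim e Pe) as [s [_ [_ Hs]]].
  assert (F : eta / 2 <= Cmod (expsum x b N (sg + (0, Im s))%C)).
  { apply (entire_min_modulus _ _ r1); auto.
    - intros y. apply entire_at_expsum.
    - intros h Hh. apply Hnz. assert (D := re_le_Cmod h). apply Rabs_le_between in D.
      simpl. unfold Re in *. lra.
    - intros h Hh.
      assert (D := re_le_Cmod h). rewrite Hh in D.
      assert (B1 := Happ e s (sg + h)%C Pe Hs).
      replace (Re (sg + h)%C - sg) with (Re h) in B1 by (simpl; unfold Re; ring).
      specialize (B1 ltac:(lra)).
      assert (B2 := Hmin (sg + h)%C).
      replace (sg + h - sg)%C with h in B2 by ring. specialize (B2 Hh).
      replace (sg + (0%R, Im s) + h)%C with (sg + h + (0%R, Im s))%C by ring.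
      assert (D2 := Cmod_sub_rev (g (sg + h)%C) (expsum x b N (sg + h + (0%R, Im s))%C)).
      rewrite Cmod_minus_sym in D2. lra. }
  assert (B1 := Happ e s (RtoC sg) Pe Hs ltac:(simpl; rewrite Rminus_diag, Rabs_R0; lra)).
  rewrite Gs in B1.
  replace (expsum x b N (sg + (0%R, Im s)) - RtoC 0)%C
    with (expsum x b N (sg + (0%R, Im s))%C) in B1 by ring.
  lra.
Qed.

(** * The Gamma function as an Euler limit *)

Lemma INR_S_pos n : 0 < INR (S n).
Proof. apply lt_0_INR. lia. Qed.

Lemma is_lim_seq_INR_S : is_lim_seq (fun n => INR (S n)) p_infty.
Proof. apply (is_lim_seq_incr_1 INR), is_lim_seq_INR. Qed.

Lemma inv_INR_S_lim (c : R) : is_lim_seq (fun n => c / INR (S n)) 0.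
Proof.
  replace (Finite 0) with (Rbar_mult c (Rbar_inv p_infty)) by (simpl; f_equal; ring).
  apply is_lim_seq_scal_l, is_lim_seq_inv; [apply is_lim_seq_INR_S|discriminate].
Qed.

Lemma BI_nat al n : 0 < al ->
  BI al 0 (RtoC (INR (S n))) = RtoC (INR (fact n) / al ^ S n).
Proof.
  intros Ha. induction n as [|n IH].
  - simpl INR. rewrite BI_1 by exact Ha. f_equal. simpl. field. lra.
  - assert (E := BI_rec0 al (RtoC (INR (S n))) Ha).
    rewrite <- RtoC_plus in E. rewrite <- S_INR in E.
    assert (H1 : 1 <= Re (RtoC (INR (S n)))).
    { change (1 <= INR (S n)). rewrite S_INR. assert (A := pos_INR n). lra. }
    specialize (E H1). rewrite IH in E.
    replace (BI al 0 (RtoC (INR (S (S n))))) with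
      (/ RtoC al * (al * BI al 0 (RtoC (INR (S (S n))))))%C by (field; apply RtoC_neq0; lra).
    rewrite E. rewrite <- RtoC_inv, <- !RtoC_mult by lra. f_equal.
    rewrite (fact_simpl n), mult_INR. simpl pow. field. split; [apply pow_nonzero|]; lra.
Qed.

(** The moment of order r of al e^t / N under the Gamma(N) density for al e^t, with N = n + 1. *)
Definition gamma_moment (al r : R) n : R :=
  Re (BI al 0 (RtoC (INR (S n) + r))) * exp (- r * ln (INR (S n) / al)) / (INR (fact n) / al ^ S n).

Lemma gamma_moment_succ (al r : R) n : 0 < al -> 1 <= INR (S n) + r ->
  gamma_moment al (r + 1) n = gamma_moment al r n * (1 + r / INR (S n)).
Proof.
  intros Ha Hr. unfold gamma_moment.
  assert (E := BI_rec0 al (RtoC (INR (S n) + r)) Ha Hr).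
  rewrite <- RtoC_plus in E. apply (f_equal Re) in E.
  assert (PN := INR_S_pos n).
  replace (INR (S n) + (r + 1)) with (INR (S n) + r + 1) by ring.
  replace (- (r + 1) * ln (INR (S n) / al)) with (- r * ln (INR (S n) / al) + - ln (INR (S n) / al)) by ring.
  rewrite exp_plus, (exp_Ropp (ln _)), exp_ln by (apply Rdiv_lt_0_compat; lra).
  set (z := BI al 0 (RtoC (INR (S n) + r + 1))) in *. set (w := BI al 0 (RtoC (INR (S n) + r))) in *.
  assert (E2 : Re z = (INR (S n) + r) * Re w / al).
  { destruct z as [z1 z2], w as [w1 w2].
    assert (E3 : al * z1 = (INR (S n) + r) * w1).
    { revert E. generalize (INR (S n) + r). intros q. simpl. lra. }
    change (z1 = (INR (S n) + r) * w1 / al). rewrite <- E3. field. lra. }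
  rewrite E2. assert (Pf := INR_fact_lt_0 n). assert (Pa := pow_lt al (S n) Ha).
  field. repeat split; lra.
Qed.

Lemma gamma_moment_ev (r : R) : exists M, forall n, (M <= n)%nat -> 1 <= INR (S n) + r.
Proof.
  destruct (INR_unbounded (1 - r)) as [M HM]. exists M. intros n Hn.
  apply le_INR in Hn. rewrite S_INR. lra.
Qed.

Lemma one_plus_inv_lim (r : R) : is_lim_seq (fun n => 1 + r / INR (S n)) 1.
Proof.
  replace (Finite 1) with (Finite (1 + 0)) by (f_equal; ring).
  apply is_lim_seq_plus'; [apply is_lim_seq_const|apply inv_INR_S_lim].
Qed.

Lemma gamma_moment_lim_succ (al r : R) : 0 < al ->
  is_lim_seq (gamma_moment al r) 1 -> is_lim_seq (gamma_moment al (r + 1)) 1.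
Proof.
  intros Ha H. destruct (gamma_moment_ev r) as [M HM].
  apply (is_lim_seq_ext_loc (fun n => gamma_moment al r n * (1 + r / INR (S n)))).
  - exists M. intros n Hn. symmetry. apply gamma_moment_succ; auto.
  - replace (Finite 1) with (Finite (1 * 1)) by (f_equal; ring).
    apply is_lim_seq_mult'; [exact H|apply one_plus_inv_lim].
Qed.

Lemma gamma_moment_lim_pred (al r : R) : 0 < al ->
  is_lim_seq (gamma_moment al r) 1 -> is_lim_seq (gamma_moment al (r - 1)) 1.
Proof.
  intros Ha H. destruct (gamma_moment_ev (r - 1)) as [M HM].
  apply (is_lim_seq_ext_loc (fun n => gamma_moment al r n * / (1 + (r - 1) / INR (S n)))).
  - exists M. intros n Hn. specialize (HM n Hn).
    replace r with (r - 1 + 1) at 1 by ring. rewrite gamma_moment_succ by auto.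
    assert (PN := INR_S_pos n). field. split; lra.
  - replace (Finite 1) with (Finite (1 * / 1)) by (f_equal; field).
    apply is_lim_seq_mult'; [exact H|].
    apply (is_lim_seq_inv _ (Finite 1)); [apply one_plus_inv_lim|].
    intros E. inversion E. lra.
Qed.

(** The moment of order 0 equals 1, and unit steps in both directions only bring factors tending to
    1. *)
Lemma gamma_moment_lim_nat al (m : nat) : 0 < al ->
  is_lim_seq (gamma_moment al (INR m)) 1 /\ is_lim_seq (gamma_moment al (- INR m)) 1.
Proof.
  intros Ha. induction m as [|m [IH1 IH2]].
  - assert (H0 : is_lim_seq (gamma_moment al 0) 1).
    { apply (is_lim_seq_ext (fun _ => 1)); [|apply is_lim_seq_const].
      intros n. unfold gamma_moment. rewrite Rplus_0_r, BI_nat by exact Ha.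
      replace (- 0 * ln (INR (S n) / al)) with 0 by ring. rewrite exp_0. simpl Re.
      assert (Pf := INR_fact_lt_0 n). assert (Pa := pow_lt al (S n) Ha). simpl. field.
      simpl in Pa. split; [|split]; nra. }
    simpl. rewrite Ropp_0. split; exact H0.
  - rewrite S_INR. split; [apply gamma_moment_lim_succ; auto|].
    replace (- (INR m + 1)) with (- INR m - 1) by ring. apply gamma_moment_lim_pred; auto.
Qed.

Lemma sq_le_cosh (v : R) : v ^ 2 <= 4 * (exp v + exp (- v) - 2).
Proof.
  assert (H : forall w, 0 <= w -> w ^ 2 <= 4 * (exp w + exp (- w) - 2)).
  { intros w Hw. assert (A := exp_ineq1_le (w / 2)). assert (B := exp_ineq1_le (- w)).
    replace (exp w) with (exp (w / 2) * exp (w / 2)) by (rewrite <- exp_plus; f_equal; field).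
    nra. }
  destruct (Rle_dec 0 v) as [L|L]; [apply H, L|].
  assert (A := H (- v) ltac:(lra)). rewrite Ropp_involutive in A.
  replace ((- v) ^ 2) with (v ^ 2) in A by ring. lra.
Qed.

(** Replaces |v| by exponentials, whose integrals are Gamma moments. Since those moments tend to 1,
    the term e^v + e^(-v) - 2 contributes nothing in the limit, however small e is. *)
Lemma Rabs_le_eps_cosh (e v : R) : 0 < e -> Rabs v <= e + 4 / e * (exp v + exp (- v) - 2).
Proof.
  intros He. assert (A := sq_le_cosh v).
  assert (B : Rabs v * e <= e * e + v ^ 2).
  { rewrite <- (pow2_abs v). assert (P := Rabs_pos v). nra. }
  apply (Rmult_le_reg_r e); [exact He|].
  replace ((e + 4 / e * (exp v + exp (- v) - 2)) * e) with (e * e + 4 * (exp v + exp (- v) - 2)) by (field; lra).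
  lra.
Qed.

Lemma Cexp_minus_1_bound (w : C) : Cmod (Cexp w - 1)%C <= Cmod w * exp (Cmod w).
Proof.
  assert (A := cexp_taylor_bound 1 w). unfold cexp_taylor in A. simpl in A.
  replace (RtoC 0 + 1 / 1)%C with (RtoC 1) in A by field.
  replace (Cmod w * 1 / 1) with (Cmod w) in A by field. exact A.
Qed.

(** The integer [m] above |s| is there so that the majorant contains only exponentials of integer
    multiples of v, that is, moments of integer order. *)
Lemma kernel_perturbation (m : nat) s (b v e : R) :
  0 < e -> 0 <= b -> Cmod s <= INR m ->
  Cmod (RtoC (exp (- b)) * Cexp (s * v) - 1)%C <=
  INR m * ((e + 4 / e * (exp v + exp (- v) - 2)) * (exp (INR m * v) + exp (- (INR m * v)))) + b.
Proof.
  intros He Hb Hs.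
  replace (RtoC (exp (- b)) * Cexp (s * v) - 1)%C
    with (RtoC (exp (- b)) * (Cexp (s * v) - 1) + RtoC (exp (- b) - 1))%C
    by (rewrite RtoC_minus; ring).
  assert (Pb := exp_pos (- b)).
  assert (B1 : exp (- b) <= 1) by (rewrite <- exp_0; apply exp_monotone; lra).
  assert (B2 := exp_ineq1_le (- b)).
  eapply Rle_trans; [apply Cmod_triangle|]. apply Rplus_le_compat.
  - rewrite Cmod_mult, Cmod_R, Rabs_pos_eq by lra.
    apply Rle_trans with (1 * Cmod (Cexp (s * v) - 1)%C);
      [apply Rmult_le_compat_r; [apply Cmod_ge_0|lra]|rewrite Rmult_1_l].
    eapply Rle_trans; [apply Cexp_minus_1_bound|]. rewrite Cmod_mult, Cmod_R.
    assert (Pv := Rabs_pos v). assert (Ps := Cmod_ge_0 s).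
    assert (Lv := Rabs_le_eps_cosh e v He).
    assert (Le : exp (Cmod s * Rabs v) <= exp (INR m * v) + exp (- (INR m * v))).
    { apply Rle_trans with (exp (INR m * Rabs v)); [apply exp_monotone, Rmult_le_compat_r; assumption|].
      assert (X := exp_pos (INR m * v)). assert (Y := exp_pos (- (INR m * v))).
      unfold Rabs. destruct (Rcase_abs v); [|lra].
      replace (INR m * - v) with (- (INR m * v)) by ring. lra. }
    rewrite Rmult_assoc.
    apply Rmult_le_compat; [exact Ps| |exact Hs|].
    + apply Rmult_le_pos; [exact Pv|left; apply exp_pos].
    + apply Rmult_le_compat; [exact Pv|left; apply exp_pos|exact Lv|exact Le].
  - rewrite Cmod_R. apply Rabs_le. lra.
Qed.

(* Under the Gamma(N) density, [al * exp t] concentrates at [N], so [exp (s t)] may be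
   replaced by [(N / al) ^ s]. *)
Lemma BI_asymptotic al be s : 0 < al -> 0 <= be ->
  Clim (fun n => BI al be (s + INR (S n)) * Cexp (- s * RtoC (ln (INR (S n) / al)))
                 / RtoC (INR (fact n) / al ^ S n))%C 1%C.
Proof.
  intros Ha Hbe eta Heta.
  destruct (INR_unbounded (Cmod s)) as [m Hm]. set (p := INR m) in *.
  assert (Ps := Cmod_ge_0 s). assert (Pp : 0 < p) by lra.
  set (e := eta / (4 * p)). assert (Pe : 0 < e) by (apply Rdiv_lt_0_compat; lra).
  set (c1 := p * e). set (c2 := p * (4 / e)).
  (* The integrated majorant, divided by the mass [J]. In the limit the coefficients of c2 cancel, 4
     - 4 = 0, the last term vanishes, and 2 c1 = 2 p e = eta / 2 remains. *)
  set (Q := fun n => c1 * gamma_moment al p n + c1 * gamma_moment al (- p) n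
     + c2 * gamma_moment al (p + 1) n + c2 * gamma_moment al (- p + 1) n
     + c2 * gamma_moment al (p - 1) n + c2 * gamma_moment al (- p - 1) n
     + (- 2 * c2) * gamma_moment al p n + (- 2 * c2) * gamma_moment al (- p) n
     + be * al / INR (S n) * gamma_moment al (- 1) n).
  assert (LQ : is_lim_seq Q (eta / 2)).
  { destruct (gamma_moment_lim_nat al m Ha) as [G1 G2]. fold p in G1, G2.
    assert (G3 := gamma_moment_lim_succ _ _ Ha G1). assert (G4 := gamma_moment_lim_succ _ _ Ha G2).
    assert (G5 := gamma_moment_lim_pred _ _ Ha G1). assert (G6 := gamma_moment_lim_pred _ _ Ha G2).
    assert (G7 := proj2 (gamma_moment_lim_nat al 1 Ha)). simpl in G7.
    replace (Finite (eta / 2)) with (Finite (c1 * 1 + c1 * 1 + c2 * 1 + c2 * 1 + c2 * 1 + c2 * 1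
       + (- 2 * c2) * 1 + (- 2 * c2) * 1 + 0 * 1)).
    2:{ f_equal. unfold c1, e. field. lra. }
    unfold Q. repeat apply is_lim_seq_plus'; try (apply is_lim_seq_mult'; [apply is_lim_seq_const|assumption]).
    apply is_lim_seq_mult'; [apply inv_INR_S_lim|exact G7]. }
  apply is_lim_seq_spec in LQ. destruct (LQ (mkposreal (eta / 2) ltac:(lra))) as [M1 HM1]. simpl in HM1.
  destruct (INR_unbounded (p + 2 + Cmod s)) as [M2 HM2].
  exists (max M1 M2). intros n Hn.
  specialize (HM1 n ltac:(lia)). apply Rabs_def2 in HM1.
  assert (HN : INR M2 <= INR n) by (apply le_INR; lia).
  set (N := INR (S n)) in *. assert (HN1 : N = INR n + 1) by apply S_INR.
  set (L := ln (N / al)). set (J := INR (fact n) / al ^ S n).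
  assert (PJ : 0 < J) by (apply Rdiv_lt_0_compat; [apply INR_fact_lt_0|apply pow_lt, Ha]).
  assert (PN : 0 < N) by apply INR_S_pos.
  assert (PNal : 0 < N / al) by (apply Rdiv_lt_0_compat; lra).
  assert (HsR := re_le_Cmod s). apply Rabs_le_between in HsR.
  set (X := Cexp (- s * L)).
  assert (I1 : is_int (fun t => X * Kexp al be (s + N) t - Kexp al 0 (RtoC N) t)%C
     (X * BI al be (s + N) - J)%C).
  { apply is_int_minus.
    - apply is_int_scal, BI_correct. split; [exact Ha|split; [exact Hbe|right]].
      rewrite Re_Cplus. simpl. lra.
    - unfold J. rewrite <- BI_nat by exact Ha. apply BI_correct.
      split; [exact Ha|split; [lra|right]]. change (1 <= N). lra. }
  (* With v = t - L, [h r t] is the Gamma(N) weight times e^(r v), where e^v = al e^t / N. *)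
  set (h := fun r t => wexp al 0 (N + r) t * exp (- r * L)).
  set (b := fun r => (BI al 0 (RtoC (N + r)) * RtoC (exp (- r * L)))%C).
  assert (Ib : forall r, 1 <= N + r -> is_int (fun t => RtoC (h r t)) (b r)).
  { intros r Hr. unfold b. rewrite Cmult_comm.
    eapply is_int_ext; [|apply is_int_scal, BI_correct].
    - intros t. simpl. rewrite Kexp_R, <- RtoC_mult. unfold h. rewrite Rmult_comm. reflexivity.
    - split; [exact Ha|split; [lra|right; exact Hr]]. }
  assert (Rb : forall r, Re (b r) = J * gamma_moment al r n).
  { intros r. unfold b, gamma_moment. fold N L J.
    replace (Re (BI al 0 (RtoC (N + r)) * RtoC (exp (- r * L)))%C)
      with (Re (BI al 0 (RtoC (N + r))) * exp (- r * L)) by (simpl; unfold Re; ring).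
    field. lra. }
  set (g := fun t => c1 * h p t + c1 * h (- p) t + c2 * h (p + 1) t + c2 * h (- p + 1) t
     + c2 * h (p - 1) t + c2 * h (- p - 1) t + (- 2 * c2) * h p t + (- 2 * c2) * h (- p) t
     + be * al / N * h (- 1) t).
  set (bg := (c1 * b p + c1 * b (- p)%R + c2 * b (p + 1)%R + c2 * b (- p + 1)%R
     + RtoC c2 * b (p - 1)%R + c2 * b (- p - 1)%R + RtoC (- 2 * c2) * b p + RtoC (- 2 * c2) * b (- p)%R
     + RtoC (be * al / N) * b (- 1)%R)%C).
  assert (Ig : is_int (fun t => RtoC (g t)) bg).
  { unfold bg. eapply is_int_ext;
      [|repeat apply is_int_plus; apply is_int_scal, Ib; lra].
    intros t. simpl. unfold g. rewrite !RtoC_plus, !(RtoC_mult _ (h _ _)). reflexivity. }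
  assert (Rbg : Re bg = J * Q n).
  { assert (Rm : forall (c : R) (z : C), Re (c * z)%C = c * Re z) by (intros; simpl; unfold Re; ring).
    unfold bg. rewrite !Re_Cplus, !Rm, !Rb. unfold Q. fold N. ring. }
  assert (Hle : Cmod (X * BI al be (s + N) - J)%C <= J * Q n).
  { rewrite <- Rbg. refine (is_int_Cmod_le _ _ _ _ _ I1 Ig). intros t. cbv beta.
    set (E := wexp al 0 N t). assert (PE : 0 < E) by apply exp_pos.
    set (v := t - L).
    assert (Hh : forall r, h r t = E * exp (r * v)).
    { intros r. unfold h, E, wexp, v. rewrite <- !exp_plus. f_equal. ring. }
    replace (X * Kexp al be (s + N) t - Kexp al 0 (RtoC N) t)%C
      with (E * (RtoC (exp (- (be * exp (- t)))) * Cexp (s * v) - 1))%C.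
    2:{ rewrite Kexp_R. fold E.
        replace (X * Kexp al be (s + N) t)%C
          with (E * RtoC (exp (- (be * exp (- t)))) * Cexp (s * v))%C; [ring|].
        unfold X, Kexp, E, wexp. rewrite <- !Cexp_R, <- !Cexp_plus. f_equal.
        unfold v. rewrite !RtoC_plus, !RtoC_minus, !RtoC_opp, !RtoC_mult. ring. }
    rewrite Cmod_mult, Cmod_R, Rabs_pos_eq by lra.
    assert (KP := kernel_perturbation m s (be * exp (- t)) v e Pe).
    specialize (KP ltac:(apply Rmult_le_pos; [lra|left; apply exp_pos]) ltac:(fold p; lra)). fold p in KP.
    (* Turns the [be] term into a moment of order -1 with the vanishing factor be al / N. *)
    assert (Et : exp (- t) = al / N * exp (- 1 * v)).
    { unfold v. replace (- 1 * (t - L)) with (- t + L) by ring. rewrite exp_plus. unfold L.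
      rewrite exp_ln by exact PNal. field. lra. }
    apply Rle_trans with (E * (p * ((e + 4 / e * (exp v + exp (- v) - 2)) * (exp (p * v) + exp (- (p * v))))
       + be * exp (- t))); [apply Rmult_le_compat_l; lra|].
    right. unfold g. rewrite !Hh, Et.
    replace ((p + 1) * v) with (p * v + v) by ring.
    replace ((- p + 1) * v) with (- (p * v) + v) by ring.
    replace ((p - 1) * v) with (p * v + - v) by ring.
    replace ((- p - 1) * v) with (- (p * v) + - v) by ring.
    replace (- p * v) with (- (p * v)) by ring.
    rewrite !exp_plus. unfold c1, c2. field. lra. }
  replace (BI al be (s + N) * X / J - 1)%C
    with ((X * BI al be (s + N) - J) / J)%C by (field; apply RtoC_neq0; lra).
  rewrite Cmod_div by (apply RtoC_neq0; lra). rewrite (Cmod_R J), Rabs_pos_eq by lra.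
  apply Rle_lt_trans with (Q n); [|lra].
  apply Rle_div_l; lra.
Qed.

Lemma Cinv_neq_0 z : z <> RtoC 0 -> (/ z)%C <> RtoC 0.
Proof.
  intros Hz E. apply (RtoC_neq0 1); [lra|].
  rewrite <- (Cinv_r z Hz), E. ring.
Qed.

Fixpoint rising s n : C :=
  match n with O => RtoC 1 | S p => (rising s p * (s + INR p))%C end.

Lemma rising_neq0 s n : Im s <> 0 -> rising s n <> RtoC 0.
Proof.
  intros Hs. induction n as [|n IH]; simpl; [apply RtoC_neq0; lra|].
  apply Cmult_neq_0; [exact IH|]. apply Im_neq0. rewrite Im_Cplus. simpl. lra.
Qed.

Lemma rising_S_l s n : rising s (S n) = (s * rising (s + 1) n)%C.
Proof.
  induction n as [|n IH]; [simpl; ring|].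
  change (rising s (S (S n))) with (rising s (S n) * (s + INR (S n)))%C.
  rewrite IH. simpl rising. rewrite S_INR, RtoC_plus. ring.
Qed.

(** (n + 1)^s n! / (s (s + 1) ... (s + n)): Euler's limit, with n + 1 instead of n as base to match
    the parameter N of [BI_asymptotic]. *)
Definition euler s n : C :=
  (Cpow_neg (INR (S n)) (- s) * INR (fact n) / rising s (S n))%C.

Definition Gam s : C := Climit (euler s).

Lemma Cpow_neg_nat al n : 0 < al -> Cpow_neg al (RtoC (INR n)) = RtoC (/ al ^ n).
Proof.
  intros Ha. induction n as [|n IH].
  - simpl. unfold Cpow_neg. replace (RtoC (- ln al) * 0)%C with (RtoC 0) by ring.
    rewrite Cexp_0. f_equal. field.
  - rewrite S_INR, RtoC_plus, Cpow_neg_plus, IH, Cpow_neg_1, <- RtoC_mult by exact Ha.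
    f_equal. simpl. field. split; try apply pow_nonzero; lra.
Qed.

Lemma Cexp_ln_div s (x al : R) : 0 < x -> 0 < al ->
  Cexp (- s * RtoC (ln (x / al)))%C = (Cpow_neg x s / Cpow_neg al s)%C.
Proof.
  intros Hx Ha. unfold Cdiv. rewrite <- Cpow_neg_opp. unfold Cpow_neg. rewrite <- Cexp_plus. f_equal.
  unfold Rdiv. rewrite ln_mult, ln_Rinv by (try apply Rinv_0_lt_compat; lra).
  rewrite !RtoC_plus, !RtoC_opp. ring.
Qed.

Lemma add_INR_S s n : (s + INR (S n) = s + INR n + 1)%C.
Proof. rewrite S_INR, RtoC_plus. ring. Qed.

Lemma BI0_rising s n : 1 <= Re s -> BI 1 0 (s + INR n)%C = (rising s n * BI 1 0 s)%C.
Proof.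
  intros Hs. induction n as [|n IH].
  - simpl. replace (s + RtoC 0)%C with s by ring. ring.
  - assert (E := BI_rec0 1 (s + INR n)%C ltac:(lra)).
    rewrite Re_Cplus in E. assert (Pn := pos_INR n). simpl (Re (RtoC _)) in E. specialize (E ltac:(lra)).
    rewrite add_INR_S.
    replace (BI 1 0 (s + INR n + 1)) with (RtoC 1 * BI 1 0 (s + INR n + 1))%C by ring.
    rewrite E, IH. simpl. ring.
Qed.

(** For al = 1, be = 0 the asymptotics of [BI], unwound by its functional equation, say that BI 1 0
    s / euler s n tends to 1. This also forces BI 1 0 s <> 0. *)
Lemma euler_lim_right s : 1 <= Re s -> Im s <> 0 ->
  BI 1 0 s <> RtoC 0 /\ Clim (euler s) (BI 1 0 s).
Proof.
  intros Hs Hi. assert (H := BI_asymptotic 1 0 s ltac:(lra) ltac:(lra)).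
  assert (H2 : Clim (fun n => BI 1 0 s * / euler s n)%C 1%C).
  { eapply Clim_ext; [|exact H]. intros n. cbv beta. rewrite BI0_rising by exact Hs.
    rewrite Cexp_ln_div by (try apply INR_S_pos; lra).
    unfold euler. rewrite Cpow_neg_opp.
    assert (E1 : Cpow_neg 1 s = RtoC 1).
    { unfold Cpow_neg. rewrite ln_1. replace (RtoC (- 0) * s)%C with (RtoC 0).
      - apply Cexp_0.
      - rewrite Ropp_0. ring. }
    rewrite E1, pow1. replace (INR (fact n) / 1) with (INR (fact n)) by field.
    assert (A := Cpow_neg_neq0 (INR (S n)) s). assert (B := rising_neq0 s (S n) Hi).
    assert (D := fact_C_neq0 n).
    generalize dependent (rising s (S n)). intros z Hz. field. auto. }
  assert (N0 : BI 1 0 s <> RtoC 0).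
  { intros E. rewrite E in H2. apply (RtoC_neq0 1); [lra|].
    apply (Clim_unique _ _ _ H2). eapply Clim_ext; [|apply Clim_const].
    intros n. simpl. ring. }
  split; [exact N0|].
  apply Clim_inv in H2; [|apply RtoC_neq0; lra]. apply (Clim_scal (BI 1 0 s)) in H2.
  replace (BI 1 0 s * / 1)%C with (BI 1 0 s) in H2 by field.
  eapply Clim_ext; [|exact H2]. intros n. cbv beta.
  assert (Ne : euler s n <> RtoC 0).
  { unfold euler, Cdiv. repeat apply Cmult_neq_0; [apply Cpow_neg_neq0|apply fact_C_neq0|].
    apply Cinv_neq_0, rising_neq0, Hi. }
  field. auto.
Qed.

Lemma euler_shift s n : Im s <> 0 ->
  euler s n = (euler (s + 1) n * (/ s * (1 + s * / INR (S n))))%C.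
Proof.
  intros Hi. unfold euler. assert (PN := INR_S_pos n).
  assert (Hi1 : Im (s + 1)%C <> 0) by (rewrite Im_Cplus; simpl; lra).
  assert (A := rising_neq0 _ (S n) Hi). assert (B := rising_neq0 _ (S n) Hi1).
  assert (Es := Im_neq0 s Hi).
  assert (E : (s * rising (s + 1) (S n) = rising s (S n) * (s + INR (S n)))%C).
  { rewrite <- rising_S_l. reflexivity. }
  assert (EN : (s + INR (S n))%C <> RtoC 0).
  { apply Im_neq0. rewrite Im_Cplus. simpl. lra. }
  assert (RN : RtoC (INR (S n)) <> RtoC 0) by (apply RtoC_neq0; lra).
  replace (- (s + 1))%C with (- s - 1)%C by ring. rewrite Cpow_neg_pred by exact PN.
  replace (rising (s + 1) (S n)) with (/ s * (s * rising (s + 1) (S n)))%C by (field; exact Es).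
  rewrite E. field. repeat split; auto.
Qed.

Lemma inv_INR_S_Clim s : Clim (fun n => 1 + s * / INR (S n))%C 1%C.
Proof.
  assert (H : Clim (fun n => 1 + s * / INR (S n))%C (1 + s * 0)%C).
  { apply Clim_plus; [apply Clim_const|]. apply Clim_scal.
    eapply Clim_ext; [|apply (Clim_R (fun n => 1 / INR (S n)) 0); apply inv_INR_S_lim].
    intros n. unfold Rdiv. rewrite Rmult_1_l, RtoC_inv; [reflexivity|]. apply Rgt_not_eq, INR_S_pos. }
  replace (1 + s * 0)%C with (RtoC 1) in H by ring. exact H.
Qed.

(** Starts from the half-plane Re s >= 1 and moves left by unit steps, each costing the factor 1 /
    s. *)
Lemma euler_lim_exists s : Im s <> 0 -> exists l, l <> RtoC 0 /\ Clim (euler s) l.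
Proof.
  intros Hi. destruct (INR_unbounded (1 - Re s)) as [M HM].
  revert s Hi HM. induction M as [|M IH]; intros s Hi HM.
  - simpl in HM. exists (BI 1 0 s). apply euler_lim_right; [lra|exact Hi].
  - destruct (IH (s + 1)%C) as [l [l0 Hl]].
    + rewrite Im_Cplus. simpl. lra.
    + rewrite S_INR in HM. rewrite Re_Cplus. simpl. lra.
    + assert (Es := Im_neq0 s Hi). exists (l * (/ s * 1))%C. split.
      * repeat apply Cmult_neq_0; [exact l0|apply Cinv_neq_0, Es|apply RtoC_neq0; lra].
      * eapply Clim_ext; [intros n; symmetry; apply euler_shift, Hi|].
        apply Clim_mult; [exact Hl|]. apply Clim_scal, inv_INR_S_Clim.
Qed.

Lemma Gam_lim s : Im s <> 0 -> Clim (euler s) (Gam s).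
Proof. intros Hi. destruct (euler_lim_exists s Hi) as [l [_ Hl]]. eapply Climit_correct, Hl. Qed.

Lemma Gam_neq0 s : Im s <> 0 -> Gam s <> RtoC 0.
Proof.
  intros Hi. destruct (euler_lim_exists s Hi) as [l [l0 Hl]].
  unfold Gam. rewrite (Climit_eq _ _ Hl). exact l0.
Qed.

Lemma Gam_rec s : Im s <> 0 -> Gam (s + 1)%C = (s * Gam s)%C.
Proof.
  intros Hi. assert (Es := Im_neq0 s Hi).
  assert (Hi1 : Im (s + 1)%C <> 0) by (rewrite Im_Cplus; simpl; lra).
  assert (E : Gam s = (Gam (s + 1) * (/ s * 1))%C).
  { eapply Clim_unique; [apply Gam_lim, Hi|].
    eapply Clim_ext; [intros n; symmetry; apply euler_shift, Hi|].
    apply Clim_mult; [apply Gam_lim, Hi1|]. apply Clim_scal, inv_INR_S_Clim. }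
  rewrite E. field. exact Es.
Qed.

Lemma rising_conj s n : rising (Cconj s) n = Cconj (rising s n).
Proof.
  induction n as [|n IH]; simpl; [apply C_ext; simpl; ring|].
  rewrite IH, Cmult_conj, Cplus_conj. f_equal. f_equal. apply C_ext; simpl; ring.
Qed.

Lemma Cconj_R (x : R) : Cconj (RtoC x) = RtoC x.
Proof. apply C_ext; simpl; ring. Qed.

Lemma Gam_conj s : Im s <> 0 -> Gam (Cconj s) = Cconj (Gam s).
Proof.
  intros Hi. apply Climit_eq. eapply Clim_ext; [|apply Clim_conj, Gam_lim, Hi].
  intros n. unfold euler. rewrite rising_conj, Cdiv_conj by (apply rising_neq0, Hi).
  rewrite Cmult_conj, Cconj_R, <- Cpow_neg_conj. reflexivity.
Qed.

Lemma Gam_rising s n : Im s <> 0 -> Gam (s + INR n)%C = (rising s n * Gam s)%C.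
Proof.
  intros Hi. induction n as [|n IH].
  - simpl. replace (s + RtoC 0)%C with s by ring. ring.
  - rewrite add_INR_S.
    rewrite Gam_rec, IH; [simpl; ring|]. rewrite Im_Cplus. simpl. lra.
Qed.

Definition dominant al s : C := (Gam s * Cpow_neg al s)%C.

Lemma dominant_neq0 al s : Im s <> 0 -> dominant al s <> RtoC 0.
Proof. intros Hs. apply Cmult_neq_0; [apply Gam_neq0, Hs|apply Cpow_neg_neq0]. Qed.

Lemma BI_over_dominant al be s : 0 < al -> 0 <= be -> Im s <> 0 ->
  Clim (fun n => BI al be (s + INR n) / dominant al (s + INR n))%C 1%C.
Proof.
  intros Ha Hb Hi. apply Clim_S_inv.
  assert (G : Clim (fun n => euler s n / Gam s)%C 1%C).
  { replace (RtoC 1) with (Gam s * / Gam s)%C by (field; apply Gam_neq0, Hi).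
    apply Clim_mult; [apply Gam_lim, Hi|apply Clim_const]. }
  assert (H := Clim_mult _ _ _ _ (BI_asymptotic al be s Ha Hb) G).
  replace (1 * 1)%C with (RtoC 1) in H by ring.
  eapply Clim_ext; [|exact H]. intros n. cbv beta.
  unfold dominant. rewrite Gam_rising by exact Hi. rewrite Cpow_neg_plus, Cpow_neg_nat by exact Ha.
  rewrite Cexp_ln_div by (try apply INR_S_pos; exact Ha).
  unfold euler. rewrite Cpow_neg_opp.
  assert (A := Cpow_neg_neq0 (INR (S n)) s). assert (B := rising_neq0 s (S n) Hi).
  assert (D := fact_C_neq0 n). assert (A' := Cpow_neg_neq0 al s). assert (G0 := Gam_neq0 s Hi).
  assert (Pa := pow_lt al (S n) Ha). assert (Pf := INR_fact_lt_0 n).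
  unfold Rdiv. rewrite RtoC_mult.
  assert (E : RtoC (/ al ^ S n) <> RtoC 0) by (apply RtoC_neq0, Rgt_not_eq, Rinv_0_lt_compat; lra).
  generalize dependent (rising s (S n)). intros z Hz.
  generalize dependent (RtoC (/ al ^ S n)). intros y Hy.
  field. repeat split; auto.
Qed.

(** * The connection formula *)

(** Lets the harmonic-type sums in [Gam_growth] telescope. *)
Lemma one_minus_inv_le_ln (x : R) : 1 < x -> / x <= ln x - ln (x - 1).
Proof.
  intros Hx. assert (A := exp_ineq1_le (ln (1 - / x))).
  assert (P : 0 < / x) by (apply Rinv_0_lt_compat; lra).
  assert (Q : / x < 1) by (rewrite <- Rinv_1; apply Rinv_lt_contravar; lra).
  rewrite exp_ln in A by lra.
  replace (x - 1) with (x * (1 - / x)) by (field; lra).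
  rewrite ln_mult by lra. lra.
Qed.

Lemma Cmod_sq (w : C) : Cmod w ^ 2 = Re w ^ 2 + Im w ^ 2.
Proof. unfold Cmod. rewrite pow2_sqrt; [reflexivity|]. simpl. nra. Qed.

(** From |w + h|^2 = |w|^2 (1 + 2 h (Re w + h / 2) / |w|^2) and 1 + x <= e^x. *)
Lemma Cmod_shift_le (w : C) (h q : R) : 0 <= h -> w <> RtoC 0 ->
  (Re w + h / 2) / Cmod w ^ 2 <= q -> Cmod (w + h)%C <= exp (h * q) * Cmod w.
Proof.
  intros Hh Hw Hq. assert (Pw := proj1 (Cmod_gt_0 w) Hw). assert (Pe := exp_pos (h * q)).
  apply Rsqr_incr_0_var; [|apply Rmult_le_pos; lra].
  rewrite !Rsqr_pow2, Rpow_mult_distr, !Cmod_sq.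
  replace (Re (w + h)%C) with (Re w + h) by reflexivity.
  replace (Im (w + h)%C) with (Im w) by (simpl; unfold Im; ring).
  assert (Q := Cmod_sq w). set (m := Cmod w) in *.
  assert (Pm : 0 < m ^ 2) by (apply pow_lt, Pw).
  assert (E : 2 * h * ((Re w + h / 2) / m ^ 2) <= 2 * h * q) by (apply Rmult_le_compat_l; lra).
  assert (X := exp_ineq1_le (2 * h * q)).
  replace (exp (h * q) ^ 2) with (exp (2 * h * q)) by (simpl; rewrite Rmult_1_r, <- exp_plus; f_equal; ring).
  rewrite <- Q.
  apply Rle_trans with ((1 + 2 * h * ((Re w + h / 2) / m ^ 2)) * m ^ 2).
  - right. replace ((1 + 2 * h * ((Re w + h / 2) / m ^ 2)) * m ^ 2)
      with (m ^ 2 + 2 * h * (Re w + h / 2)) by (field; lra). rewrite Q. field.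
  - apply Rmult_le_compat_r; lra.
Qed.

Lemma rising_shift_le s (h : R) (q : nat -> R) n : 0 <= h -> Im s <> 0 ->
  (forall i, (i < n)%nat -> (Re s + INR i + h / 2) / Cmod (s + INR i)%C ^ 2 <= q i) ->
  Cmod (rising (s + h) n) <= exp (h * rsum q n) * Cmod (rising s n).
Proof.
  intros Hh Hs. induction n as [|n IH]; intros Hq; simpl.
  - rewrite Rmult_0_r, exp_0. lra.
  - rewrite !Cmod_mult, Rmult_plus_distr_l, exp_plus.
    assert (A : Cmod (s + h + INR n)%C <= exp (h * q n) * Cmod (s + INR n)%C).
    { replace (s + h + INR n)%C with (s + INR n + h)%C by ring.
      apply Cmod_shift_le; [exact Hh| |].
      - apply Im_neq0. rewrite Im_Cplus. simpl. lra.
      - rewrite Re_Cplus. simpl (Re (RtoC _)). apply Hq. lia. }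
    assert (B := IH (fun i Hi => Hq i (Nat.lt_trans _ _ _ Hi (Nat.lt_succ_diag_r n)))).
    replace (exp (h * rsum q n) * exp (h * q n) * (Cmod (rising s n) * Cmod (s + INR n)%C))
      with ((exp (h * rsum q n) * Cmod (rising s n)) * (exp (h * q n) * Cmod (s + INR n)%C)) by ring.
    apply Rmult_le_compat; try apply Cmod_ge_0; assumption.
Qed.

(* Integrated form of [Re (Gamma' / Gamma) -> +oo] as [|Im s| -> oo] in vertical strips. *)
Lemma Gam_growth (K B : R) : 0 <= B -> exists T, 0 < T /\ forall s (h : R),
  Rabs (Re s) <= B -> 0 <= h <= 2 * B -> T <= Rabs (Im s) ->
  exp (K * h) * Cmod (Gam s) <= Cmod (Gam (s + h)%C).
Proof.
  (* With N = n + 1 the quotient |euler (s + h) n| / |euler s n| is at least exp (h (ln N - sum of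
     q)), so the aim is a sum of q at most ln N - K. Here a0 bounds Re s + h / 2, and l gives ln (l
     + 1) >= K + 1. *)
  intros HB. destruct (INR_unbounded (2 * B)) as [a0 Ha0].
  destruct (INR_unbounded (exp (K + 1))) as [l Hl].
  set (L := (2 * a0 + 2 + l)%nat).
  set (T := INR L + INR a0 + 1).
  assert (PL := pos_INR L). assert (Pa0 := pos_INR a0). assert (Pl := pos_INR l).
  exists T. split; [unfold T; lra|]. intros s h Hs Hh HT.
  apply Rabs_le_between in Hs.
  assert (Hy : Im s <> 0).
  { intros E. rewrite E, Rabs_R0 in HT. unfold T in HT. lra. }
  set (q := fun i => (INR i + INR a0) / ((Re s + INR i) ^ 2 + Im s ^ 2)).
  assert (Py : 0 < Im s ^ 2) by (rewrite <- (pow2_abs (Im s)); apply pow_lt, Rabs_pos_lt, Hy).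
  assert (HyT : T ^ 2 <= Im s ^ 2).
  { rewrite <- (pow2_abs (Im s)). apply pow_incr. unfold T in *. lra. }
  assert (Hden : forall i, 0 < (Re s + INR i) ^ 2 + Im s ^ 2).
  { intros i. assert (X := pow2_ge_0 (Re s + INR i)). lra. }
  (* The first L terms are each at most T / T^2 once |Im s| >= T, and L <= T. *)
  assert (S0 : rsum q L <= 1).
  { apply Rle_trans with (rsum (fun _ => / T) L).
    - apply rsum_le. intros i Hi. apply lt_INR in Hi. unfold q.
      apply Rle_trans with (T / T ^ 2); [|right; field; unfold T; lra].
      unfold Rdiv. apply Rmult_le_compat.
      + assert (X := pos_INR i). lra.
      + left. apply Rinv_0_lt_compat, Hden.
      + unfold T. lra.
      + apply Rinv_le_contravar; [apply pow_lt; unfold T; lra|].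
        assert (X := pow2_ge_0 (Re s + INR i)). lra.
    - assert (X : forall m, rsum (fun _ => / T) m = INR m * / T).
      { induction m as [|m IH]; [simpl; ring|]. rewrite S_INR. simpl rsum. rewrite IH. ring. }
      rewrite X. apply (Rmult_le_reg_r T); [unfold T; lra|].
      rewrite Rmult_assoc, Rinv_l by (unfold T; lra). unfold T. lra. }
  assert (EL : INR L = 2 * INR a0 + 2 + INR l).
  { unfold L. rewrite !plus_INR, mult_INR. simpl. ring. }
  (* Beyond L, q n <= 1 / (n - 2 a0), and these bounds telescope against ln. The choice of L makes L
     - 2 a0 - 1 equal to l + 1 at the start. *)
  assert (S1 : forall d, rsum q (L + d) <= 1 + ln (INR (L + d) - 2 * INR a0 - 1) - ln (INR l + 1)).
  { induction d as [|d IH].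
    - rewrite Nat.add_0_r. replace (INR L - 2 * INR a0 - 1) with (INR l + 1) by lra. lra.
    - rewrite Nat.add_succ_r. simpl rsum. rewrite S_INR.
      assert (Hn : INR L <= INR (L + d)) by (apply le_INR; lia).
      set (n := (L + d)%nat) in *.
      assert (Q1 : q n <= / (INR n - 2 * INR a0)).
      { unfold q. apply Rle_div_l; [apply Hden|].
        apply (Rmult_le_reg_l (INR n - 2 * INR a0)); [lra|].
        rewrite <- Rmult_assoc, Rinv_r, Rmult_1_l by lra.
        assert (0 <= (2 * Re s + INR a0) * INR n) by (apply Rmult_le_pos; lra).
        assert (0 <= Re s ^ 2) by apply pow2_ge_0. nra. }
      assert (Q2 := one_minus_inv_le_ln (INR n - 2 * INR a0) ltac:(lra)).
      replace (INR n + 1 - 2 * INR a0 - 1) with (INR n - 2 * INR a0) by ring.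
      lra. }
  assert (Hln : K + 1 <= ln (INR l + 1)).
  { rewrite <- (ln_exp (K + 1)). left. apply ln_increasing; [apply exp_pos|lra]. }
  assert (Hn : forall n, (L <= n)%nat -> exp (K * h) * Cmod (euler s n) <= Cmod (euler (s + h)%C n)).
  { intros n HLn.
    assert (Sn := S1 (S n - L)%nat). replace (L + (S n - L))%nat with (S n) in Sn by lia.
    assert (HN : INR L + 1 <= INR (S n)) by (rewrite S_INR; apply Rplus_le_compat_r, le_INR, HLn).
    assert (PN := INR_S_pos n). set (N := S n) in *.
    assert (Ln : ln (INR N - 2 * INR a0 - 1) <= ln (INR N)).
    { apply ln_le; lra. }
    assert (Rs : Cmod (rising (s + h) N) <= exp (h * rsum q N) * Cmod (rising s N)).
    { apply rising_shift_le; [lra|exact Hy|]. intros i Hi. unfold q.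
      rewrite Cmod_sq. rewrite Re_Cplus, Im_Cplus. simpl (Re (RtoC _)). simpl (Im (RtoC _)).
      rewrite Rplus_0_r. unfold Rdiv. apply Rmult_le_compat_r; [left; apply Rinv_0_lt_compat, Hden|]. lra. }
    assert (Hy' : Im (s + h)%C <> 0) by (rewrite Im_Cplus; simpl; lra).
    assert (R1 := proj1 (Cmod_gt_0 _) (rising_neq0 s N Hy)).
    assert (R2 := proj1 (Cmod_gt_0 _) (rising_neq0 _ N Hy')).
    unfold euler. fold N.
    rewrite !Cmod_div, !Cmod_mult by (apply rising_neq0; assumption).
    rewrite !Cmod_Cpow_neg. set (F := Cmod (RtoC (INR (fact n)))).
    assert (PF : 0 < F) by (apply Cmod_gt_0, fact_C_neq0).
    replace (- ln (INR N) * Re (- (s + h))%C) with (ln (INR N) * Re s + ln (INR N) * h) by (simpl; unfold Re; ring).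
    replace (- ln (INR N) * Re (- s)%C) with (ln (INR N) * Re s) by (simpl; unfold Re; ring).
    rewrite exp_plus.
    assert (PE := exp_pos (ln (INR N) * Re s)). set (E := exp (ln (INR N) * Re s)) in *.
    apply (Rmult_le_reg_r (Cmod (rising s N) * Cmod (rising (s + h) N))); [apply Rmult_lt_0_compat; assumption|].
    replace (exp (K * h) * (E * F / Cmod (rising s N)) * (Cmod (rising s N) * Cmod (rising (s + h) N)))
      with (E * F * (exp (K * h) * Cmod (rising (s + h) N))) by (field; lra).
    replace (E * exp (ln (INR N) * h) * F / Cmod (rising (s + h) N) * (Cmod (rising s N) * Cmod (rising (s + h) N)))
      with (E * F * (exp (ln (INR N) * h) * Cmod (rising s N))) by (field; lra).
    apply Rmult_le_compat_l; [apply Rmult_le_pos; lra|].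
    apply Rle_trans with (exp (K * h) * (exp (h * rsum q N) * Cmod (rising s N)));
      [apply Rmult_le_compat_l; [left; apply exp_pos|exact Rs]|].
    rewrite <- Rmult_assoc, <- exp_plus. apply Rmult_le_compat_r; [lra|].
    apply exp_monotone. replace (K * h + h * rsum q N) with ((K + rsum q N) * h) by ring.
    apply Rmult_le_compat_r; lra. }
  assert (Hy' : Im (s + h)%C <> 0) by (rewrite Im_Cplus; simpl; lra).
  apply (is_lim_seq_le_loc (fun n => exp (K * h) * Cmod (euler s n)) (fun n => Cmod (euler (s + h)%C n))
     (exp (K * h) * Cmod (Gam s)) (Cmod (Gam (s + h)%C))).
  - exists L. exact Hn.
  - apply (is_lim_seq_scal_l _ (exp (K * h)) (Cmod (Gam s))). apply Clim_Cmod, Gam_lim, Hy.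
  - apply Clim_Cmod, Gam_lim, Hy'.
Qed.

(** * The Bessel-type series [U] *)

Fixpoint cfalling s n : C :=
  match n with O => RtoC 1 | S p => (cfalling s p * (s - INR (S p)))%C end.

Lemma cfalling_neq0 s n : Im s <> 0 -> cfalling s n <> RtoC 0.
Proof.
  intros Hs. induction n as [|n IH]; [apply RtoC_neq0; lra|].
  apply Cmult_neq_0; [exact IH|]. apply Im_neq0. unfold Cminus. rewrite Im_Cplus. simpl. lra.
Qed.

Lemma cfalling_S_l s n : cfalling s (S n) = ((s - 1) * cfalling (s - 1) n)%C.
Proof.
  induction n as [|n IH]; [simpl; ring|].
  change (cfalling s (S (S n))) with (cfalling s (S n) * (s - INR (S (S n))))%C.
  rewrite IH. change (cfalling (s - 1) (S n)) with (cfalling (s - 1) n * (s - 1 - INR (S n)))%C.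
  rewrite (S_INR (S n)), RtoC_plus. ring.
Qed.

Lemma Cmod_shift_ge_Im s (x : R) : Rabs (Im s) <= Cmod (s - x)%C.
Proof.
  replace (Im s) with (Im (s - x)%C) by (simpl; unfold Im; ring). apply Cmod_Im.
Qed.

Lemma cfalling_ge s n : Rabs (Im s) ^ n <= Cmod (cfalling s n).
Proof.
  induction n as [|n IH]; [simpl; rewrite Cmod_R, Rabs_R1; lra|].
  change (cfalling s (S n)) with (cfalling s n * (s - INR (S n)))%C.
  rewrite Cmod_mult. simpl pow. rewrite Rmult_comm.
  apply Rmult_le_compat; [apply pow_le, Rabs_pos|apply Rabs_pos|exact IH|apply Cmod_shift_ge_Im].
Qed.

(** [cfalling s i] is (s - 1) ... (s - i) = Gamma(s) / Gamma(s - i), so for k = 0 the series is the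
    hypergeometric function 0F1(; 1 - s; z). The factorial shifted by k describes what is left of it
    after k terms are split off. *)
Definition uterm k (z : R) s (i : nat) : C :=
  (RtoC ((- z) ^ i / INR (fact (k + i))) / cfalling s i)%C.

(* [U 0 z s = Gamma(s)^-1 * sum_i (-z)^i Gamma(s - i) / i!] *)
Definition U k (z : R) s : C := Climit (csum (uterm k z s)).

Lemma csum_abs_conv (f : nat -> C) (g : nat -> R) (B : R) :
  (forall i, Cmod (f i) <= g i) -> (forall n, rsum g n <= B) -> exists l, Clim (csum f) l.
Proof.
  intros Hfg HB.
  assert (Pg : forall i, 0 <= g i) by (intros i; eapply Rle_trans; [apply Cmod_ge_0|apply Hfg]).
  destruct (ex_finite_lim_seq_incr (rsum g) B) as [l Hl].
  { intros n. simpl. specialize (Pg n). lra. }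
  { exact HB. }
  apply is_lim_seq_spec in Hl.
  apply Clim_Cauchy. intros eps He. destruct (Hl (mkposreal (eps / 2) ltac:(lra))) as [N HN]. simpl in HN.
  exists N. intros n m Hn Hm.
  assert (A : Cmod (csum f m - csum f n)%C <= rsum g m - rsum g n).
  { induction Hm as [|m Hm IH].
    - replace (csum f n - csum f n)%C with (RtoC 0) by ring. rewrite Cmod_0. lra.
    - simpl. replace (csum f m + f m - csum f n)%C with ((csum f m - csum f n) + f m)%C by ring.
      eapply Rle_trans; [apply Cmod_triangle|]. specialize (Hfg m). lra. }
  assert (B1 := HN n Hn). assert (B2 := HN m ltac:(lia)).
  apply Rabs_def2 in B1, B2. lra.
Qed.

Lemma fact_add_ge (k i : nat) : INR (fact i) <= INR (fact (k + i)).
Proof. apply le_INR, fact_le. lia. Qed.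

Lemma uterm_bound k (z : R) s (i : nat) : 0 <= z -> Im s <> 0 ->
  Cmod (uterm k z s i) <= (z / Rabs (Im s)) ^ i / INR (fact i).
Proof.
  intros Hz Hs. unfold uterm. assert (Py := Rabs_pos_lt _ Hs).
  rewrite Cmod_div by (apply cfalling_neq0, Hs).
  rewrite Cmod_R. unfold Rdiv at 1 2. rewrite Rabs_mult, <- RPow_abs, Rabs_Ropp, (Rabs_pos_eq z) by exact Hz.
  assert (Pf := INR_fact_lt_0 i). assert (Pk := INR_fact_lt_0 (k + i)).
  rewrite (Rabs_pos_eq (/ _)) by (left; apply Rinv_0_lt_compat, Pk).
  unfold Rdiv. rewrite Rpow_mult_distr, pow_inv.
  assert (Pz : 0 <= z ^ i) by (apply pow_le, Hz).
  assert (Pp : 0 < Rabs (Im s) ^ i) by (apply pow_lt, Py).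
  rewrite Rmult_assoc, Rmult_assoc. apply Rmult_le_compat_l; [exact Pz|].
  rewrite (Rmult_comm (/ Rabs _ ^ i)).
  apply Rmult_le_compat; try (left; apply Rinv_0_lt_compat; assumption).
  - left. apply Rinv_0_lt_compat, Cmod_gt_0, cfalling_neq0, Hs.
  - apply Rinv_le_contravar; [exact Pf|apply fact_add_ge].
  - apply Rinv_le_contravar; [exact Pp|apply cfalling_ge].
Qed.

Lemma U_lim k (z : R) s : 0 <= z -> Im s <> 0 -> Clim (csum (uterm k z s)) (U k z s).
Proof.
  intros Hz Hs.
  destruct (csum_abs_conv (uterm k z s) (fun i => (z / Rabs (Im s)) ^ i / INR (fact i)) (exp (z / Rabs (Im s))))
    as [l Hl].
  - intros i. apply uterm_bound; assumption.
  - intros n. apply rsum_exp_le. apply Rle_mult_inv_pos; [exact Hz|apply Rabs_pos_lt, Hs].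
  - eapply Climit_correct, Hl.
Qed.

Lemma U_bound k (z : R) s : 0 <= z -> Im s <> 0 ->
  Cmod (U k z s) <= exp (z / Rabs (Im s)).
Proof.
  intros Hz Hs. eapply Clim_Cmod_le; [|apply U_lim; assumption].
  exists O. intros n _. eapply Rle_trans.
  - apply csum_Cmod_le. intros i _. apply uterm_bound; assumption.
  - apply rsum_exp_le. apply Rle_mult_inv_pos; [exact Hz|apply Rabs_pos_lt, Hs].
Qed.

Lemma Im_sub_1 s : Im (s - 1)%C = Im s.
Proof. simpl; unfold Im; ring. Qed.

Lemma Im_sub_R s (x : R) : Im (s - x)%C = Im s.
Proof. simpl; unfold Im; ring. Qed.

Lemma Im_add_R s (x : R) : Im (s + x)%C = Im s.
Proof. simpl; unfold Im; ring. Qed.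

(** Splits off the term i = 0. It serves twice: as the estimate U = 1/k! + O(1/|s|), and, iterated,
    to expose the terms that the vanishing moments cancel. *)
Lemma U_step k (z : R) s : 0 <= z -> Im s <> 0 ->
  U k z s = (RtoC (/ INR (fact k)) - z / (s - 1) * U (S k) z (s - 1))%C.
Proof.
  intros Hz Hs. assert (Hs1 : Im (s - 1)%C <> 0) by (rewrite Im_sub_1; exact Hs).
  eapply Clim_unique; [apply Clim_S, U_lim; assumption|].
  eapply Clim_ext; [|apply Clim_minus; [apply Clim_const|apply Clim_scal, U_lim; assumption]].
  intros n. cbv beta. rewrite csum_S_l.
  replace (uterm k z s 0) with (RtoC (/ INR (fact k))).
  2:{ unfold uterm. rewrite Nat.add_0_r. change (cfalling s 0) with (RtoC 1).
      replace ((- z) ^ 0 / INR (fact k)) with (/ INR (fact k)) by (simpl; field; apply INR_fact_neq_0).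
      field. }
  rewrite <- csum_scal. unfold Cminus at 1. f_equal.
  replace (- csum (fun i => RtoC z / (s - 1) * uterm (S k) z (s - 1) i) n)%C
    with (- (1) * csum (fun i => RtoC z / (s - 1) * uterm (S k) z (s - 1) i) n)%C by ring.
  rewrite <- csum_scal. apply csum_ext. intros i _.
  unfold uterm. rewrite cfalling_S_l. replace (k + S i)%nat with (S k + i)%nat by lia.
  assert (A := cfalling_neq0 (s - 1)%C i Hs1). assert (B := Im_neq0 _ Hs1).
  assert (Pf := INR_fact_neq_0 (S k + i)).
  replace ((- z) ^ S i / INR (fact (S k + i))) with (- z * ((- z) ^ i / INR (fact (S k + i)))) by (simpl pow; field; exact Pf).
  rewrite RtoC_mult, RtoC_opp. field. auto.
Qed.

(** Contiguity relation, checked term by term: 1 / cfalling (s + 1) (i + 1) - 1 / cfalling s (i + 1)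
    = - (i + 1) / (s (s - 1) cfalling (s - 1) i), and i + 1 cancels against the factorial. *)
Lemma U_rec (z : R) s : 0 <= z -> Im s <> 0 ->
  U 0 z (s + 1)%C = (U 0 z s + z / (s * (s - 1)) * U 0 z (s - 1))%C.
Proof.
  intros Hz Hs. assert (Hs1 : Im (s - 1)%C <> 0) by (rewrite Im_sub_1; exact Hs).
  assert (Hs2 : Im (s + 1)%C <> 0) by (rewrite Im_add_R; exact Hs).
  eapply Clim_unique; [apply Clim_S, U_lim; assumption|].
  eapply Clim_ext; [|apply Clim_plus; [apply Clim_S, U_lim|apply Clim_scal, U_lim]; assumption].
  intros n. cbv beta. rewrite !csum_S_l, <- csum_scal, <- Cplus_assoc, <- csum_plus.
  f_equal. apply csum_ext. intros i _. unfold uterm.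
  rewrite (cfalling_S_l (s + 1)). replace (s + 1 - 1)%C with s by ring.
  assert (E := cfalling_S_l s i).
  change (cfalling s (S i)) with (cfalling s i * (s - INR (S i)))%C in E.
  rewrite (cfalling_S_l s i).
  assert (A := cfalling_neq0 (s - 1)%C i Hs1). assert (B := Im_neq0 _ Hs1).
  assert (D := Im_neq0 _ Hs).
  assert (F : (s - INR (S i))%C <> RtoC 0).
  { apply Im_neq0. rewrite Im_sub_R. exact Hs. }
  replace (cfalling s i) with ((s - 1) * cfalling (s - 1) i / (s - INR (S i)))%C
    by (rewrite <- E; field; exact F).
  simpl Nat.add.
  assert (Pf := INR_fact_neq_0 i). assert (PN := INR_S_pos i).
  replace ((- z) ^ S i / INR (fact (S i))) with (- z / INR (S i) * ((- z) ^ i / INR (fact i))).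
  2:{ rewrite fact_simpl, mult_INR. simpl pow. field. split; lra. }
  set (c := (- z) ^ i / INR (fact i)).
  rewrite RtoC_mult, RtoC_div, RtoC_opp by lra. assert (RN : RtoC (INR (S i)) <> RtoC 0) by (apply RtoC_neq0; lra).
  generalize dependent (RtoC (INR (S i))). intros N. intros.
  field. repeat split; auto.
Qed.

Lemma cfalling_conj s n : cfalling (Cconj s) n = Cconj (cfalling s n).
Proof.
  induction n as [|n IH]; [apply C_ext; simpl; ring|].
  change (cfalling s (S n)) with (cfalling s n * (s - INR (S n)))%C.
  change (cfalling (Cconj s) (S n)) with (cfalling (Cconj s) n * (Cconj s - INR (S n)))%C.
  rewrite IH, Cmult_conj, Cminus_conj, Cconj_R. reflexivity.
Qed.

Lemma U_conj k (z : R) s : 0 <= z -> Im s <> 0 -> U k z (Cconj s) = Cconj (U k z s).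
Proof.
  intros Hz Hs. apply Climit_eq. eapply Clim_ext; [|apply Clim_conj, U_lim; assumption].
  intros n. cbv beta. rewrite csum_conj. apply csum_ext. intros i _. unfold uterm.
  rewrite Cdiv_conj, Cconj_R, cfalling_conj by (apply cfalling_neq0, Hs). reflexivity.
Qed.

Lemma INR_le_pow2 n : INR n <= 2 ^ n.
Proof.
  induction n as [|n IH]; [simpl; lra|]. rewrite S_INR. simpl pow.
  assert (A := pow_R1_Rle 2 n ltac:(lra)). lra.
Qed.

Lemma Cmod_inv_shift_le s (x : R) : 1 <= Rabs (Im s) -> Cmod (/ (s - x))%C <= 1.
Proof.
  intros Hs. assert (A := Cmod_shift_ge_Im s x).
  rewrite Cmod_inv by (apply Cmod_pos_neq; lra).
  rewrite <- Rinv_1. apply Rinv_le_contravar; lra.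
Qed.

Lemma cfalling_inv_le s n : 1 <= Rabs (Im s) -> Cmod (/ cfalling s n)%C <= 1.
Proof.
  intros Hs. assert (A := cfalling_ge s n). assert (B := pow_R1_Rle _ n Hs).
  rewrite Cmod_inv by (apply Cmod_pos_neq; lra).
  rewrite <- Rinv_1. apply Rinv_le_contravar; lra.
Qed.

(** For |Im s| >= 1 each factor 1 / (s - j) is bounded by 1 and 1-Lipschitz in the horizontal
    direction, so the product of n of them is n-Lipschitz. *)
Lemma cfalling_inv_Lipschitz s (h : R) n : 1 <= Rabs (Im s) -> 0 <= h ->
  Cmod (/ cfalling (s + h) n - / cfalling s n)%C <= INR n * h.
Proof.
  intros Hs Hh. assert (Hi : Im s <> 0) by (intros E; rewrite E, Rabs_R0 in Hs; lra).
  assert (Hi' : Im (s + h)%C <> 0) by (rewrite Im_add_R; exact Hi).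
  assert (Hs' : 1 <= Rabs (Im (s + h)%C)) by (rewrite Im_add_R; exact Hs).
  induction n as [|n IH].
  - simpl. replace (/ 1 - / 1)%C with (RtoC 0) by field. rewrite Cmod_0. lra.
  - change (cfalling s (S n)) with (cfalling s n * (s - INR (S n)))%C.
    change (cfalling (s + h) (S n)) with (cfalling (s + h) n * (s + h - INR (S n)))%C.
    set (N := INR (S n)).
    assert (A := cfalling_neq0 s n Hi). assert (B := cfalling_neq0 _ n Hi').
    assert (D : (s - N)%C <> RtoC 0) by (apply Cmod_pos_neq; assert (X := Cmod_shift_ge_Im s N); lra).
    assert (F : (s + h - N)%C <> RtoC 0)
      by (apply Cmod_pos_neq; assert (X := Cmod_shift_ge_Im (s + h)%C N); lra).
    replace (/ (cfalling (s + h) n * (s + h - N)) - / (cfalling s n * (s - N)))%C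
      with ((/ cfalling (s + h) n - / cfalling s n) * / (s + h - N)
        + / cfalling s n * (RtoC (- h) * (/ (s + h - N) * / (s - N))))%C
      by (rewrite RtoC_opp; field; auto).
    eapply Rle_trans; [apply Cmod_triangle|]. rewrite !Cmod_mult, Cmod_R, Rabs_Ropp, (Rabs_pos_eq h) by exact Hh.
    assert (X1 := Cmod_inv_shift_le s N Hs). assert (X2 := Cmod_inv_shift_le _ N Hs').
    assert (X3 := cfalling_inv_le s n Hs).
    assert (Y1 := Cmod_ge_0 (/ (s - N))%C). assert (Y2 := Cmod_ge_0 (/ (s + h - N))%C).
    assert (Y3 := Cmod_ge_0 (/ cfalling s n)%C).
    assert (Y4 := Cmod_ge_0 (/ cfalling (s + h) n - / cfalling s n)%C).
    assert (EN : N * h = INR n * h + h) by (unfold N; rewrite S_INR; ring).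
    set (p := Cmod (/ (s - N))%C) in *. set (q := Cmod (/ (s + h - N))%C) in *.
    assert (q * p <= 1 * 1) by (apply Rmult_le_compat; lra).
    assert (h * (q * p) <= h * 1) by (apply Rmult_le_compat_l; lra).
    assert (0 <= h * (q * p)) by (apply Rmult_le_pos; [lra|apply Rmult_le_pos; assumption]).
    assert (Cmod (/ cfalling s n)%C * (h * (q * p)) <= 1 * h) by (apply Rmult_le_compat; lra).
    assert (Cmod (/ cfalling (s + h) n - / cfalling s n)%C * q <= INR n * h * 1) by (apply Rmult_le_compat; lra).
    lra.
Qed.

Lemma U_Lipschitz k (z : R) s (h : R) : 0 <= z -> 1 <= Rabs (Im s) -> 0 <= h ->
  Cmod (U k z (s + h) - U k z s)%C <= exp (2 * z) * h.
Proof.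
  intros Hz Hs Hh. assert (Hi : Im s <> 0) by (intros E; rewrite E, Rabs_R0 in Hs; lra).
  assert (Hi' : Im (s + h)%C <> 0) by (rewrite Im_add_R; exact Hi).
  eapply Clim_Cmod_le; [|apply Clim_minus; apply U_lim; assumption].
  exists O. intros n _. rewrite <- csum_minus.
  (* The Lipschitz constant i of the i-th term is absorbed by i <= 2^i, which doubles z in the
     exponential series. *)
  apply Rle_trans with (rsum (fun i => (2 * z) ^ i / INR (fact i) * h) n).
  - apply csum_Cmod_le. intros i _. unfold uterm, Cdiv.
    set (c := (- z) ^ i / INR (fact (k + i))).
    cmod_ring (c * (/ cfalling (s + h) i - / cfalling s i))%C.
    rewrite Cmod_mult, Cmod_R.
    assert (L := cfalling_inv_Lipschitz s h i Hs Hh).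
    assert (Pf := INR_fact_lt_0 i). assert (Pk := INR_fact_lt_0 (k + i)).
    assert (Ec : Rabs c <= z ^ i / INR (fact i)).
    { unfold c, Rdiv. rewrite Rabs_mult, <- RPow_abs, Rabs_Ropp, (Rabs_pos_eq z) by exact Hz.
      apply Rmult_le_compat_l; [apply pow_le, Hz|].
      rewrite Rabs_pos_eq by (left; apply Rinv_0_lt_compat, Pk).
      apply Rinv_le_contravar; [exact Pf|apply fact_add_ge]. }
    apply Rle_trans with (z ^ i / INR (fact i) * (2 ^ i * h)).
    + apply Rmult_le_compat; [apply Rabs_pos|apply Cmod_ge_0|exact Ec|].
      eapply Rle_trans; [exact L|]. apply Rmult_le_compat_r; [exact Hh|apply INR_le_pow2].
    + right. rewrite Rpow_mult_distr. field. lra.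
  - rewrite rsum_scal_r. apply Rmult_le_compat_r; [exact Hh|]. apply rsum_exp_le. lra.
Qed.

(** By [U_step], U - 1 is z / (w - 1) times a factor bounded in terms of the fixed imaginary part,
    while |w n - 1| grows at least linearly. *)
Lemma U_lim_far (z : R) (w : nat -> C) (y c : R) : 0 <= z -> y <> 0 ->
  (forall n, Im (w n) = y) -> (forall n, INR n - c <= Cmod (w n - 1)%C) ->
  Clim (fun n => U 0 z (w n)) 1%C.
Proof.
  intros Hz Hy Hw Hc.
  set (A := z * exp (z / Rabs y)).
  assert (PA : 0 <= A) by (apply Rmult_le_pos; [exact Hz|left; apply exp_pos]).
  destruct (INR_unbounded (c + 1)) as [M HM].
  intros eps He. destruct (INR_unbounded (c + A / eps)) as [M2 HM2].
  exists (max M M2). intros n Hn.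
  assert (H1 : INR M <= INR n) by (apply le_INR; lia). assert (H2 : INR M2 <= INR n) by (apply le_INR; lia).
  specialize (Hc n). assert (Hi : Im (w n) <> 0) by (rewrite Hw; exact Hy).
  rewrite U_step by assumption. simpl fact. simpl INR. rewrite Rinv_1.
  replace (1 - z / (w n - 1) * U 1 z (w n - 1) - 1)%C
    with (- (z / (w n - 1) * U 1 z (w n - 1)))%C by ring.
  assert (N0 : (w n - 1)%C <> RtoC 0) by (apply Cmod_pos_neq; lra).
  rewrite Cmod_opp, Cmod_mult, Cmod_div, Cmod_R, Rabs_pos_eq by assumption.
  assert (Hi1 : Im (w n - 1)%C <> 0) by (rewrite Im_sub_1; exact Hi).
  assert (B := U_bound 1 z (w n - 1)%C Hz Hi1). rewrite Im_sub_1, Hw in B.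
  assert (Pd : 0 < Cmod (w n - 1)%C) by lra.
  apply Rle_lt_trans with (A / Cmod (w n - 1)%C).
  - replace (A / Cmod (w n - 1)%C) with (z / Cmod (w n - 1)%C * exp (z / Rabs y))
      by (unfold A, Rdiv; ring).
    apply Rmult_le_compat_l; [|exact B]. apply Rle_mult_inv_pos; assumption.
  - apply Rlt_div_l; [exact Pd|].
    assert (E : A / eps < Cmod (w n - 1)%C) by lra. apply Rlt_div_l in E; lra.
Qed.

(** * Solutions of the recurrence and their Casoratians *)

Definition Gf al be s : C := (dominant al s * U 0 (al * be) s)%C.

Lemma Cpow_neg_succ (x : R) s : 0 < x -> Cpow_neg x (s + 1)%C = (Cpow_neg x s / x)%C.
Proof.
  intros Hx. rewrite Cpow_neg_plus, Cpow_neg_1 by exact Hx. rewrite RtoC_inv; [reflexivity|lra].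
Qed.

Lemma Gf_rec al be s : 0 < al -> 0 < be -> Im s <> 0 ->
  (al * Gf al be (s + 1) = s * Gf al be s + be * Gf al be (s - 1))%C.
Proof.
  intros Ha Hb Hs. assert (Hs1 : Im (s - 1)%C <> 0) by (rewrite Im_sub_1; exact Hs).
  assert (E1 := Gam_rec s Hs). assert (E2 := Gam_rec (s - 1)%C Hs1).
  replace (s - 1 + 1)%C with s in E2 by ring.
  assert (Hz : 0 <= al * be) by (apply Rmult_le_pos; lra).
  unfold Gf, dominant. rewrite E1, Cpow_neg_succ, Cpow_neg_pred, U_rec, E2 by assumption.
  rewrite (RtoC_mult al be).
  assert (A := Im_neq0 _ Hs). assert (B := Im_neq0 _ Hs1). assert (D : RtoC al <> RtoC 0) by (apply RtoC_neq0; lra).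
  field. auto.
Qed.

Lemma Gf_flip_rec al be s : 0 < al -> 0 < be -> Im s <> 0 ->
  (al * Gf be al (- (s + 1)) = s * Gf be al (- s) + be * Gf be al (- (s - 1)))%C.
Proof.
  intros Ha Hb Hs.
  assert (Hs' : Im (- s)%C <> 0) by (simpl; unfold Im in Hs; lra).
  assert (E := Gf_rec be al (- s)%C Hb Ha Hs').
  replace (- s + 1)%C with (- (s - 1))%C in E by ring.
  replace (- s - 1)%C with (- (s + 1))%C in E by ring.
  rewrite E. ring.
Qed.

Lemma Cmod_add_nat_ge s n : INR n - Cmod s <= Cmod (s + INR n)%C.
Proof.
  assert (A := Cmod_sub_rev (RtoC (INR n)) (- s)%C). rewrite Cmod_opp, Cmod_R, Rabs_pos_eq in A by apply pos_INR.
  replace (INR n - - s)%C with (s + INR n)%C in A by ring. exact A.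
Qed.

Lemma Im_opp_neq s : Im s <> 0 -> Im (- s)%C <> 0.
Proof. intros Hs. simpl. unfold Im in Hs. lra. Qed.

Lemma Gf_over_dominant al be s : 0 < al -> 0 < be -> Im s <> 0 ->
  Clim (fun n => Gf al be (s + INR n) / dominant al (s + INR n))%C 1%C.
Proof.
  intros Ha Hb Hs. eapply Clim_ext;
    [|apply (U_lim_far (al * be) (fun n => s + INR n)%C (Im s) (Cmod (s - 1)%C))].
  - intros n. unfold Gf. field. apply dominant_neq0. rewrite Im_add_R. exact Hs.
  - apply Rmult_le_pos; lra.
  - exact Hs.
  - intros n. apply Im_add_R.
  - intros n. replace (s + INR n - 1)%C with (s - 1 + INR n)%C by ring. apply Cmod_add_nat_ge.
Qed.

Lemma Gf_flip_over_dominant al be s : 0 < al -> 0 < be -> Im s <> 0 ->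
  Clim (fun n => Gf be al (- (s + INR n)) / dominant be (- (s + INR n)))%C 1%C.
Proof.
  intros Ha Hb Hs. eapply Clim_ext;
    [|apply (U_lim_far (be * al) (fun n => - (s + INR n))%C (- Im s) (Cmod (s + 1)%C))].
  - intros n. unfold Gf. field. apply dominant_neq0, Im_opp_neq. rewrite Im_add_R. exact Hs.
  - apply Rmult_le_pos; lra.
  - lra.
  - intros n. simpl. unfold Im. ring.
  - intros n. replace (- (s + INR n) - 1)%C with (- (s + 1 + INR n))%C by ring.
    rewrite Cmod_opp. apply Cmod_add_nat_ge.
Qed.

(** Leading part of X(s+1) Y(s) - X(s) Y(s+1), where X behaves like [dominant al] and Y(s) =
    G_{be,al}(-s): in the second product the dominant factors are smaller by al be / (- s (s +
    1)). *)
Definition casorati al be s : C := (dominant al (s + 1) * dominant be (- s))%C.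

Lemma dominant_succ al s : 0 < al -> Im s <> 0 ->
  dominant al (s + 1)%C = (s / al * dominant al s)%C.
Proof.
  intros Ha Hs. unfold dominant. rewrite Gam_rec, Cpow_neg_succ by assumption.
  field. apply RtoC_neq0. lra.
Qed.

Lemma dominant_opp_succ (be : R) s : 0 < be -> Im s <> 0 ->
  dominant be (- (s + 1))%C = (be / (- (s + 1)) * dominant be (- s))%C.
Proof.
  intros Hb Hs.
  assert (Hs1 : Im (- (s + 1))%C <> 0) by (apply Im_opp_neq; rewrite Im_add_R; exact Hs).
  replace (- s)%C with (- (s + 1) + 1)%C by ring.
  rewrite (dominant_succ be (- (s + 1))%C) by assumption.
  assert (A := Im_neq0 _ Hs1).
  assert (B : RtoC be <> RtoC 0) by (apply RtoC_neq0; lra).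
  set (w := (- (s + 1))%C) in *. field. auto.
Qed.

Lemma casorati_neq0 al be s : Im s <> 0 -> casorati al be s <> RtoC 0.
Proof.
  intros Hs. apply Cmult_neq_0; apply dominant_neq0; [rewrite Im_add_R|apply Im_opp_neq]; exact Hs.
Qed.

Lemma casorati_succ al be s : 0 < al -> 0 < be -> Im s <> 0 ->
  casorati al be (s + 1)%C = (RtoC (- (be / al)) * casorati al be s)%C.
Proof.
  intros Ha Hb Hs. assert (Hs1 : Im (s + 1)%C <> 0) by (rewrite Im_add_R; exact Hs).
  unfold casorati. rewrite (dominant_succ al (s + 1)%C), dominant_opp_succ by assumption.
  assert (A := Im_neq0 _ Hs1). assert (B : RtoC al <> RtoC 0) by (apply RtoC_neq0; lra).
  rewrite RtoC_opp, RtoC_div by lra. field. split; auto.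
Qed.

(* Casoratian of a solution [X] with the solution that is minimal at +oo: only the leading
   behaviour of [X] at +oo matters. *)
Lemma casoratian_eq al be (X : C -> C) s : 0 < al -> 0 < be -> Im s <> 0 ->
  (forall w, Im w <> 0 -> (al * X (w + 1) = w * X w + be * X (w - 1))%C) ->
  Clim (fun n => X (s + INR n) / dominant al (s + INR n))%C 1%C ->
  (X (s + 1) * Gf be al (- s) - X s * Gf be al (- (s + 1)))%C = casorati al be s.
Proof.
  intros Ha Hb Hs HX Hlim.
  set (Y := fun w => Gf be al (- w)%C).
  assert (HY : forall w, Im w <> 0 -> (al * Y (w + 1) = w * Y w + be * Y (w - 1))%C).
  { intros w Hw. apply Gf_flip_rec; assumption. }
  assert (HlimY := Gf_flip_over_dominant al be s Ha Hb Hs).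
  set (W := fun w => (X (w + 1) * Y w - X w * Y (w + 1))%C).
  assert (Ra : RtoC al <> RtoC 0) by (apply RtoC_neq0; lra).
  assert (Rb : RtoC be <> RtoC 0) by (apply RtoC_neq0; lra).
  (* Abel's identity: the Casoratian of two solutions obeys a first-order recurrence, the same as
     [casorati]. *)
  assert (HW : forall w, Im w <> 0 -> W (w + 1)%C = (RtoC (- (be / al)) * W w)%C).
  { intros w Hw. assert (Hw1 : Im (w + 1)%C <> 0) by (rewrite Im_add_R; exact Hw).
    assert (E1 := HX _ Hw1). assert (E2 := HY _ Hw1).
    replace (w + 1 - 1)%C with w in E1, E2 by ring.
    unfold W. replace (X (w + 1 + 1)%C) with (/ RtoC al * (al * X (w + 1 + 1)%C))%C by (field; exact Ra).
    replace (Y (w + 1 + 1)%C) with (/ RtoC al * (al * Y (w + 1 + 1)%C))%C by (field; exact Ra).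
    rewrite E1, E2, RtoC_opp, RtoC_div by lra. field. exact Ra. }
  assert (Him : forall n, Im (s + INR n)%C <> 0) by (intros n; rewrite Im_add_R; exact Hs).
  assert (Hr : RtoC (- (be / al)) <> RtoC 0).
  { apply RtoC_neq0. assert (0 < be / al) by (apply Rdiv_lt_0_compat; lra). lra. }
  (* The quotient is therefore constant along s + n, and its limit at +oo is its value at s. *)
  assert (Hratio : forall n, (W (s + INR n) / casorati al be (s + INR n) = W s / casorati al be s)%C).
  { induction n as [|n IH].
    - simpl. replace (s + RtoC 0)%C with s by ring. reflexivity.
    - rewrite add_INR_S.
      rewrite HW, casorati_succ by auto. rewrite <- IH. field.
      split; [apply casorati_neq0, Him|exact Hr]. }
  set (x := fun n => (X (s + INR n) / dominant al (s + INR n))%C) in *.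
  set (y := fun n => (Y (s + INR n) / dominant be (- (s + INR n)))%C).
  assert (Ly : Clim y 1%C) by exact HlimY.
  assert (Lc : Clim (fun n => RtoC (al * be) * / ((s + INR n) * - (s + INR n + 1)))%C 0%C).
  { intros eps He. set (A := al * be). assert (PA : 0 < A) by (apply Rmult_lt_0_compat; lra).
    assert (Py := Rabs_pos_lt _ Hs). set (yy := Rabs (Im s)) in *.
    destruct (INR_unbounded (Cmod s + A / (yy * eps))) as [M HM].
    exists M. intros n Hn. apply le_INR in Hn.
    cmod_ring (A * / ((s + INR n) * - (s + INR n + 1)))%C.
    assert (B1 := Cmod_add_nat_ge s n).
    assert (B2 := Cmod_shift_ge_Im (s + INR n)%C (- 1)). rewrite Im_add_R in B2. fold yy in B2.
    replace (s + INR n - RtoC (- 1))%C with (s + INR n + 1)%C in B2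
      by (change (RtoC (- 1)) with (RtoC (Ropp 1)); rewrite RtoC_opp; ring).
    assert (PQ : 0 < A / (yy * eps)) by (apply Rdiv_lt_0_compat; [exact PA|apply Rmult_lt_0_compat; assumption]).
    assert (N1 : (s + INR n)%C <> RtoC 0) by apply Im_neq0, Him.
    assert (N2 : (- (s + INR n + 1))%C <> RtoC 0).
    { apply Cmod_pos_neq. rewrite Cmod_opp. lra. }
    rewrite Cmod_mult, Cmod_R, Rabs_pos_eq, Cmod_inv, Cmod_mult, Cmod_opp by (try apply Cmult_neq_0; auto; lra).
    set (p := Cmod (s + INR n)%C) in *. set (q := Cmod (s + INR n + 1)%C) in *.
    assert (Pp : A / (yy * eps) < p) by lra.
    apply (Rmult_lt_reg_r (p * q)); [apply Rmult_lt_0_compat; lra|].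
    rewrite Rmult_assoc, Rinv_l, Rmult_1_r by (apply Rgt_not_eq, Rmult_lt_0_compat; lra).
    apply Rlt_le_trans with (eps * (p * yy)).
    - apply (Rmult_lt_compat_r (yy * eps)) in Pp; [|apply Rmult_lt_0_compat; assumption].
      replace (A / (yy * eps) * (yy * eps)) with A in Pp by (field; lra). lra.
    - apply Rmult_le_compat_l; [lra|]. apply Rmult_le_compat_l; lra. }
  assert (LW : Clim (fun n => x (S n) * y n - x n * y (S n)
       * (RtoC (al * be) * / ((s + INR n) * - (s + INR n + 1))))%C (1 * 1 - 1 * 1 * 0)%C).
  { apply Clim_minus; [apply Clim_mult; [apply Clim_S|]; assumption|].
    apply Clim_mult; [apply Clim_mult; [|apply Clim_S]; assumption|exact Lc]. }
  replace (1 * 1 - 1 * 1 * 0)%C with (RtoC 1) in LW by ring.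
  assert (E : (W s / casorati al be s)%C = RtoC 1).
  { eapply Clim_unique; [|exact LW]. eapply Clim_ext; [|apply Clim_const]. intros n. cbv beta.
    rewrite <- (Hratio n). unfold x, y, W, casorati.
    rewrite add_INR_S.
    assert (Hw := Him n). set (w := (s + INR n)%C) in *.
    assert (Hw1 : Im (w + 1)%C <> 0) by (rewrite Im_add_R; exact Hw).
    rewrite (dominant_succ al w), (dominant_opp_succ be w) by assumption.
    assert (D1 := dominant_neq0 al w Hw). assert (D2 := dominant_neq0 be _ (Im_opp_neq w Hw)).
    assert (D3 := Im_neq0 w Hw). assert (D4 := Im_neq0 _ Hw1).
    assert (D5 : (- (w + 1))%C <> RtoC 0) by (apply Im_neq0, Im_opp_neq, Hw1).
    rewrite RtoC_mult.
    generalize dependent (- (w + 1))%C. intros v Hv. field. repeat split; auto. }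
  assert (Hq := casorati_neq0 al be s Hs).
  change (W s = casorati al be s).
  replace (W s) with (W s / casorati al be s * casorati al be s)%C by (field; exact Hq).
  rewrite E. ring.
Qed.

Lemma Copp_opp z : (- - z)%C = z.
Proof. ring. Qed.

(** [BI] and [Gf] have the same leading behaviour at +oo, hence the same Casoratian with
    G_{be,al}(-s), so their difference [D] has Casoratian 0 with it. The reflection s -> -s gives
    the same with G_{al,be}(s). Being proportional to two solutions whose Casoratian is not 0, [D]
    vanishes. *)
Lemma BI_decomposition al be s : 0 < al -> 0 < be -> Im s <> 0 ->
  BI al be s = (Gf al be s + Gf be al (- s))%C.
Proof.
  intros Ha Hb Hs.
  set (D := fun a b w => (BI a b w - Gf a b w - Gf b a (- w))%C).
  assert (HD : forall a b w, 0 < a -> 0 < b -> Im w <> 0 ->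
     (D a b (w + 1) * Gf b a (- w) = D a b w * Gf b a (- (w + 1)))%C).
  { intros a b w Ha' Hb' Hw.
    assert (E1 := casoratian_eq a b (BI a b) w Ha' Hb' Hw (fun v _ => BI_rec a b v Ha' Hb')
       (BI_over_dominant a b w Ha' (Rlt_le _ _ Hb') Hw)).
    assert (E2 := casoratian_eq a b (Gf a b) w Ha' Hb' Hw (fun v Hv => Gf_rec a b v Ha' Hb' Hv)
       (Gf_over_dominant a b w Ha' Hb' Hw)).
    rewrite <- E2 in E1. unfold D.
    transitivity ((BI a b (w + 1) * Gf b a (- w) - BI a b w * Gf b a (- (w + 1)))
      + (BI a b w * Gf b a (- (w + 1)) - (Gf a b (w + 1) + Gf b a (- (w + 1))) * Gf b a (- w)))%C;
      [ring|rewrite E1; ring]. }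
  assert (F1 := HD al be s Ha Hb Hs).
  assert (Hs' : Im (- (s + 1))%C <> 0) by (apply Im_opp_neq; rewrite Im_add_R; exact Hs).
  (* With the parameters exchanged and s reflected, this is the comparison at -oo. *)
  assert (F2 := HD be al (- (s + 1))%C Hb Ha Hs').
  assert (Dflip : forall w, D be al (- w)%C = D al be w).
  { intros w. unfold D. rewrite (BI_flip be al), (Copp_opp w) by assumption. ring. }
  replace (- (s + 1) + 1)%C with (- s)%C in F2 by ring.
  rewrite !Dflip, !Copp_opp in F2.
  assert (E2 := casoratian_eq al be (Gf al be) s Ha Hb Hs (fun v Hv => Gf_rec al be v Ha Hb Hv)
       (Gf_over_dominant al be s Ha Hb Hs)).
  assert (Hq := casorati_neq0 al be s Hs).
  assert (Z : (D al be s * casorati al be s)%C = RtoC 0).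
  { rewrite <- E2.
    replace (D al be s * (Gf al be (s + 1) * Gf be al (- s) - Gf al be s * Gf be al (- (s + 1))))%C
      with ((D al be s * Gf al be (s + 1)) * Gf be al (- s) - Gf al be s * (D al be s * Gf be al (- (s + 1))))%C by ring.
    rewrite F2, <- F1. ring. }
  assert (Z0 : D al be s = RtoC 0).
  { destruct (Ceq_dec (D al be s) (RtoC 0)) as [e|ne]; [exact e|]. now elim (Cmult_neq_0 _ _ ne Hq). }
  unfold D in Z0.
  replace (BI al be s) with ((BI al be s - Gf al be s - Gf be al (- s)) + (Gf al be s + Gf be al (- s)))%C by ring.
  rewrite Z0. ring.
Qed.

(** * Zeros of symmetric sums *)

Lemma entire_at_derive (f : C -> C) z0 : entire_at f z0 ->
  exists l M, 0 <= M /\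
    (forall h, Cmod h <= 1 -> Cmod (f (z0 + h) - f z0 - l * h)%C <= M * Cmod h ^ 2) /\
    @is_derive C_AbsRing C_NormedModule f z0 l.
Proof.
  intros H. destruct (entire_at_order2 f z0 H) as [l [M [PM B]]].
  exists l, M. split; [exact PM|split; [exact B|]].
  split; [apply is_linear_scal_l|].
  intros x Hx.
  apply (is_filter_lim_locally_unique (V := AbsRing_NormedModule C_AbsRing)) in Hx.
  subst x. intros eps.
  apply (locally_le_locally_norm (V := AbsRing_NormedModule C_AbsRing)).
  assert (Pe : 0 < Rmin 1 (eps / (M + 1))).
  { apply Rmin_glb_lt; [lra|]. apply Rdiv_lt_0_compat; [apply cond_pos|lra]. }
  exists (mkposreal _ Pe).
  cut (forall y : C, Cmod (y - z0)%C < Rmin 1 (eps / (M + 1)) ->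
    Cmod (f y - f z0 - (y - z0) * l)%C <= eps * Cmod (y - z0)%C).
  { intros K y Hy. exact (K y Hy). }
  intros y Hy.
  assert (A1 := Rmin_l 1 (eps / (M + 1))). assert (A2 := Rmin_r 1 (eps / (M + 1))).
  specialize (B (y - z0)%C ltac:(lra)). replace (z0 + (y - z0))%C with y in B by ring.
  rewrite (Cmult_comm (y - z0)). eapply Rle_trans; [exact B|].
  assert (Pd := Cmod_ge_0 (y - z0)). set (d := Cmod (y - z0)) in *.
  assert (Ld : d * (M + 1) <= eps) by (apply Rle_div_r; lra).
  simpl. nra.
Qed.

(** Each box of a finite cover of the rectangle contains at most one zero, its centre, so the list
    of centres contains all zeros. *)
Lemma entire_finite_zeros (f : C -> C) (X Y : R) :
  (forall z, entire_at f z) -> (exists z, f z <> RtoC 0) ->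
  exists L : list C, forall z, f z = RtoC 0 -> Rabs (Re z) <= X -> Rabs (Im z) <= Y -> In z L.
Proof.
  intros Hf Hnz.
  assert (HK : forall t : Compactness.Tn 2 R, exists r : posreal, forall h : C,
     0 < Cmod h < 2 * r -> f ((fst t, fst (snd t)) + h)%C <> RtoC 0).
  { intros t. destruct (entire_isolated_zeros f (fst t, fst (snd t)) (Hf _) Hnz) as [r [Pr Hr]].
    (* Half the radius: the cover bounds each coordinate separately, and |h| <= |Re h| + |Im h|. *)
    exists (mkposreal (r / 2) ltac:(lra)). intros h Hh. apply Hr. simpl in Hh. lra. }
  destruct (choice _ HK) as [delta Hd].
  assert (Hcov := compactness_list 2 (- X, (- Y, tt)) (X, (Y, tt)) delta).
  apply NNPP in Hcov. destruct Hcov as [l Hl].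
  exists (map (fun t : Compactness.Tn 2 R => (fst t, fst (snd t)) : C) l).
  intros z Hz HX HY. apply Rabs_le_between in HX, HY.
  destruct (Hl (Re z, (Im z, tt))) as [t [Ht [_ Hc]]].
  { simpl. repeat split; lra. }
  destruct t as [t1 [t2 t3]]. simpl in Hc. destruct Hc as [C1 [C2 _]].
  apply in_map_iff. exists (t1, (t2, t3)). split; [|exact Ht]. simpl.
  set (h := (z - (t1, t2))%C).
  destruct (Req_dec (Cmod h) 0) as [E|E].
  - apply Cmod_eq_0 in E. replace z with ((t1, t2) + h)%C by (unfold h; ring). rewrite E.
    apply C_ext; simpl; ring.
  - exfalso. apply (Hd (t1, (t2, t3)) h).
    + split; [destruct (Cmod_ge_0 h); [assumption|congruence]|]. eapply Rle_lt_trans; [apply Cmod_le_ReIm|].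
      replace (Re h) with (Re z - t1) by (unfold h; simpl; unfold Re; ring).
      replace (Im h) with (Im z - t2) by (unfold h; simpl; unfold Im; ring).
      replace (2 * delta (t1, (t2, t3))) with (delta (t1, (t2, t3)) + delta (t1, (t2, t3))) by ring.
      exact (Rplus_lt_compat _ _ _ _ C1 C2).
    + simpl. replace ((t1, t2) + h)%C with z by (unfold h; ring). exact Hz.
Qed.

(** The points s and - conj s lie at the same height on opposite sides of the axis, so a zero off
    the axis would equate two moduli that the growth makes different. On the axis, |F(z + h)| >=
    |G(z + h)| - |G(z - h)| >= h |G z| excludes a double zero. *)
Lemma symmetric_sum_zeros (F G : C -> C) (delta T : R) :
  0 < delta ->
  (forall z, entire_at F z) ->
  (forall s, Rabs (Re s) <= delta -> T <= Rabs (Im s) -> F s = (G s + Cconj (G (- Cconj s)%C))%C) ->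
  (forall s, Rabs (Re s) <= delta -> T <= Rabs (Im s) -> G s <> RtoC 0) ->
  (forall s h, Rabs (Re s) <= delta -> 0 <= h -> Re s + h <= delta -> T <= Rabs (Im s) ->
     exp h * Cmod (G s) <= Cmod (G (s + h)%C)) ->
  exists L : list C, forall z : C,
    F z = RtoC 0 -> Rabs (Re z) <= delta -> ~ In z L -> Re z = 0 /\ simple_zero F z.
Proof.
  intros Hdl HF Hsym HG Hgrow.
  assert (Hoff : forall s, Rabs (Re s) <= delta -> T <= Rabs (Im s) -> Re s <> 0 -> F s <> RtoC 0).
  { intros s Hs HT Hre E. rewrite Hsym in E by assumption.
    assert (Em : Cmod (G s) = Cmod (G (- Cconj s)%C)).
    { rewrite <- (Cmod_conj (G (- Cconj s)%C)), <- Cmod_opp. f_equal.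
      replace (- G s)%C with (Cconj (G (- Cconj s)) - (G s + Cconj (G (- Cconj s))))%C by ring.
      rewrite E. ring. }
    assert (Hs' := proj1 (Rabs_le_between _ _) Hs).
    assert (R' : Re (- Cconj s)%C = - Re s) by (simpl; unfold Re; ring).
    assert (I' : Im (- Cconj s)%C = Im s) by (simpl; unfold Im; ring).
    assert (Gp : 0 < Cmod (G s)) by (apply Cmod_gt_0, HG; assumption).
    destruct (Rtotal_order 0 (Re s)) as [L|[L|L]]; [|congruence|].
    - assert (B := Hgrow (- Cconj s)%C (2 * Re s)). rewrite R', I', Rabs_Ropp in B.
      specialize (B Hs ltac:(lra) ltac:(lra) HT).
      replace (- Cconj s + RtoC (2 * Re s))%C with s in B by (apply C_ext; simpl; unfold Re, Im; ring).
      rewrite <- Em in B. assert (X := exp_ineq1 (2 * Re s) ltac:(apply Rgt_not_eq; lra)). nra.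
    - assert (B := Hgrow s (- (2 * Re s)) Hs ltac:(lra) ltac:(lra) HT).
      replace (s + RtoC (- (2 * Re s)))%C with (- Cconj s)%C in B by (apply C_ext; simpl; unfold Re, Im; ring).
      rewrite <- Em in B. assert (X := exp_ineq1 (- (2 * Re s)) ltac:(apply Rgt_not_eq; lra)). nra. }
  (* The corner delta + i T lies off the axis and high enough for [Hoff]. *)
  assert (Hnz : exists z, F z <> RtoC 0).
  { exists (delta, T). apply Hoff; simpl; [rewrite Rabs_pos_eq; lra|apply Rle_abs|lra]. }
  destruct (entire_finite_zeros F delta T HF Hnz) as [L HL].
  exists L. intros z Hz Hre Hin.
  assert (HT : T <= Rabs (Im z)).
  { apply Rnot_lt_le. intros K. apply Hin, HL; [exact Hz|exact Hre|lra]. }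
  assert (Hre0 : Re z = 0).
  { destruct (Req_dec (Re z) 0) as [e|ne]; [exact e|]. now elim (Hoff z Hre HT ne). }
  split; [exact Hre0|split; [exact Hz|]].
  destruct (entire_at_derive F z (HF z)) as [l [M [PM [HM Hl]]]].
  exists l. split; [|exact Hl]. intros El.
  assert (Gp : 0 < Cmod (G z)) by (apply Cmod_gt_0, HG; assumption).
  set (g := Cmod (G z)) in *.
  (* Small enough that h g <= M h^2, which a zero derivative would imply, is false. *)
  set (h := Rmin (Rmin 1 delta) (g / (2 * (M + 1)))).
  assert (h1 : h <= 1) by rmin_le.
  assert (h2 : h <= delta) by rmin_le.
  assert (h3 : h <= g / (2 * (M + 1))) by apply Rmin_r.
  assert (h0 : 0 < h).
  { repeat apply Rmin_glb_lt; try lra. apply Rdiv_lt_0_compat; lra. }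
  assert (U1 : Cmod (F (z + h)%C) <= M * h ^ 2).
  { specialize (HM (RtoC h)). rewrite Cmod_R, Rabs_pos_eq in HM by lra. specialize (HM h1).
    rewrite Hz, El in HM.
    replace (F (z + h) - RtoC 0 - RtoC 0 * h)%C with (F (z + h)%C) in HM by ring. exact HM. }
  assert (Rh : Re (z + h)%C = h) by (rewrite Re_Cplus, Hre0; simpl; ring).
  rewrite Hsym in U1.
  2:{ rewrite Rh, Rabs_pos_eq; lra. }
  2:{ rewrite Im_add_R. exact HT. }
  replace (- Cconj (z + h))%C with (z - h)%C in U1
    by (apply C_ext; simpl; unfold Re, Im in *; lra).
  assert (B1 := Hgrow z h ltac:(rewrite Hre0, Rabs_R0; lra) ltac:(lra) ltac:(lra) HT). fold g in B1.
  assert (Rm : Re (z - h)%C = - h) by (unfold Cminus; rewrite Re_Cplus, Hre0; simpl; ring).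
  assert (Imm : Im (z - h)%C = Im z) by (simpl; unfold Im; ring).
  assert (B2 := Hgrow (z - h)%C h). rewrite Rm, Imm, Rabs_Ropp, (Rabs_pos_eq h) in B2 by lra.
  specialize (B2 h2 ltac:(lra) ltac:(lra) HT).
  replace (z - h + h)%C with z in B2 by ring. fold g in B2.
  assert (D := Cmod_sub_rev (G (z + h)%C) (- Cconj (G (z - h)%C))%C).
  rewrite Cmod_opp, Cmod_conj in D.
  replace (G (z + h) - - Cconj (G (z - h)))%C
    with (G (z + h) + Cconj (G (z - h)))%C in D by ring.
  assert (X := exp_ineq1 h ltac:(apply Rgt_not_eq; lra)).
  assert (Q := Cmod_ge_0 (G (z - h)%C)).
  assert (Lh : h * (2 * (M + 1)) <= g) by (apply Rle_div_r; lra).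
  assert (V1 : (1 + h) * g <= Cmod (G (z + h)%C)) by nra.
  assert (V2 : Cmod (G (z - h)%C) <= g) by nra.
  assert (V3 : h * g <= M * h ^ 2) by lra.
  assert (h * (h * (2 * (M + 1))) <= h * g) by (apply Rmult_le_compat_l; lra).
  simpl in V3. nra.
Qed.

(** * Moments of the coefficients and double sums *)

Lemma falling_gt (m j : nat) : (m < j)%nat -> falling m j = 0%nat.
Proof.
  induction j as [|j IH]; intros H; [lia|]. simpl.
  destruct (Nat.eq_dec m j) as [->|ne]; [rewrite Nat.sub_diag; reflexivity|].
  rewrite IH by lia. lia.
Qed.

(** The subtraction in [falling] is truncated, but for m < j the falling factorial is already 0. *)
Lemma falling_succ_R (m j : nat) :
  INR m * INR (falling m j) = INR (falling m (S j)) + INR j * INR (falling m j).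
Proof.
  rewrite <- !mult_INR, <- plus_INR. f_equal. simpl.
  destruct (Nat.le_gt_cases j m) as [L|L].
  - rewrite <- Nat.mul_add_distr_r. f_equal. lia.
  - rewrite (falling_gt m j L). lia.
Qed.

Definition freq (m : nat) : R := PI * (2 * INR m + 1).

Lemma freq_pos (m : nat) : 0 < freq m.
Proof.
  apply Rmult_lt_0_compat; [apply PI_RGT_0|]. assert (A := pos_INR m). lra.
Qed.

Lemma freq_inj (i j : nat) : freq i = freq j -> i = j.
Proof.
  intros E. unfold freq in E. apply Rmult_eq_reg_l in E; [|assert (P := PI_RGT_0); lra].
  apply INR_eq. lra.
Qed.

(** Interpolates between the derivatives of P at 1 (j = 0) and the power moments of the frequencies
    (i = 0), which are what the expansion of G produces. *)
Definition mixed_moment n (a : nat -> C) (j i : nat) : C :=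
  csum (fun l => a l * RtoC (freq l ^ j * INR (falling l i)))%C (S n).

Lemma mixed_moment_0 n (a : nat -> C) (i : nat) : mixed_moment n a 0 i = Pderiv_at1 n a i.
Proof.
  unfold mixed_moment, Pderiv_at1. rewrite sum_n_csum. apply csum_ext. intros l _.
  simpl pow. rewrite Rmult_1_l. ring.
Qed.

(** Writes freq l = 2 PI l + PI and applies l l^{(i)} = l^{(i+1)} + i l^{(i)}: one power of the
    frequency becomes one order of falling factorial. *)
Lemma mixed_moment_succ n (a : nat -> C) (j i : nat) :
  mixed_moment n a (S j) i =
  (RtoC (2 * PI) * mixed_moment n a j (S i) + RtoC (PI * (2 * INR i + 1)) * mixed_moment n a j i)%C.
Proof.
  unfold mixed_moment. rewrite <- !csum_scal, <- csum_plus. apply csum_ext. intros l _.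
  replace (freq l ^ S j * INR (falling l i))
    with (2 * PI * (freq l ^ j * INR (falling l (S i))) + PI * (2 * INR i + 1) * (freq l ^ j * INR (falling l i))).
  - rewrite RtoC_plus, !(RtoC_mult (_ * _) (_ * _)). ring.
  - assert (E := falling_succ_R l i).
    assert (E2 : INR (falling l (S i)) = INR l * INR (falling l i) - INR i * INR (falling l i)) by lra.
    rewrite E2. unfold freq. simpl pow. ring.
Qed.

Lemma mixed_moment_vanish n (a : nat -> C) k :
  (forall j, (j < k)%nat -> Pderiv_at1 n a j = RtoC 0) ->
  forall j i, (j + i < k)%nat -> mixed_moment n a j i = RtoC 0.
Proof.
  intros H j. induction j as [|j IH]; intros i Hi.
  - rewrite mixed_moment_0. apply H. lia.
  - rewrite mixed_moment_succ, !IH by lia. ring.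
Qed.

(** On the diagonal j + i = k the lower-order term vanishes, so each step only multiplies by 2
    PI. *)
Lemma mixed_moment_top n (a : nat -> C) k :
  (forall j, (j < k)%nat -> Pderiv_at1 n a j = RtoC 0) -> Pderiv_at1 n a k <> RtoC 0 ->
  forall j i, (j + i = k)%nat -> mixed_moment n a j i <> RtoC 0.
Proof.
  intros H Hk j. induction j as [|j IH]; intros i Hi.
  - rewrite mixed_moment_0. simpl in Hi. rewrite Hi. exact Hk.
  - rewrite mixed_moment_succ. rewrite (mixed_moment_vanish n a k H j i) by lia.
    rewrite Cmult_0_r, Cplus_0_r. apply Cmult_neq_0; [|apply IH; lia].
    apply RtoC_neq0. assert (P := PI_RGT_0). lra.
Qed.

Definition dsum (N : nat) (f : nat -> nat -> C) : C := csum (fun m => csum (f m) N) N.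

Lemma dsum_ext (N : nat) (f g : nat -> nat -> C) : (forall m l, f m l = g m l) -> dsum N f = dsum N g.
Proof. intros E. apply csum_ext. intros m _. apply csum_ext. intros l _. apply E. Qed.

Lemma dsum_plus (N : nat) (f g : nat -> nat -> C) :
  dsum N (fun m l => f m l + g m l)%C = (dsum N f + dsum N g)%C.
Proof.
  unfold dsum. rewrite <- csum_plus. apply csum_ext. intros m _. apply csum_plus.
Qed.

Lemma dsum_scal (N : nat) (c : C) (f : nat -> nat -> C) :
  dsum N (fun m l => c * f m l)%C = (c * dsum N f)%C.
Proof.
  unfold dsum. rewrite <- csum_scal. apply csum_ext. intros m _. apply csum_scal.
Qed.

Lemma dsum_minus (N : nat) (f g : nat -> nat -> C) :
  dsum N (fun m l => f m l - g m l)%C = (dsum N f - dsum N g)%C.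
Proof.
  unfold dsum. rewrite <- csum_minus. apply csum_ext. intros m _. apply csum_minus.
Qed.

Lemma dsum_product (N : nat) (f g : nat -> C) :
  dsum N (fun m l => f m * g l)%C = (csum f N * csum g N)%C.
Proof. symmetry. apply csum_mult. Qed.

Lemma dsum_Cmod_le (N : nat) (f : nat -> nat -> C) (g : nat -> nat -> R) :
  (forall m l, Cmod (f m l) <= g m l) ->
  Cmod (dsum N f) <= rsum (fun m => rsum (g m) N) N.
Proof. intros H. apply csum_Cmod_le. intros m _. apply csum_Cmod_le. intros l _. apply H. Qed.

Lemma rsum_ext (f g : nat -> R) n : (forall i, f i = g i) -> rsum f n = rsum g n.
Proof. intros E. induction n as [|n IH]; simpl; [reflexivity|]. rewrite IH, E. reflexivity. Qed.

Lemma rsum2_scal (N : nat) (g : nat -> nat -> R) (c : R) :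
  rsum (fun m => rsum (fun l => g m l * c) N) N = rsum (fun m => rsum (g m) N) N * c.
Proof. rewrite <- rsum_scal_r. apply rsum_ext. intros m. apply rsum_scal_r. Qed.

(** * Zeros of Xi_F *)

Definition coef (a : nat -> C) (m l : nat) : C := (a m * Cconj (a l))%C.

(** Since 2 PI cosh t = PI e^t + PI e^(-t), the factor in front shifts each 2 PI m to PI (2 m +
    1). *)
Lemma phiF_Kexp n (a : nat -> C) s (t : R) :
  (phiF n a t * Cexp (s * t))%C =
  dsum (S n) (fun m l => coef a m l * Kexp (freq m) (freq l) s t)%C.
Proof.
  unfold phiF. rewrite !sum_n_csum.
  rewrite (dsum_ext _ _ (fun m l => (RtoC (exp (- 2 * PI * cosh t)) * Cexp (s * t)) *
     ((a m * RtoC (exp (- 2 * PI * INR m * exp t))) * (Cconj (a l) * RtoC (exp (- 2 * PI * INR l * exp (- t))))))%C).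
  - rewrite dsum_scal, dsum_product. ring.
  - intros m l. unfold coef, Kexp. rewrite Cexp_plus, Cexp_R.
    replace (- freq m * exp t - freq l * exp (- t))
      with (- 2 * PI * cosh t + (- 2 * PI * INR m * exp t + - 2 * PI * INR l * exp (- t))).
    + rewrite !exp_plus, !RtoC_mult. ring.
    + unfold cosh, freq. field.
Qed.

Lemma CF_BI n (a : nat -> C) (CF : C -> C) :
  (forall s : C,
     is_RInt_gen (V := C_R_CompleteNormedModule)
       (fun t : R => Cmult (phiF n a t) (Cexp (Cmult s (RtoC t))))
       (Rbar_locally m_infty) (Rbar_locally p_infty) (CF s)) ->
  forall s, CF s = dsum (S n) (fun m l => coef a m l * BI (freq m) (freq l) s)%C.
Proof.
  intros H s. eapply is_int_unique; [apply is_int_of_gen, H|].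
  eapply is_int_ext; [intros t; symmetry; apply phiF_Kexp|].
  apply (is_int_csum (fun m t => csum (fun l => coef a m l * Kexp (freq m) (freq l) s t)%C (S n))).
  intros m _. apply (is_int_csum (fun l t => coef a m l * Kexp (freq m) (freq l) s t)%C).
  intros l _. apply is_int_scal, BI_correct, integrable_params_pos; apply freq_pos.
Qed.

Definition GG n (a : nat -> C) s : C :=
  dsum (S n) (fun m l => coef a m l * Gf (freq m) (freq l) s)%C.

Lemma Gf_conj al be s : 0 <= al * be -> Im s <> 0 -> Gf al be (Cconj s) = Cconj (Gf al be s).
Proof.
  intros Hz Hs. unfold Gf, dominant. rewrite Gam_conj, Cpow_neg_conj, U_conj, !Cmult_conj by assumption. reflexivity.
Qed.

(** [coef] is Hermitian, so conjugation amounts to exchanging the two summation indices. *)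
Lemma GG_conj n (a : nat -> C) s : Im s <> 0 ->
  Cconj (GG n a (- Cconj s)%C) = dsum (S n) (fun m l => coef a m l * Gf (freq l) (freq m) (- s))%C.
Proof.
  intros Hs. unfold GG, dsum. rewrite csum_conj, csum_swap.
  assert (E : forall m, Cconj (csum (fun l => coef a m l * Gf (freq m) (freq l) (- Cconj s))%C (S n))
     = csum (fun l => coef a l m * Gf (freq m) (freq l) (- s))%C (S n)).
  { intros m. rewrite csum_conj. apply csum_ext. intros l _. unfold coef.
    rewrite !Cmult_conj, Cconj_conj.
    replace (- Cconj s)%C with (Cconj (- s)%C) by (apply C_ext; simpl; unfold Re, Im; ring).
    rewrite Gf_conj, Cconj_conj.
    - ring.
    - left. apply Rmult_lt_0_compat; apply freq_pos.
    - apply Im_opp_neq, Hs. }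
  apply csum_ext. intros m _. apply E.
Qed.

Lemma CF_symmetric_sum n (a : nat -> C) (CF : C -> C) :
  (forall s, CF s = dsum (S n) (fun m l => coef a m l * BI (freq m) (freq l) s)%C) ->
  forall s, Im s <> 0 -> CF s = (GG n a s + Cconj (GG n a (- Cconj s)))%C.
Proof.
  intros H s Hs. rewrite H, GG_conj by exact Hs. unfold GG. rewrite <- dsum_plus.
  apply dsum_ext. intros m l.
  rewrite BI_decomposition by (try apply freq_pos; exact Hs). ring.
Qed.

(** The cofactor of Gamma(s - k) in [GG] once k terms of each series have been split off and have
    cancelled. *)
Definition hpart n (a : nat -> C) k s : C :=
  dsum (S n) (fun m l => coef a m l * (Cpow_neg (freq m) s *
    (RtoC ((- (freq m * freq l)) ^ k) * U k (freq m * freq l) (s - INR k))))%C.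

(** [hpart] with [U k] replaced by its limit 1 / k! for |Im s| -> oo. *)
Definition hlead n (a : nat -> C) k s : C :=
  dsum (S n) (fun m l => coef a m l * (Cpow_neg (freq m) s *
    (RtoC ((- (freq m * freq l)) ^ k) * RtoC (/ INR (fact k)))))%C.

Lemma freq_prod_pos (m l : nat) : 0 <= freq m * freq l.
Proof. left. apply Rmult_lt_0_compat; apply freq_pos. Qed.

(** (freq m freq l)^k factors, so the double sum splits: the m-sum is psi_F(s - k), by
    [psiF_expsum], and the l-sum is a conjugate moment of order k. *)
Lemma hlead_eq n (a : nat -> C) k s :
  hlead n a k s = (RtoC ((- (1)) ^ k / INR (fact k))
     * (expsum freq (fun m => a m * RtoC (freq m ^ k))%C (S n) s * Cconj (mixed_moment n a k 0)))%C.
Proof.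
  unfold mixed_moment. rewrite csum_conj. unfold expsum, hlead.
  rewrite <- dsum_product, <- dsum_scal. apply dsum_ext. intros m l. unfold coef.
  rewrite Cmult_conj, Cconj_R. simpl (INR (falling l 0)).
  replace ((- (freq m * freq l)) ^ k) with ((- (1)) ^ k * (freq m ^ k * freq l ^ k)).
  - unfold Rdiv. rewrite Rmult_1_r, !RtoC_mult. ring.
  - rewrite <- !Rpow_mult_distr. f_equal. ring.
Qed.

(** The terms split off by [U_step] add up to [hlead n a j s], which contains the moment of order j
    as a factor. *)
Lemma hpart_step n (a : nat -> C) (j : nat) s : Im s <> 0 ->
  mixed_moment n a j 0 = RtoC 0 ->
  hpart n a j s = (/ (s - INR (S j)) * hpart n a (S j) s)%C.
Proof.
  intros Hs Hm.
  assert (HZ : hlead n a j s = RtoC 0).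
  { rewrite hlead_eq, Hm. replace (Cconj (RtoC 0)) with (RtoC 0) by (symmetry; apply Cconj_R). ring. }
  rewrite <- (Cplus_0_l (_ * _)%C), <- HZ. unfold hpart, hlead. rewrite <- dsum_scal, <- dsum_plus.
  apply dsum_ext. intros m l.
  assert (Hi : forall x : R, Im (s - x)%C <> 0).
  { intros x. rewrite Im_sub_R. exact Hs. }
  rewrite (U_step j) by (try apply freq_prod_pos; apply Hi).
  replace (s - INR j - 1)%C with (s - INR (S j))%C by (rewrite S_INR, RtoC_plus; ring).
  assert (A := Im_neq0 _ (Hi (INR (S j)))). set (w := (s - INR (S j))%C) in *.
  set (z := freq m * freq l). simpl pow. rewrite RtoC_mult, RtoC_opp. field. exact A.
Qed.

(** Each step brings a factor 1 / (s - (j + 1)), which turns Gamma(s - j) into Gamma(s - j - 1). *)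
Lemma GG_hpart n (a : nat -> C) k s : Im s <> 0 ->
  (forall j, (j < k)%nat -> mixed_moment n a j 0 = RtoC 0) ->
  GG n a s = (Gam (s - INR k) * hpart n a k s)%C.
Proof.
  intros Hs Hm.
  assert (Hi : forall x : R, Im (s - x)%C <> 0).
  { intros x. rewrite Im_sub_R. exact Hs. }
  induction k as [|k IH].
  - simpl INR. replace (s - RtoC 0)%C with s by ring. unfold GG, hpart. rewrite <- dsum_scal.
    apply dsum_ext. intros m l. simpl INR. replace (s - RtoC 0)%C with s by ring.
    unfold Gf, dominant. simpl pow. ring.
  - rewrite IH by (intros j Hj; apply Hm; lia). rewrite hpart_step by (auto; apply Hm; lia).
    assert (E := Gam_rec _ (Hi (INR (S k)))).
    replace (s - INR (S k) + 1)%C with (s - INR k)%C in E by (rewrite S_INR, RtoC_plus; ring).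
    rewrite E. assert (A := Im_neq0 _ (Hi (INR (S k)))). field. exact A.
Qed.

(** The factor 3 comes from |Re (s + h)| <= delta + 2 delta. *)
Lemma Cpow_neg_strip (x delta : R) s (h : R) :
  Rabs (Re s) <= delta -> 0 <= h <= 2 * delta ->
  Cmod (Cpow_neg x s) <= exp (Rabs (ln x) * (3 * delta)) /\
  Cmod (Cpow_neg x (s + h))%C <= exp (Rabs (ln x) * (3 * delta)) /\
  Cmod (Cpow_neg x (s + h) - Cpow_neg x s)%C <= Rabs (ln x) * exp (Rabs (ln x) * (3 * delta)) * h.
Proof.
  intros Hs Hh. set (L := Rabs (ln x)). assert (PL : 0 <= L) by apply Rabs_pos.
  assert (B : forall w : C, Rabs (Re w) <= 3 * delta -> Cmod (Cpow_neg x w) <= exp (L * (3 * delta))).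
  { intros w Hw. rewrite Cmod_Cpow_neg. apply exp_monotone.
    eapply Rle_trans; [apply Rle_abs|]. rewrite Rabs_mult, Rabs_Ropp.
    apply Rmult_le_compat_l; assumption. }
  assert (P0 := Rabs_pos (Re s)).
  split; [apply B; lra|]. split.
  - apply B. rewrite Re_Cplus. simpl (Re (RtoC h)).
    eapply Rle_trans; [apply Rabs_triang|]. rewrite (Rabs_pos_eq h); lra.
  - rewrite Cpow_neg_plus.
    cmod_ring (Cpow_neg x s * (Cpow_neg x (RtoC h) - 1))%C.
    rewrite Cmod_mult. unfold Cpow_neg at 2.
    assert (T := Cexp_minus_1_bound (RtoC (- ln x) * h)%C).
    rewrite Cmod_mult, !Cmod_R, Rabs_Ropp, (Rabs_pos_eq h) in T by lra. fold L in T.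
    assert (B1 : Cmod (Cpow_neg x s) <= exp (L * delta)).
    { rewrite Cmod_Cpow_neg. apply exp_monotone.
      eapply Rle_trans; [apply Rle_abs|]. rewrite Rabs_mult, Rabs_Ropp.
      apply Rmult_le_compat_l; assumption. }
    assert (B2 : exp (L * h) <= exp (L * (2 * delta))) by (apply exp_monotone, Rmult_le_compat_l; lra).
    apply Rle_trans with (exp (L * delta) * (L * h * exp (L * (2 * delta)))).
    + apply Rmult_le_compat; [apply Cmod_ge_0|apply Cmod_ge_0|exact B1|].
      eapply Rle_trans; [exact T|]. apply Rmult_le_compat_l; [apply Rmult_le_pos; lra|exact B2].
    + replace (L * (3 * delta)) with (L * delta + L * (2 * delta)) by ring. rewrite exp_plus. right. ring.
Qed.

(** The first bound transfers the lower bound of psi_F to [hpart]. In the second, C2 is independent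
    of the height, whereas the growth rate of Gamma is not bounded. *)
Lemma hpart_bounds n (a : nat -> C) k (delta : R) :
  exists C1 C2, 0 <= C1 /\ 0 <= C2 /\ forall (s : C) (h : R),
    Rabs (Re s) <= delta -> 1 <= Rabs (Im s) -> 0 <= h <= 2 * delta ->
    Cmod (hpart n a k s - hlead n a k s)%C <= C1 * / Rabs (Im s) /\
    Cmod (hpart n a k (s + h) - hpart n a k s)%C <= C2 * h.
Proof.
  set (z := fun m l => freq m * freq l). set (E := fun m => exp (Rabs (ln (freq m)) * (3 * delta))).
  set (w := fun m l => Cmod (coef a m l) * (E m * z m l ^ k)).
  set (g1 := fun m l => w m l * (z m l * exp (z m l))).
  set (g2 := fun m l => w m l * (exp (2 * z m l) + Rabs (ln (freq m)) * exp (z m l))).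
  assert (Pz : forall m l, 0 <= z m l) by (intros; apply freq_prod_pos).
  assert (PE : forall m, 0 < E m) by (intros; apply exp_pos).
  assert (Pw : forall m l, 0 <= w m l).
  { intros m l. apply Rmult_le_pos; [apply Cmod_ge_0|]. apply Rmult_le_pos; [left; apply PE|apply pow_le, Pz]. }
  exists (rsum (fun m => rsum (g1 m) (S n)) (S n)), (rsum (fun m => rsum (g2 m) (S n)) (S n)).
  split; [|split].
  { apply rsum_nonneg. intros m. apply rsum_nonneg. intros l. apply Rmult_le_pos; [apply Pw|].
    apply Rmult_le_pos; [apply Pz|left; apply exp_pos]. }
  { apply rsum_nonneg. intros m. apply rsum_nonneg. intros l. apply Rmult_le_pos; [apply Pw|].
    apply Rplus_le_le_0_compat; [left; apply exp_pos|].
    apply Rmult_le_pos; [apply Rabs_pos|left; apply exp_pos]. }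
  intros s h Hs Hy Hh.
  assert (Hi : Im s <> 0) by (intros e; rewrite e, Rabs_R0 in Hy; lra).
  assert (Yexp : forall m l, exp (z m l / Rabs (Im s)) <= exp (z m l)).
  { intros m l. apply exp_monotone. apply Rle_div_l; [lra|].
    specialize (Pz m l). nra. }
  assert (Czk : forall m l, Cmod (RtoC ((- (z m l)) ^ k)) = z m l ^ k).
  { intros m l. rewrite Cmod_R, <- RPow_abs, Rabs_Ropp, Rabs_pos_eq by apply Pz. reflexivity. }
  split.
  - unfold hpart, hlead. rewrite <- dsum_minus, <- rsum2_scal. apply dsum_Cmod_le. intros m l. fold (z m l).
    set (v := (s - INR k)%C). assert (Iv : Im v = Im s) by apply Im_sub_R.
    rewrite (U_step k (z m l) v) by (try apply Pz; rewrite Iv; exact Hi).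
    assert (Iv1 : Im (v - 1)%C = Im s) by (rewrite Im_sub_1; exact Iv).
    assert (Uv := U_bound (S k) (z m l) (v - 1)%C (Pz m l) ltac:(rewrite Iv1; exact Hi)). rewrite Iv1 in Uv.
    set (u := U (S k) (z m l) (v - 1)) in *.
    unfold Cdiv. cmod_ring (- (coef a m l * (Cpow_neg (freq m) s * RtoC ((- z m l) ^ k)) * (RtoC (z m l) * (/ (v - 1)) * u)))%C.
    rewrite Cmod_opp, !Cmod_mult, Czk, (Cmod_R (z m l)), (Rabs_pos_eq (z m l)) by apply Pz.
    assert (N1 : (v - 1)%C <> RtoC 0) by (apply Im_neq0; rewrite Iv1; exact Hi).
    rewrite Cmod_inv by exact N1.
    assert (L1 : / Cmod (v - 1)%C <= / Rabs (Im s)).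
    { apply Rinv_le_contravar; [lra|]. rewrite <- Iv1. apply Cmod_Im. }
    assert (PC := proj1 (Cmod_gt_0 _) N1).
    destruct (Cpow_neg_strip (freq m) delta s h Hs Hh) as [S1 _]. fold (E m) in S1.
    assert (PQ : 0 <= Cmod (Cpow_neg (freq m) s) * z m l ^ k * z m l).
    { apply Rmult_le_pos; [apply Rmult_le_pos; [apply Cmod_ge_0|apply pow_le, Pz]|apply Pz]. }
    unfold g1, w. rewrite !Rmult_assoc. apply Rmult_le_compat_l; [apply Cmod_ge_0|].
    rewrite <- !Rmult_assoc.
    replace (E m * z m l ^ k * z m l * exp (z m l) * / Rabs (Im s))
      with (E m * z m l ^ k * z m l * / Rabs (Im s) * exp (z m l)) by ring.
    apply Rmult_le_compat; [| apply Cmod_ge_0 | |].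
    + apply Rmult_le_pos; [exact PQ|left; apply Rinv_0_lt_compat, PC].
    + apply Rmult_le_compat; [exact PQ|left; apply Rinv_0_lt_compat, PC| |exact L1].
      apply Rmult_le_compat_r; [apply Pz|]. apply Rmult_le_compat_r; [apply pow_le, Pz|exact S1].
    + eapply Rle_trans; [exact Uv|apply Yexp].
  - unfold hpart. rewrite <- dsum_minus, <- rsum2_scal. apply dsum_Cmod_le. intros m l. fold (z m l).
    set (v := (s - INR k)%C). assert (Iv : Im v = Im s) by apply Im_sub_R.
    replace (s + h - INR k)%C with (v + h)%C by (unfold v; ring).
    assert (UL := U_Lipschitz k (z m l) v h (Pz m l) ltac:(rewrite Iv; exact Hy) ltac:(lra)).
    assert (UB := U_bound k (z m l) v (Pz m l) ltac:(rewrite Iv; exact Hi)). rewrite Iv in UB.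
    specialize (Yexp m l).
    destruct (Cpow_neg_strip (freq m) delta s h Hs Hh) as [S1 [S2 S3]]. fold (E m) in S1, S2, S3.
    set (u := U k (z m l) v) in *. set (u' := U k (z m l) (v + h)) in *.
    set (p := Cpow_neg (freq m) s) in *. set (p' := Cpow_neg (freq m) (s + h)) in *.
    cmod_ring (coef a m l * (RtoC ((- z m l) ^ k) * (p' * (u' - u) + (p' - p) * u)))%C.
    rewrite !Cmod_mult, Czk. unfold g2, w. rewrite !Rmult_assoc.
    apply Rmult_le_compat_l; [apply Cmod_ge_0|].
    replace (E m * (z m l ^ k * ((exp (2 * z m l) + Rabs (ln (freq m)) * exp (z m l)) * h)))
      with (z m l ^ k * (E m * (exp (2 * z m l) * h) + Rabs (ln (freq m)) * E m * h * exp (z m l))) by ring.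
    apply Rmult_le_compat_l; [apply pow_le, Pz|].
    eapply Rle_trans; [apply Cmod_triangle|]. rewrite !Cmod_mult. apply Rplus_le_compat.
    + apply Rmult_le_compat; [apply Cmod_ge_0|apply Cmod_ge_0|exact S2|exact UL].
    + apply Rmult_le_compat; [apply Cmod_ge_0|apply Cmod_ge_0|exact S3|lra].
Qed.

(** The powers of PI and 2 m + 1 merge into powers of [freq m], and the shift by k moves into the
    coefficients. *)
Lemma psiF_expsum n (a : nat -> C) k s :
  psiF n a (s - INR k)%C = expsum freq (fun m => a m * RtoC (freq m ^ k))%C (S n) s.
Proof.
  unfold psiF, expsum. rewrite sum_n_csum, <- csum_scal. apply csum_ext. intros m _.
  assert (PP := PI_RGT_0). assert (Pm := pos_INR m).
  replace (Cpow_neg PI (s - INR k) * (a m * Cpow_neg (2 * INR m + 1) (s - INR k)))%C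
    with (a m * (Cpow_neg PI (s - INR k) * Cpow_neg (2 * INR m + 1) (s - INR k)))%C by ring.
  replace (Cpow_neg PI (s - INR k) * Cpow_neg (2 * INR m + 1) (s - INR k))%C
    with (Cpow_neg (freq m) (s - INR k)).
  - unfold Cminus. rewrite Cpow_neg_plus, Cpow_neg_opp, Cpow_neg_nat by apply freq_pos.
    rewrite <- RtoC_inv, Rinv_inv by (apply Rinv_neq_0_compat, pow_nonzero, Rgt_not_eq, freq_pos). ring.
  - unfold Cpow_neg. rewrite <- Cexp_plus. f_equal. unfold freq. rewrite ln_mult by lra.
    rewrite !RtoC_opp, RtoC_plus. ring.
Qed.

Theorem theorem3 (n : nat) (a : nat -> C)
  (Ha : exists m, (m <= n)%nat /\ a m <> RtoC 0)
  (CF : C -> C)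
  (HCF : forall s : C,
     is_RInt_gen (V := C_R_CompleteNormedModule)
       (fun t : R => Cmult (phiF n a t) (Cexp (Cmult s (RtoC t))))
       (Rbar_locally m_infty) (Rbar_locally p_infty) (CF s))
  (k : nat)
  (Hk0 : forall j, (j < k)%nat -> Pderiv_at1 n a j = RtoC 0)
  (Hk : Pderiv_at1 n a k <> RtoC 0)
  (D1 D2 : R) (HD1 : 0 < D1) (HD2 : 0 < D2) (HD12 : D1 < D2)
  (Hpsi : forall s : C, - D2 < Re s < D1 ->
     psiF n a (Cminus s (RtoC (INR k))) <> RtoC 0)
  (delta : R) (Hdelta : 0 < delta < D1) :
  exists L : list C, forall z : C,
    CF z = RtoC 0 -> Rabs (Re z) <= delta -> ~ In z L ->
    Re z = 0 /\ simple_zero CF z.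
Proof.
  assert (HBI := CF_BI n a CF HCF). destruct Ha as [m0 [Hm0 Ham0]].
  assert (Hmom : forall j, (j < k)%nat -> mixed_moment n a j 0 = RtoC 0).
  { intros j Hj. apply (mixed_moment_vanish n a k Hk0). lia. }
  assert (Htop : mixed_moment n a k 0 <> RtoC 0) by (apply (mixed_moment_top n a k Hk0 Hk); lia).
  (* The zero-free strip contains |Re s| <= delta in its interior since delta < D1 < D2. *)
  destruct (expsum_lower_bound freq (fun m => a m * RtoC (freq m ^ k))%C (S n) m0 (- D2) (- delta) delta D1)
    as [eta [Peta Heta]].
  { apply freq_pos. }
  { apply freq_inj. }
  { lia. }
  { apply Cmult_neq_0; [exact Ham0|]. apply RtoC_neq0, pow_nonzero, Rgt_not_eq, freq_pos. }
  { lra. }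
  { lra. }
  { intros s Hs. rewrite <- psiF_expsum. apply Hpsi, Hs. }
  set (bk := Cmod (Cconj (mixed_moment n a k 0))).
  assert (Pbk : 0 < bk) by (unfold bk; rewrite Cmod_conj; apply Cmod_gt_0, Htop).
  assert (Pfk := INR_fact_lt_0 k).
  (* Lower bound for |hlead| on the strip, read off from [hlead_eq]. *)
  set (c0 := / INR (fact k) * (eta * bk)).
  assert (Pc0 : 0 < c0).
  { apply Rmult_lt_0_compat; [apply Rinv_0_lt_compat, Pfk|apply Rmult_lt_0_compat; assumption]. }
  destruct (hpart_bounds n a k delta) as [C1 [C2 [PC1 [PC2 HC]]]].
  (* Chosen so that the Lipschitz variation C2 h of [hpart] is K h times its lower bound c0 / 2. *)
  set (K := 2 * C2 / c0).
  assert (PK : 0 <= K) by (apply Rle_mult_inv_pos; lra).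
  (* The rate K pays for a possible decrease of [hpart], and the extra 1 yields the factor e^h. The
     width delta + k accounts for the argument s - k. *)
  destruct (Gam_growth (K + 1) (delta + INR k)) as [T0 [PT0 HT0]].
  { assert (A := pos_INR k). lra. }
  (* Above 2 C1 / c0 the error C1 / |Im s| is at most c0 / 2. *)
  set (T := Rmax T0 (Rmax 1 (2 * C1 / c0))).
  assert (T1 : T0 <= T) by apply Rmax_l.
  assert (T2 : 1 <= T) by rmax_le.
  assert (T3 : 2 * C1 / c0 <= T) by rmax_le.
  assert (Him : forall s : C, T <= Rabs (Im s) -> Im s <> 0).
  { intros s Hs E. rewrite E, Rabs_R0 in Hs. lra. }
  assert (Hlow : forall s, Rabs (Re s) <= delta -> T <= Rabs (Im s) -> c0 / 2 <= Cmod (hpart n a k s)).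
  { intros s Hs HT. destruct (HC s 0 Hs ltac:(lra) ltac:(lra)) as [H1 _].
    assert (H2 : c0 <= Cmod (hlead n a k s)).
    { rewrite hlead_eq, !Cmod_mult, Cmod_R. fold bk. unfold Rdiv.
      rewrite Rabs_mult, <- RPow_abs, Rabs_Ropp, Rabs_R1, pow1, Rmult_1_l.
      rewrite Rabs_pos_eq by (left; apply Rinv_0_lt_compat, Pfk). unfold c0.
      apply Rmult_le_compat_l; [left; apply Rinv_0_lt_compat, Pfk|].
      apply Rmult_le_compat_r; [lra|]. apply Heta. apply Rabs_le_between, Hs. }
    assert (H3 : C1 * / Rabs (Im s) <= c0 / 2).
    { apply Rle_div_l; [lra|].
      assert (H4 : 2 * C1 / c0 <= Rabs (Im s)) by lra. apply Rle_div_l in H4; lra. }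
    assert (D := Cmod_sub_rev (hlead n a k s) (hpart n a k s)). rewrite Cmod_minus_sym in D. lra. }
  assert (Hgam : forall s : C, T <= Rabs (Im s) -> GG n a s = (Gam (s - INR k) * hpart n a k s)%C).
  { intros s HT. apply GG_hpart; [apply Him, HT|exact Hmom]. }
  apply (symmetric_sum_zeros CF (GG n a) delta T).
  - lra.
  - intros z. apply (entire_at_ext _ _ _ (fun s => eq_sym (HBI s))). unfold dsum.
    apply (entire_at_csum (fun m s => csum (fun l => coef a m l * BI (freq m) (freq l) s)%C (S n))).
    intros m _. apply (entire_at_csum (fun l s => coef a m l * BI (freq m) (freq l) s)%C).
    intros l _. apply entire_at_scal, entire_at_BI; apply freq_pos.
  - intros s _ HT. apply CF_symmetric_sum; [exact HBI|apply Him, HT].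
  - intros s Hs HT. rewrite Hgam by exact HT. apply Cmult_neq_0.
    + apply Gam_neq0. rewrite Im_sub_R. apply Him, HT.
    + apply Cmod_pos_neq. assert (A := Hlow s Hs HT). lra.
  - intros s h Hs Hh Hsh HT. assert (Hs' := proj1 (Rabs_le_between _ _) Hs).
    assert (HT' : T <= Rabs (Im (s + h)%C)) by (rewrite Im_add_R; exact HT).
    rewrite (Hgam s HT), (Hgam _ HT'), !Cmod_mult.
    replace (s + h - INR k)%C with (s - INR k + h)%C by ring.
    set (w := (s - INR k)%C).
    assert (Rw : Re w = Re s - INR k) by (unfold w; simpl; unfold Re; ring).
    assert (Iw : Im w = Im s) by apply Im_sub_R.
    assert (Pk := pos_INR k).
    assert (G1 := HT0 w h ltac:(rewrite Rw; apply Rabs_le; lra) ltac:(lra) ltac:(rewrite Iw; lra)).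
    destruct (HC s h Hs ltac:(lra) ltac:(lra)) as [_ H1].
    assert (H2 := Hlow (s + h)%C). rewrite Re_Cplus in H2. simpl (Re (RtoC h)) in H2.
    specialize (H2 ltac:(apply Rabs_le; lra) HT').
    (* |hpart s| <= |hpart (s + h)| + C2 h <= (1 + K h) |hpart (s + h)|, by the lower bound at s +
       h. *)
    assert (H3 : Cmod (hpart n a k s) <= exp (K * h) * Cmod (hpart n a k (s + h))).
    { assert (D := Cmod_sub_rev (hpart n a k s) (hpart n a k (s + h))). rewrite Cmod_minus_sym in D.
      set (q := Cmod (hpart n a k (s + h))) in *.
      assert (X := exp_ineq1_le (K * h)).
      assert (Y : C2 * h <= K * h * q).
      { replace (C2 * h) with (K * h * (c0 / 2)) by (unfold K; field; lra).
        apply Rmult_le_compat_l; [apply Rmult_le_pos; lra|exact H2]. }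
      assert ((1 + K * h) * q <= exp (K * h) * q) by (apply Rmult_le_compat_r; lra). lra. }
    replace ((K + 1) * h) with (h + K * h) in G1 by ring. rewrite exp_plus in G1.
    apply Rle_trans with (exp h * (Cmod (Gam w) * (exp (K * h) * Cmod (hpart n a k (s + h))))).
    + apply Rmult_le_compat_l; [left; apply exp_pos|]. apply Rmult_le_compat_l; [apply Cmod_ge_0|exact H3].
    + replace (exp h * (Cmod (Gam w) * (exp (K * h) * Cmod (hpart n a k (s + h)))))
        with (exp h * exp (K * h) * Cmod (Gam w) * Cmod (hpart n a k (s + h))) by ring.
      apply Rmult_le_compat_r; [apply Cmod_ge_0|exact G1].
Qed.
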